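(* Let $T>0$, $H\in(\frac12,1)$, $\alpha\in(1-H,1)$, $\sigma\in\mathbb R\setminus\{0\}$, $x_0\in\mathbb R$, and let $f\in C_b^1$. Let $N\ge1$ be an integer, $h=T/N$, $t_n=nh$ for $n=0,1,\dots,N$, and define the Euler--Maruyama approximations recursively by $$x_n=x_0+\frac1{\Gamma(\alpha)}\sum_{j=1}^nf(x_{j-1})\int_{t_{j-1}}^{t_j}(t_n-s)^{\alpha-1}\,\mathrm ds+\frac{\sigma}{\Gamma(\alpha)}\int_0^{t_n}(t_n-s)^{\alpha-1}\,\mathrm dW_H(s),\qquad n=1,\dots,N.$$ Then for every $n\in\{1,2,\dots,N\}$ the law of $x_n$ is absolutely continuous with respect to the Lebesgue measure on $\mathbb R$.
   Context: $W_H$ is a fractional Brownian motion with Hurst index $H$ (centered Gaussian process with covariance $H(2H-1)\int_0^t\int_0^s|u-v|^{2H-2}\mathrm du\,\mathrm dv$) on a complete filtered probability space $(\Omega,\mathscr F,\{\mathscr F_t\}_{t\in[0,T]},\mathbb P)$ satisfying the usual conditions. The stochastic integral of a deterministic function against $W_H$ is the Wiener integral: the isometric extension of $\mathbf 1_{[0,t]}\mapsto W_H(t)$ to the Hilbert space $\mathcal H$ obtained by closing the step functions on $[0,T]$ under the scalar product $\langle\varphi,\phi\rangle_{\mathcal H}=H(2H-1)\int_0^T\int_0^T\varphi(u)\phi(v)|u-v|^{2H-2}\mathrm du\,\mathrm dv$. $\Gamma$ is the Gamma function. For an integer $m\ge1$, $C_b^m$ is the space of (not necessarily bounded) functions $f:\mathbb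 R\to\mathbb R$ whose derivatives of orders $1,\dots,m$ exist, are continuous and bounded. *)

(* Defs.v *)
From HB Require Import structures.
From mathcomp Require Import all_boot all_order all_algebra.
From mathcomp Require Import all_classical all_reals all_analysis.

Set Implicit Arguments.
Unset Strict Implicit.
Unset Printing Implicit Defensive.

Import Order.TTheory GRing.Theory Num.Theory.
Import numFieldNormedType.Exports.

Local Open Scope classical_set_scope.
Local Open Scope ring_scope.

Definition Gamma {R : realType} (a : R) : R :=
  \int[lebesgue_measure]_(t in `]0, +oo[) (t `^ (a - 1) * expR (- t)).

(** The function itself is not required to be bounded, only its derivatives
    of orders [1, ..., m]. *)
Definition Cb {R : realType} (m : nat) (f : R -> R) : Prop :=
  forall k : nat, (k < m)%N ->
    [/\ forall y : R, derivable (f^`(k))%classic y 1,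
        continuous (f^`(k.+1))%classic &
        exists M : R, forall y : R, `|(f^`(k.+1))%classic y| <= M].

Definition usual_conditions d (Omega : measurableType d) (R : realType)
    (P : probability Omega R) (T : R) (F : R -> set (set Omega)) : Prop :=
  [/\ measure_is_complete P,
      forall t, t \in `[0, T] ->
        sigma_algebra [set: Omega] (F t) /\ F t `<=` measurable,
      forall s t, 0 <= s -> s <= t -> t <= T -> F s `<=` F t,
      P.-negligible `<=` F 0 &
      forall t, 0 <= t -> t < T -> F t = \bigcap_(s in `]t, T]) F s].

(** [normal_prob m 0] is not the Dirac mass at [m] in the library, hence the
    separate degenerate case. The equality is only required on Borel sets,
    the values of set functions elsewhere being meaningless. *)
Definition gaussian_law {R : realType} (mu : set R -> \bar R) : Prop :=
  exists m s : R, forall A : set R, measurable A ->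
    mu A = if s == 0 then \d_m A else normal_prob m s A.

(** The list [c] of pairs [(a_i, t_i)] encodes the step function
    [\sum_i a_i 1_[0, t_i]]; its integral against [W] is [\sum_i a_i W(t_i)]. *)
Definition step_fun {R : realType} (c : seq (R * R)) (u : R) : R :=
  \sum_(p <- c) p.1 * \1_`[0, p.2] u.

Definition step_integral d (Omega : measurableType d) (R : realType)
    (P : probability Omega R) (W : R -> {RV P >-> R}) (c : seq (R * R)) :
    {RV P >-> R} :=
  (\sum_(p <- c) p.1 *: (W p.2 : {mfun Omega >-> R}) : {mfun Omega >-> R}).

Definition nodes_in {R : realType} (T : R) (c : seq (R * R)) : bool :=
  all (fun p => p.2 \in `[0, T]) c.

(** Finite-dimensional laws are Gaussian iff all linear combinations of the
    coordinates are; this is taken as the definition of a Gaussian vector. *)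
Definition gaussian_process d (Omega : measurableType d) (R : realType)
    (P : probability Omega R) (T : R) (W : R -> {RV P >-> R}) : Prop :=
  forall c : seq (R * R), nodes_in T c ->
    gaussian_law (distribution P (step_integral W c)).

Definition fbm_cov {R : realType} (H t s : R) : R :=
  H * (2 * H - 1) *
  \int[lebesgue_measure]_(v in `[0, t])
    \int[lebesgue_measure]_(u in `[0, s]) (`|u - v| `^ (2 * H - 2)).

Definition fractional_brownian_motion d (Omega : measurableType d)
    (R : realType) (P : probability Omega R) (H T : R)
    (W : R -> {RV P >-> R}) : Prop :=
  [/\ gaussian_process T W,
      forall t, t \in `[0, T] -> ('E_P[W t] = 0)%E &
      forall t s, t \in `[0, T] -> s \in `[0, T] ->
        covariance P (W t) (W s) = (fbm_cov H t s)%:E].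

Definition innerH {R : realType} (H T : R) (phi psi : R -> R) : R :=
  H * (2 * H - 1) *
  \int[lebesgue_measure]_(v in `[0, T])
    \int[lebesgue_measure]_(u in `[0, T])
      (phi u * psi v * `|u - v| `^ (2 * H - 2)).

(** Functions whose scalar products [innerH] converge absolutely; they all
    belong to the closure of the step functions. *)
Definition mem_absH {R : realType} (H T : R) (phi : R -> R) : Prop :=
  measurable_fun `[0, T] phi /\
  (lebesgue_measure \x lebesgue_measure)%E.-integrable
    (`[0, T] `*` `[0, T])
    (fun z : R * R => (phi z.1 * phi z.2 * `|z.1 - z.2| `^ (2 * H - 2))%:E).

(** [I] is (a version of) the Wiener integral of [phi]: the value at [phi] of
    the continuous extension of [step_fun c |-> step_integral W c] from the
    norm of [innerH] to [L^2(P)]. *)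
Definition is_wiener_integral d (Omega : measurableType d) (R : realType)
    (P : probability Omega R) (H T : R) (W : R -> {RV P >-> R})
    (phi : R -> R) (I : {RV P >-> R}) : Prop :=
  mem_absH H T phi /\
  exists c : nat -> seq (R * R),
    [/\ forall k, nodes_in T (c k),
        (fun k => innerH H T (step_fun (c k) \- phi) (step_fun (c k) \- phi))
          @ \oo --> (0 : R) &
        (fun k => 'E_P[fun w => ((step_integral W (c k) w - I w) ^+ 2)%R]%E)
          @ \oo --> (0%E : \bar R)].

(* Main.v *)
(* Write x_n = U + c Z with c = sigma / Gamma alpha, where Z is the residual of
   the Wiener integral I_n in its L^2-projection on I_1, ..., I_(n-1) and U is
   measurable with respect to the latter. All linear combinations of the I_k are
   Gaussian, so Z is independent of U; given U the law of x_n is Gaussian, and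
   it is nondegenerate as soon as Z has positive variance.

   Positivity comes from the mixture formula, valid for -1 < e < 0,
     e (e - 1) \int\int_(z < min(u, v), max(u, v) < y) (y - z)^(e - 2) dy dz
       = |u - v|^e,
   which turns innerH phi phi into a weighted integral of (\int_z^y phi)^2 over
   z < y. This is nonnegative, satisfies the Cauchy-Schwarz inequality, and is
   positive for the integrand of Z, which equals (t_n - s)^(alpha - 1) on the
   last interval ]t_(n-1), t_n[.

   Laws and independence are recovered from the integrals of cos (b X + th): the
   bounded functions integrated correctly form a class closed under linear
   combinations and bounded pointwise limits, and this class contains the
   indicators of half-lines. *)

Require Import Defs.
From HB Require Import structures.
From mathcomp Require Import all_boot all_order all_algebra.
From mathcomp Require Import all_classical all_reals all_analysis.
From mathcomp Require Import measurable_realfun ring lra.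

Set Implicit Arguments.
Unset Strict Implicit.
Unset Printing Implicit Defensive.

Import Order.TTheory GRing.Theory Num.Theory.
Import numFieldNormedType.Exports.

Local Open Scope classical_set_scope.
Local Open Scope ring_scope.

(** Only the positivity of the variance of Z matters, so no isometry is established for limits: an
    inequality between energy and variance, up to a factor 2, suffices and survives the L^2 limit.
    The recurring obstacle is absolute convergence. A divergent real integral has the default value
    0, and [innerH] and [fbm_cov] are iterated integrals, so every energy is first shown to converge
    absolutely; the kernels (t_n - s)^(alpha - 1) get this from [mem_absH], the indicators by
    domination.

    The free phase th does the work of complex exponentials: it encodes the sine as well, and the
    product-to-sum formulas bring products of cosines back to sums of cosines. Centered Gaussian
    variables are handled through E cos (X + th) = exp (- E X^2 / 2) cos th, an identity that passes
    to L^2 limits and covers variance 0.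

    Positivity is proved for the residual of each I_k, k <= n, with arbitrary coefficients on the
    earlier integrals; this is also what lets the projection be built by Gram-Schmidt without a
    degenerate case. *)

Section real_integrable.
Context d (T : measurableType d) (R : realType) (mu : {measure set T -> \bar R}).
Context (D : set T) (mD : measurable D).
Implicit Types f g : T -> R.

Lemma integrableZl_EFin (a : R) f : mu.-integrable D (EFin \o f) ->
  mu.-integrable D (EFin \o (fun x => a * f x)).
Proof. by move=> h; exact: (integrableZl mD a h). Qed.

Lemma integrableD_EFin f g : mu.-integrable D (EFin \o f) ->
  mu.-integrable D (EFin \o g) ->
  mu.-integrable D (EFin \o (fun x => f x + g x)).
Proof. by move=> hf hg; exact: (integrableD mD hf hg). Qed.

Lemma integrableB_EFin f g : mu.-integrable D (EFin \o f) ->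
  mu.-integrable D (EFin \o g) ->
  mu.-integrable D (EFin \o (fun x => f x - g x)).
Proof. by move=> hf hg; exact: (integrableB mD hf hg). Qed.

Lemma le_integrable_EFin f g : measurable_fun D f ->
  (forall x, D x -> `|f x| <= g x) -> mu.-integrable D (EFin \o g) ->
  mu.-integrable D (EFin \o f).
Proof.
move=> mf fg; apply: le_integrable => //; first exact/measurable_EFinP.
by move=> x Dx; rewrite lee_fin (le_trans (fg _ Dx))// ler_norm.
Qed.

End real_integrable.

(** * Energies of kernels that are mixtures of squares *)

Section square_measure.
Context d (T : measurableType d) (R : realType).
Context (m : {sigma_finite_measure set T -> \bar R}).

(** The product gets a name of its own so as to carry a sigma-finite structure: it is in turn a
    factor of [m2 \x nu], or the mixing measure [nu] itself. *)
Definition square_measure : set (T * T) -> \bar R := (m \x m)%E.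

HB.instance Definition _ := Measure.on square_measure.

Let square_measure_sigma_finite : sigma_finite setT square_measure.
Proof.
have /sigma_finiteP[F [TF ndF Foo]] := sigma_finiteT m.
exists (fun n => F n `*` F n).
  rewrite -setXTT TF predeqE => -[x y]; split.
    move=> [/= [n _ Fnx] [k _ Gky]]; exists (maxn n k) => //; split.
    - by move: x Fnx; exact/subsetPset/ndF/leq_maxl.
    - by move: y Gky; exact/subsetPset/ndF/leq_maxr.
  by move=> [n _ []/= ? ?]; split; exists n.
move=> k; have [? ?] := Foo k.
split; first exact: measurableX.
by rewrite /square_measure product_measure1E// lte_mul_pinfty// ge0_fin_numE.
Qed.

HB.instance Definition _ := Measure_isSigmaFinite.Build _ _ _ square_measure
  square_measure_sigma_finite.

Lemma measurable_tensor (f g : T -> R) :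
  measurable_fun setT f -> measurable_fun setT g ->
  measurable_fun setT (fun x : T * T => f x.1 * g x.2).
Proof.
move=> mf mg; apply: measurable_funM.
  exact: (measurableT_comp mf measurable_fst).
exact: (measurableT_comp mg measurable_snd).
Qed.

Lemma EFin_Rintegral d' (T' : measurableType d')
    (m' : {measure set T' -> \bar R}) (k : T' -> R) :
  m'.-integrable setT (EFin \o k) ->
  (\int[m']_u (k u)%:E = (\int[m']_u k u)%:E)%E.
Proof. by move=> h; rewrite /Rintegral fineK//; exact: integrable_fin_num. Qed.

(** Tonelli on [|k|] gives integrability; Fubini then factors the signed integral. With
    [k u = f u * b (s, u)] each layer of a mixture becomes a square. *)
Lemma tensor_square (k : T -> R) : m.-integrable setT (EFin \o k) ->
  square_measure.-integrable setT (EFin \o (fun x => k x.1 * k x.2)) /\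
  (\int[square_measure]_x (k x.1 * k x.2)%:E = ((\int[m]_u k u) ^+ 2)%:E)%E.
Proof.
move=> intk; have /measurable_EFinP mk := measurable_int _ intk.
have intkk : square_measure.-integrable setT (EFin \o (fun x => k x.1 * k x.2)).
  have mkk : measurable_fun setT (EFin \o (fun x : T * T => k x.1 * k x.2)).
    by apply/measurable_EFinP; exact: measurable_tensor.
  apply/(integrable12ltyP m m mkk) => /=.
  have [_ fink] := integrableP _ _ _ intk.
  under eq_integral => u _.
    under eq_integral => v _ do rewrite normrM EFinM.
    rewrite ge0_integralZl//; last by apply/measurable_EFinP; exact: measurableT_comp.
    over.
  rewrite ge0_integralZr//.
  - rewrite lte_mul_pinfty//; first exact: integral_ge0.
    by rewrite ge0_fin_numE//; exact: integral_ge0.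
  - by apply/measurable_EFinP; exact: measurableT_comp.
  - exact: integral_ge0.
split => //; move: intkk; rewrite /square_measure => intkk.
rewrite -(integral12_prod_meas1 intkk)/fubini_F/=.
have kE := EFin_Rintegral intk.
under eq_integral => u _.
  under eq_integral => v _ do rewrite EFinM.
  rewrite integralZl// kE; over.
rewrite /=.
by rewrite integralZr// kE -EFinM expr2.
Qed.

End square_measure.

(** The inner integral is finite for almost every [y], so taking [fine] inside is harmless. This is
    the link with the iterated integrals of [innerH] and [fbm_cov]. *)
Lemma Rintegral21_prod d1 d2 (T1 : measurableType d1) (T2 : measurableType d2)
    (R : realType) (m1 : {sigma_finite_measure set T1 -> \bar R})
    (m2 : {sigma_finite_measure set T2 -> \bar R}) (f : T1 * T2 -> R) :
  (m1 \x m2)%E.-integrable setT (EFin \o f) ->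
  \int[m2]_y \int[m1]_x f (x, y) = \int[(m1 \x m2)%E]_z f z.
Proof.
move=> intf; rewrite /Rintegral -(integral21_prod_meas1 intf); congr fine.
have mG := measurable_fubini_G intf.
apply: ae_eq_integral => //.
- apply/measurable_EFinP.
  exact: (measurableT_comp (@fine_measurable R setT measurableT) mG).
- have := ae_integrable2 intf; apply: filterS => y iy _.
  by rewrite fineK//; exact: integrable_fin_num.
Qed.

Section mixture_kernel.
Context d1 d2 (T : measurableType d1) (S : measurableType d2) (R : realType).
Context (m : {sigma_finite_measure set T -> \bar R}).
Context (nu : {sigma_finite_measure set S -> \bar R}).
Context (b : S * T -> R) (w : S -> R) (k : T * T -> R) (N : set (T * T)).
Hypothesis mb : measurable_fun setT b.
Hypothesis b01 : forall p, 0 <= b p <= 1.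
Hypothesis mw : measurable_fun setT w.
Hypothesis w0 : forall s, 0 <= w s.
Hypothesis mk : measurable_fun setT k.
Hypothesis k0 : forall x, 0 <= k x.
Hypothesis mN : measurable N.
Hypothesis N0 : (m \x m)%E N = 0%E.
Hypothesis kN : forall x, ~ N x ->
  (\int[nu]_s (b (s, x.1) * b (s, x.2) * w s)%:E = (k x)%:E)%E.
Local Notation m2 := (square_measure m).

(** The energy of [f] is the integral of the squares of these coefficients with weight [w]; for the
    Riesz kernel they are the integrals of [f] over intervals. *)
Definition mixture_coef (f : T -> R) (s : S) : R := \int[m]_u (f u * b (s, u)).

Let b_ge0 p : 0 <= b p. Proof. by have /andP[] := b01 p. Qed.
Let b_le1 p : b p <= 1. Proof. by have /andP[] := b01 p. Qed.

Let mbs s : measurable_fun setT (fun u => b (s, u)).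
Proof. exact: (measurableT_comp mb (pair1_measurable s)). Qed.

Let mbu u : measurable_fun setT (fun s => b (s, u)).
Proof. exact: (measurableT_comp mb (pair2_measurable u)). Qed.

Lemma integrable_mixture (f : T -> R) s : m.-integrable setT (EFin \o f) ->
  m.-integrable setT (EFin \o (fun u => f u * b (s, u))).
Proof.
move=> intf; have /measurable_EFinP mf := measurable_int _ intf.
apply: (@le_integrable_EFin _ _ _ m setT measurableT _ (fun u => `|f u|)).
- by apply: measurable_funM => //.
- move=> u _; rewrite normrM -[leRHS]mulr1 ler_wpM2l//.
  by rewrite ger0_norm.
- exact: integrable_norm.
Qed.

Let Phi (f : T -> R) (p : (T * T) * S) : R :=
  f p.1.1 * f p.1.2 * (b (p.2, p.1.1) * b (p.2, p.1.2) * w p.2).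

Let measurable_Phi f : measurable_fun setT f -> measurable_fun setT (Phi f).
Proof.
move=> mf.
have m11 : measurable_fun setT (fun p : (T * T) * S => p.1.1).
  exact: (measurableT_comp measurable_fst measurable_fst).
have m12 : measurable_fun setT (fun p : (T * T) * S => p.1.2).
  exact: (measurableT_comp measurable_snd measurable_fst).
apply: measurable_funM.
  apply: measurable_funM; first exact: (measurableT_comp mf m11).
  exact: (measurableT_comp mf m12).
apply: measurable_funM; last exact: (measurableT_comp mw measurable_snd).
apply: measurable_funM.
  apply: (measurableT_comp mb (g := fun p : (T * T) * S => (p.2, p.1.1))).
  exact: measurable_fun_pair.
apply: (measurableT_comp mb (g := fun p : (T * T) * S => (p.2, p.1.2))).
exact: measurable_fun_pair.
Qed.

Let Phi_int1 f s : m.-integrable setT (EFin \o f) ->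
  (\int[m2]_x (Phi f (x, s))%:E = (w s * mixture_coef f s ^+ 2)%:E)%E.
Proof.
move=> intf; have [ik ek] := tensor_square (integrable_mixture s intf).
rewrite EFinM -ek -integralZl//; apply: eq_integral => x _.
by rewrite -EFinM /Phi/=; congr EFin; ring.
Qed.

Let Phi_int2 (f : T -> R) x : (forall u, 0 <= f u) -> ~ N x ->
  (\int[nu]_s (Phi f (x, s))%:E = (f x.1 * f x.2 * k x)%:E)%E.
Proof.
move=> f0 Nx; rewrite EFinM -kN// -ge0_integralZl//.
- apply/measurable_EFinP; apply: measurable_funM => //.
  by apply: measurable_funM; exact: mbu.
- by move=> s _; rewrite lee_fin !mulr_ge0.
- by rewrite lee_fin mulr_ge0.
Qed.

(** Tonelli gives measurability for nonnegative functions, hence the split into positive and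
    negative parts. *)
Lemma measurable_mixture_coef f : m.-integrable setT (EFin \o f) ->
  measurable_fun setT (mixture_coef f).
Proof.
move=> intf; have /measurable_EFinP mf := measurable_int _ intf.
have J (f' : T -> R) : measurable_fun setT f' -> (forall u, 0 <= f' u) ->
    measurable_fun setT (mixture_coef f').
  move=> mf' f'0; have mF : measurable_fun setT (fun p : S * T => (f' p.2 * b p)%:E).
    apply/measurable_EFinP; apply: measurable_funM => //.
    exact: (measurableT_comp mf' measurable_snd).
  have F0 p : (0 <= (f' p.2 * b p)%:E)%E by rewrite lee_fin mulr_ge0.
  have mG := @measurable_fun_fubini_tonelli_F _ _ _ _ R m _ mF F0.
  exact: (measurableT_comp (@fine_measurable R setT measurableT) mG).
have nf := integrable_norm intf.
pose fp u := Num.max (f u) 0; pose fn u := Num.max (- f u) 0.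
have mfp : measurable_fun setT fp by exact: measurable_maxr.
have mfn : measurable_fun setT fn by apply: measurable_maxr => //; exact: measurableT_comp.
have fp0 u : 0 <= fp u by rewrite le_max lexx orbT.
have fn0 u : 0 <= fn u by rewrite le_max lexx orbT.
have fE u : f u = fp u - fn u.
  rewrite /fp /fn /Num.max; case: ltP => h1; case: ltP => h2; lra.
have fabs u : `|f u| = fp u + fn u.
  rewrite /fp /fn /Num.max; case: ltP => h1; case: ltP => h2;
    by [rewrite ler0_norm; lra | rewrite ger0_norm; lra].
have ifp : m.-integrable setT (EFin \o fp).
  apply: (@le_integrable_EFin _ _ _ m setT measurableT _ (fun u => `|f u|)) => //.
  by move=> u _; rewrite fabs ger0_norm// lerDl.
have ifn : m.-integrable setT (EFin \o fn).
  apply: (@le_integrable_EFin _ _ _ m setT measurableT _ (fun u => `|f u|)) => //.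
  by move=> u _; rewrite fabs ger0_norm// lerDr.
rewrite (_ : mixture_coef f = (fun s => mixture_coef fp s - mixture_coef fn s)); last first.
  apply/funext => s; rewrite /mixture_coef -RintegralB//; try exact: integrable_mixture.
  by apply: eq_Rintegral => u _; rewrite fE mulrBl.
by apply: measurable_funB; exact: J.
Qed.

Let mwJ (f : T -> R) : m.-integrable setT (EFin \o f) ->
  measurable_fun setT (fun s => (w s * mixture_coef f s ^+ 2)%:E).
Proof.
move=> intf; apply/measurable_EFinP; apply: measurable_funM => //.
by apply: measurable_funX; exact: measurable_mixture_coef.
Qed.

Let wJ0 (f : T -> R) s : (0 <= (w s * mixture_coef f s ^+ 2)%:E)%E.
Proof. by rewrite lee_fin mulr_ge0 ?sqr_ge0. Qed.

(** The second identity keeps the integral over [s], which may differ from [k] on the null set [N];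
    it is the form in which Fubini's integrability criterion is checked in [energyE]. *)
Lemma mixture_tonelli (f : T -> R) : m.-integrable setT (EFin \o f) ->
  (forall u, 0 <= f u) ->
  (\int[m2]_x (f x.1 * f x.2 * k x)%:E =
   \int[nu]_s (w s * mixture_coef f s ^+ 2)%:E)%E /\
  (\int[m2]_x \int[nu]_s (Phi f (x, s))%:E =
   \int[nu]_s (w s * mixture_coef f s ^+ 2)%:E)%E.
Proof.
move=> intf f0; have /measurable_EFinP mf := measurable_int _ intf.
have mEPhi : measurable_fun setT (EFin \o Phi f).
  by apply/measurable_EFinP; exact: measurable_Phi.
have Phi0 p : (0 <= (EFin \o Phi f) p)%E.
  by rewrite lee_fin /Phi !mulr_ge0.
have F := @fubini_tonelli _ _ _ _ R m2 nu (EFin \o Phi f) mEPhi Phi0.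
have e2 : (\int[m2]_x \int[nu]_s (Phi f (x, s))%:E =
   \int[nu]_s (w s * mixture_coef f s ^+ 2)%:E)%E.
  by rewrite F; apply: eq_integral => s _; rewrite Phi_int1.
split => //; rewrite -e2; apply: ge0_ae_eq_integral => //.
- apply/measurable_EFinP; apply: measurable_funM => //.
  exact: measurable_tensor.
- exact: (@measurable_fun_fubini_tonelli_F _ _ _ _ R nu (EFin \o Phi f) mEPhi Phi0).
- by move=> x _; rewrite lee_fin !mulr_ge0.
- by move=> x _; apply: integral_ge0 => s _; exact: Phi0.
exists N; split => // x /=; apply: contra_notP => Nx _.
by rewrite Phi_int2.
Qed.

(** Integrability of [f] alone is included so that every [mixture_coef f s] is a genuine
    integral. *)
Definition finite_energy (f : T -> R) : Prop := m.-integrable setT (EFin \o f) /\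
  m2.-integrable setT (EFin \o (fun x => f x.1 * f x.2 * k x)).

(** In this form the condition is a weighted L^2 bound on the coefficients of [|f|], which are
    subadditive in [f]; the vector space structure follows from it. *)
Lemma finite_energyP (f : T -> R) : finite_energy f <->
  m.-integrable setT (EFin \o f) /\
  (\int[nu]_s (w s * mixture_coef (fun u => `|f u|) s ^+ 2)%:E < +oo)%E.
Proof.
have aux : m.-integrable setT (EFin \o f) ->
    (\int[m2]_x `|(f x.1 * f x.2 * k x)%:E| =
     \int[nu]_s (w s * mixture_coef (fun u => `|f u|) s ^+ 2)%:E)%E.
  move=> intf; have nf := integrable_norm intf.
  have [<- _] := mixture_tonelli nf (fun u => normr_ge0 _).
  by apply: eq_integral => x _ /=; rewrite !normrM (ger0_norm (k0 x)).
split=> -[intf h]; split => //.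
  by have [_] := integrableP _ _ _ h; rewrite aux.
have /measurable_EFinP mf := measurable_int _ intf.
apply/integrableP; split; last by rewrite aux.
by apply/measurable_EFinP; apply: measurable_funM => //; exact: measurable_tensor.
Qed.

Lemma finite_energyZD (a : R) (f g : T -> R) : finite_energy f -> finite_energy g ->
  finite_energy (fun u => a * f u + g u).
Proof.
move=> /finite_energyP[intf Ef] /finite_energyP[intg Eg]; apply/finite_energyP.
have intafg : m.-integrable setT (EFin \o (fun u => a * f u + g u)).
  by apply: integrableD_EFin => //; exact: integrableZl_EFin.
split; first exact: intafg.
have nf := integrable_norm intf; have ng := integrable_norm intg.
have nafg := integrable_norm intafg.
have J0 (f' : T -> R) s : 0 <= mixture_coef (fun u => `|f' u|) s.
  by apply: Rintegral_ge0 => u _; rewrite mulr_ge0.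
pose E (f' : T -> R) s := (w s * mixture_coef (fun u => `|f' u|) s ^+ 2)%:E.
apply: (@le_lt_trans _ _ (\int[nu]_s ((2 * a ^+ 2)%:E * E f s + 2%:E * E g s))%E).
  apply: ge0_le_integral => //.
  - exact: mwJ.
  - by apply: emeasurable_funD; apply: measurable_funeM; exact: mwJ.
  move=> s _; rewrite /E -!EFinM -EFinD lee_fin.
  have h : mixture_coef (fun u => `|a * f u + g u|) s <=
      `|a| * mixture_coef (fun u => `|f u|) s + mixture_coef (fun u => `|g u|) s.
    have if_ := integrable_mixture s nf; have ig := integrable_mixture s ng.
    rewrite /mixture_coef -RintegralZl// -RintegralD//; last exact: integrableZl_EFin.
    apply: le_Rintegral => //.
    - exact: (integrable_mixture s nafg).
    - by apply: integrableD_EFin => //; exact: integrableZl_EFin.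
    move=> u _; rewrite mulrA -mulrDl ler_wpM2r//.
    by rewrite (le_trans (ler_normD _ _))// normrM.
  move: h (J0 (fun u => a * f u + g u) s) (J0 f s) (J0 g s) (normr_ge0 a) (w0 s).
  rewrite -[a ^+ 2]real_normK ?num_real//.
  set x := mixture_coef _ _; set y := mixture_coef _ _; set z := mixture_coef _ _.
  move: `|a| x y z (w s) => c x y z v h x0 y0 z0 c0 v0.
  rewrite (_ : _ + _ = v * (2 * c ^+ 2 * y ^+ 2 + 2 * z ^+ 2)); last by ring.
  rewrite ler_wpM2l//.
  have h2 : x ^+ 2 <= (c * y + z) ^+ 2.
    by rewrite ler_pXn2r ?nnegrE// addr_ge0// mulr_ge0.
  apply: (le_trans h2); rewrite -subr_ge0.
  by rewrite [leRHS](_ : _ = (c * y - z) ^+ 2) ?sqr_ge0//; ring.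
have mE f' : m.-integrable setT (EFin \o f') -> measurable_fun setT (E f').
  by move=> i; apply: mwJ; exact: integrable_norm.
have E0 f' s : (0 <= E f' s)%E by exact: wJ0.
have a0 : (0 <= (2 * a ^+ 2)%:E)%E by rewrite lee_fin mulr_ge0 ?sqr_ge0.
rewrite ge0_integralD//; last 4 first.
- by move=> s _; rewrite mule_ge0.
- by apply: measurable_funeM; exact: mE.
- by move=> s _; rewrite mule_ge0.
- by apply: measurable_funeM; exact: mE.
rewrite ge0_integralZl//; last exact: mE.
rewrite ge0_integralZl//; last exact: mE.
apply: lte_add_pinfty; apply: lte_mul_pinfty; [exact: a0|by []|exact: Ef|by []|by []|exact: Eg].
Qed.

(** The tensor of [f] and [g] is dominated by the tensor square of [|f| + |g|], whose energy is
    finite by [finite_energyZD]. *)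
Lemma finite_energy_cross (f g : T -> R) : finite_energy f -> finite_energy g ->
  m2.-integrable setT (EFin \o (fun x => f x.1 * g x.2 * k x)).
Proof.
move=> ef eg.
have enorm (f' : T -> R) : finite_energy f' -> finite_energy (fun u => `|f' u|).
  move=> /finite_energyP[i E]; apply/finite_energyP; split; first exact: integrable_norm.
  by have -> : (fun u => `| `|f' u| |) = (fun u => `|f' u|) by apply/funext => u; rewrite normr_id.
have [_ h] := finite_energyZD 1 (enorm _ ef) (enorm _ eg).
have [/(measurable_int m)/measurable_EFinP mf _] := ef.
have [/(measurable_int m)/measurable_EFinP mg _] := eg.
apply: le_integrable_EFin h => //.
  by apply: measurable_funM => //; exact: measurable_tensor.
move=> x _; rewrite !normrM (ger0_norm (k0 x)) ler_wpM2r// !mul1r.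
by rewrite ler_pM// ?lerDl ?lerDr.
Qed.

(** Setting [f] to 0 on [M] gives [f1], dominated everywhere. The return from [f1] to [f] goes
    through [finite_energyP], where [f] enters only through integrals against [m], so that a null
    set of [m] is enough. *)
Lemma finite_energy_le_ae (f g : T -> R) (c : R) (M : set T) : 0 <= c ->
  measurable_fun setT f -> measurable M -> m M = 0%E ->
  (forall u, ~ M u -> `|f u| <= c * `|g u|) -> finite_energy g -> finite_energy f.
Proof.
move=> c0 mf mM M0 fg [intg eg].
pose f1 u := f u * \1_(~` M) u.
have f1E u : ~ M u -> f1 u = f u.
  by move=> Mu; rewrite /f1 indicE mem_set// mulr1.
have mf1 : measurable_fun setT f1.
  by apply: measurable_funM => //; apply: measurable_indic; exact: measurableC.
have f1g u : `|f1 u| <= c * `|g u|.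
  have [Mu|nMu] := pselect (M u); last by rewrite f1E// fg.
  by rewrite /f1 indicE memNset ?mulr0 ?normr0 ?mulr_ge0//; exact.
clearbody f1.
have i1 : m.-integrable setT (EFin \o f1).
  apply: (@le_integrable_EFin _ _ _ m setT measurableT _ (fun u => c * `|g u|)) => //.
  by apply: integrableZl_EFin => //; exact: integrable_norm.
have e1 : finite_energy f1.
  split => //; apply: (@le_integrable_EFin _ _ _ m2 setT measurableT _
    (fun x => c ^+ 2 * `|g x.1 * g x.2 * k x|)).
  - by apply: measurable_funM => //; exact: measurable_tensor.
  - move=> x _; rewrite !normrM.
    rewrite [leRHS](_ : _ = c ^+ 2 * (`|g x.1| * `|g x.2|) * `|k x|); last by ring.
    rewrite ler_wpM2r//.
    rewrite [leRHS](_ : _ = (c * `|g x.1|) * (c * `|g x.2|)); last by ring.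
    by rewrite ler_pM.
  - by apply: integrableZl_EFin => //; exact: integrable_norm.
have ae (h : T -> R -> \bar R) : measurable_fun setT (fun u => h u (f u)) ->
    measurable_fun setT (fun u => h u (f1 u)) ->
    (\int[m]_u h u (f u) = \int[m]_u h u (f1 u))%E.
  move=> mh mh1; apply: ae_eq_integral => //.
  exists M; split => // u /=; apply: contra_notP => Mu _.
  by rewrite f1E.
apply/finite_energyP; split.
  apply/integrableP; split; first exact/measurable_EFinP.
  have /integrableP[_] := i1.
  rewrite (ae (fun u x => `|x%:E|%E))//; apply: measurableT_comp => //;
    exact/measurable_EFinP.
have /finite_energyP[_] := e1.
rewrite (_ : mixture_coef (fun u => `|f u|) = mixture_coef (fun u => `|f1 u|))//.
apply/funext => s; rewrite /mixture_coef /Rintegral; congr fine.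
rewrite (ae (fun u x => (`|x| * b (s, u))%:E))//; apply/measurable_EFinP;
  by apply: measurable_funM => //; exact: measurableT_comp.
Qed.

Definition energy (f g : T -> R) : R := \int[m2]_x (f x.1 * g x.2 * k x).

(** Fubini replaces Tonelli for [f] of any sign; the integrability that it needs is
    [mixture_tonelli] for [|f|]. *)
Lemma energyE (f : T -> R) : finite_energy f ->
  nu.-integrable setT (EFin \o (fun s => w s * mixture_coef f s ^+ 2)) /\
  energy f f = \int[nu]_s (w s * mixture_coef f s ^+ 2).
Proof.
move=> ef; have [intf ekf] := ef; have /finite_energyP[_ Ef] := ef.
have /measurable_EFinP mf := measurable_int _ intf.
have nf := integrable_norm intf.
have mEPhi : measurable_fun setT (EFin \o Phi f).
  by apply/measurable_EFinP; exact: measurable_Phi.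
have iPhi : (m2 \x nu)%E.-integrable setT (EFin \o Phi f).
  apply/(integrable12ltyP m2 nu mEPhi).
  have [_ e2] := mixture_tonelli nf (fun u => normr_ge0 _).
  rewrite [X in (X < _)%E](_ : _ = (\int[m2]_x \int[nu]_s (Phi (fun u => `|f u|) (x, s))%:E)%E).
    by rewrite e2.
  apply: eq_integral => x _; apply: eq_integral => s _ /=.
  by congr EFin; rewrite /Phi/= 2!normrM [X in _ * X]ger0_norm// !mulr_ge0.
have iG : nu.-integrable setT (EFin \o (fun s => w s * mixture_coef f s ^+ 2)).
  apply/integrableP; split; first exact: mwJ.
  apply: (le_lt_trans _ Ef); apply: ge0_le_integral => //.
  - by apply: measurableT_comp => //; exact: mwJ.
  - exact: mwJ.
  move=> s _ /=; rewrite lee_fin normrM (ger0_norm (w0 s)) ler_wpM2l//.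
  rewrite (ger0_norm (sqr_ge0 _)).
  rewrite -[leLHS]real_normK ?num_real// ler_pXn2r ?nnegrE//; last first.
    by apply: Rintegral_ge0 => u _; rewrite mulr_ge0.
  have ifb := integrable_mixture s intf.
  apply: (le_trans (le_normr_Rintegral measurableT ifb)).
  rewrite /mixture_coef [leLHS](_ : _ = \int[m]_u (`|f u| * b (s, u)))//.
  by apply: eq_Rintegral => u _; rewrite normrM [X in _ * X]ger0_norm.
have GE : fubini_G m2 (EFin \o Phi f) = EFin \o (fun s => w s * mixture_coef f s ^+ 2).
  by apply/funext => s; rewrite /fubini_G/= Phi_int1.
split; first exact: iG.
have e21 := integral21_prod_meas1 iPhi; rewrite GE in e21.
have e12 := integral12_prod_meas1 iPhi.
rewrite /energy /Rintegral; congr fine; rewrite [RHS]e21 -[RHS]e12.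
apply: ae_eq_integral => //.
- by have [] := integrableP _ _ _ ekf.
- by have [] := integrableP _ _ _ (integrable_fubini_F iPhi).
exists N; split => // x /=; apply: contra_notP => Nx _.
rewrite /fubini_F/=.
have ib : nu.-integrable setT (fun s => (b (s, x.1) * b (s, x.2) * w s)%:E).
  apply/integrableP; split.
    apply/measurable_EFinP; apply: measurable_funM => //.
    by apply: measurable_funM; exact: mbu.
  rewrite [X in (X < _)%E](_ : _ = (\int[nu]_s (b (s, x.1) * b (s, x.2) * w s)%:E)%E).
    by rewrite kN// ltry.
  by apply: eq_integral => s _; rewrite gee0_abs// lee_fin !mulr_ge0.
rewrite EFinM -kN// -integralZl; [|exact: measurableT|exact: ib].
by apply: eq_integral => s _; rewrite -EFinM.
Qed.

Lemma energy_ge0 f : finite_energy f -> 0 <= energy f f.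
Proof.
by move=> /energyE[_ ->]; apply: Rintegral_ge0 => s _; rewrite mulr_ge0 ?sqr_ge0.
Qed.

Lemma energyZDl a f g h : finite_energy f -> finite_energy g -> finite_energy h ->
  energy (fun u => a * f u + g u) h = a * energy f h + energy g h.
Proof.
move=> ef eg eh; rewrite /energy -RintegralZl//; last exact: finite_energy_cross.
rewrite -RintegralD//; last 2 first.
- by apply: integrableZl_EFin => //; exact: finite_energy_cross.
- exact: finite_energy_cross.
by apply: eq_Rintegral => x _; ring.
Qed.

Lemma energyZDr a f g h : finite_energy f -> finite_energy g -> finite_energy h ->
  energy h (fun u => a * f u + g u) = a * energy h f + energy h g.
Proof.
move=> ef eg eh; rewrite /energy -RintegralZl//; last exact: finite_energy_cross.
rewrite -RintegralD//; last 2 first.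
- by apply: integrableZl_EFin => //; exact: finite_energy_cross.
- exact: finite_energy_cross.
by apply: eq_Rintegral => x _; ring.
Qed.

(** Parallelogram identity, with the nonnegative energy of [- a * f + g] discarded. *)
Lemma energyZD_le a f g : finite_energy f -> finite_energy g ->
  energy (fun u => a * f u + g u) (fun u => a * f u + g u) <=
  2 * a ^+ 2 * energy f f + 2 * energy g g.
Proof.
move=> ef eg.
have h := energy_ge0 (finite_energyZD (- a) ef eg).
rewrite -subr_ge0; move: h; congr (0 <= _).
rewrite !energyZDl ?energyZDr//; try exact: finite_energyZD.
ring.
Qed.

Lemma energy_gt0 f (A : set S) (c : R) : finite_energy f -> measurable A ->
  (0 < nu A)%E -> (nu A < +oo)%E -> 0 < c ->
  (forall s, A s -> c <= w s * mixture_coef f s ^+ 2) -> 0 < energy f f.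
Proof.
move=> ef mA A0 Ay c0 cA; have [iE ->] := energyE ef.
have i1 : nu.-integrable setT (EFin \o (fun s => \1_A s)).
  apply/integrableP; split; first by apply/measurable_EFinP; exact: measurable_indic.
  rewrite [X in (X < _)%E](_ : _ = (\int[nu]_s (\1_A s)%:E)%E); last first.
    by apply: eq_integral => s _; rewrite gee0_abs ?lee_fin.
  by rewrite integral_indic// setIT.
have iA : nu.-integrable setT (EFin \o (fun s => c * \1_A s)) by exact: integrableZl_EFin.
apply: (@lt_le_trans _ _ (\int[nu]_s (c * \1_A s))).
  rewrite RintegralZl//.
  rewrite mulr_gt0// /Rintegral integral_indic// setIT fine_gt0//.
  by rewrite A0 Ay.
apply: le_Rintegral => // s _; rewrite indicE.
have [As|nAs] := boolP (s \in A); first by rewrite mulr1 cA//; exact: set_mem.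
by rewrite mulr0 mulr_ge0 ?sqr_ge0.
Qed.

End mixture_kernel.

(** * Improper integrals of powers *)

Lemma ler_npowR {R : realType} (p x y : R) : p <= 0 -> 0 < x -> x <= y ->
  y `^ p <= x `^ p.
Proof.
move=> p0 x0 xy; have y0 := lt_le_trans x0 xy.
by rewrite /powR !gt_eqF// ler_expR ler_wnM2l// ler_ln.
Qed.

Lemma cvg_powR_Ny {R : realType} (z p : R) : p < 0 ->
  (y - z) `^ p @[y --> +oo%R] --> (0 : R).
Proof.
move=> p0; apply/cvgrPdist_le => /= eps eps0.
near=> y; rewrite sub0r normrN ger0_norm ?powR_ge0//.
have h : eps `^ p^-1 <= y - z.
  by rewrite lerBrDl; near: y; apply: nbhs_pinfty_ge; exact: num_real.
rewrite -[leRHS](@powRr1 _ eps) ?(ltW eps0)// -(@mulVf _ p) ?lt_eqF// powRrM.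
have e0 : 0 < eps `^ p^-1 by rewrite powR_gt0.
have yz0 : 0 < y - z := lt_le_trans e0 h.
by rewrite ler_npowR// ltW.
Unshelve. all: by end_near. Qed.

Lemma is_derive_powRB {R : realType} (z p y : R) : z < y ->
  is_derive y 1 (fun y => (y - z) `^ p) (p * (y - z) `^ (p - 1)).
Proof.
move=> zy; have yz : 0 < y - z by rewrite subr_gt0.
have h1 := is_derive1_powR p yz.
have h2 : is_derive y 1 (fun y : R => y - z) 1 by apply: is_derive_eq; rewrite subr0.
by have := @is_derive1_comp R (@powR R ^~ p) (fun y => y - z) y _ _ h1 h2; rewrite mulr1.
Qed.

Lemma continuous_powRB {R : realType} (z p y : R) : z < y ->
  {for y, continuous (fun y => (y - z) `^ p)}.
Proof.
move=> zy; apply/differentiable_continuous/derivable1_diffP.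
exact: (@ex_derive _ _ _ _ _ _ _ (is_derive_powRB p zy)).
Qed.

Lemma integral_powR_y {R : realType} (z v p : R) : z < v -> p < -1 ->
  (\int[lebesgue_measure]_(y in `[v, +oo[) ((y - z) `^ p)%:E)%E =
  ((v - z) `^ (p + 1) / - (p + 1))%:E.
Proof.
move=> zv p1; have p10 : p + 1 < 0 by lra.
have zx x : v <= x -> z < x by exact: lt_le_trans.
rewrite (@ge0_continuous_FTC2y R _ (fun y => (y - z) `^ (p + 1) / (p + 1)) v 0).
- by rewrite sub0e -EFinN invrN mulrN.
- by move=> x vx; rewrite powR_ge0.
- apply/continuous_within_itvcyP; split.
    move=> x; rewrite in_itv/= andbT => /ltW/zx; exact: continuous_powRB.
  apply: cvg_at_right_filter; exact: continuous_powRB.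
- rewrite -[X in _ --> X](mul0r (p + 1)^-1); apply: cvgM; last exact: cvg_cst.
  exact: cvg_powR_Ny.
- move=> x vx; have := is_derive_powRB (p + 1) (zx _ (ltW vx)) => h.
  by apply: derivableM => //; exact: (@ex_derive _ _ _ _ _ _ _ h).
- apply: cvgM; last exact: cvg_cst.
  apply: cvg_at_right_filter; exact: continuous_powRB.
- move=> x; rewrite in_itv/= andbT => vx.
  have h := is_derive_powRB (p + 1) (zx _ (ltW vx)).
  rewrite derive1E; apply: (@derive_val _ _ _ _ _ _ _ _).
  apply: is_derive_eq; rewrite scaler0 add0r /GRing.scale/= addrK.
  by rewrite mulrA mulVf ?mul1r// lt_eqF.
Qed.

Lemma integral_powR_Ny {R : realType} (v u p : R) : u < v -> p < -1 ->
  (\int[lebesgue_measure]_(z in `]-oo, u]) ((v - z) `^ p)%:E)%E =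
  ((v - u) `^ (p + 1) / - (p + 1))%:E.
Proof.
move=> uv p1.
have h := @ge0_integration_by_substitutionNy R (fun z => (v - z) `^ p) (- u).
rewrite opprK in h; rewrite h.
- transitivity ((- u - - v) `^ (p + 1) / - (p + 1))%:E; last first.
    by rewrite opprK addrC.
  have uv' : - v < - u by rewrite ltrN2.
  rewrite -(integral_powR_y uv' p1).
  by apply: eq_integral => x _ /=; rewrite !opprK addrC.
- apply: continuous_in_subspaceT => z; rewrite inE/= in_itv/= => zu.
  apply: (@continuous_comp _ _ _ (fun z => v - z) (@powR R ^~ p)).
    by apply: cvgB; [exact: cvg_cst|exact: cvg_id].
  have zv : 0 < v - z by rewrite subr_gt0 (le_lt_trans zu).
  apply/differentiable_continuous/derivable1_diffP.
  exact: (@ex_derive _ _ _ _ _ _ _ (is_derive1_powR p zv)).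
- by move=> x _; rewrite powR_ge0.
Qed.

(** * The Riesz kernel *)

Section riesz_energy.
Context {R : realType} (e : R).
Hypothesis e01 : -1 < e < 0.
Local Notation mu := (@lebesgue_measure R).
Local Notation mu2 := (square_measure mu).

(** The indicator of the interval from [s.1] to [s.2], as a function of differences so that joint
    measurability in [s] and [u] follows by composition. *)
Definition betw (s : R * R) (u : R) : R :=
  \1_`]0, +oo[ (u - s.1) * \1_`]0, +oo[ (s.2 - u).

Lemma betwE s u : betw s u = ((s.1 < u) && (u < s.2))%:R.
Proof.
rewrite /betw !indicE -natrM mulnb; congr (nat_of_bool _)%:R.
have h (x : R) : (x \in `]0, +oo[%classic) = (0 < x).
  by apply/idP/idP; rewrite inE/= in_itv/= andbT.
by rewrite !h !subr_gt0.
Qed.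

Lemma betw_ge0 s u : 0 <= betw s u.
Proof. by rewrite betwE. Qed.

Lemma betw_le1 s u : betw s u <= 1.
Proof. by rewrite betwE; case: (_ && _). Qed.

Lemma measurable_betw d (T : measurableType d) (f1 f2 g : T -> R) :
  measurable_fun setT f1 -> measurable_fun setT f2 -> measurable_fun setT g ->
  measurable_fun setT (fun x => betw (f1 x, f2 x) (g x)).
Proof.
have h : measurable_fun setT (\1_`]0, +oo[ : R -> R) by exact: measurable_indic.
move=> m1 m2 mg; apply: measurable_funM => /=.
  have m : measurable_fun setT (fun x => g x - f1 x) by exact: measurable_funB.
  exact: (measurableT_comp h m).
have m : measurable_fun setT (fun x => f2 x - g x) by exact: measurable_funB.
exact: (measurableT_comp h m).
Qed.

(** When [s.2 <= s.1] this is only a default value of [powR], but then [betw s] vanishes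
    identically. *)
Definition gapw (s : R * R) : R := (s.2 - s.1) `^ (e - 2).

Lemma gapw_ge0 s : 0 <= gapw s. Proof. exact: powR_ge0. Qed.

Lemma measurable_powRf d (T : measurableType d) (f : T -> R) p :
  measurable_fun setT f -> measurable_fun setT (fun x => f x `^ p).
Proof. by move=> mf; exact: (measurableT_comp (measurable_powR p) mf). Qed.

Lemma measurable_gapw : measurable_fun [set: R * R] gapw.
Proof. by apply: measurable_powRf; apply: measurable_funB. Qed.

(* A point (z, y) of the half-plane stands for the interval ]z, y[. *)
Lemma riesz_kernel_intervals (u v : R) : u != v ->
  (\int[mu2]_s (betw s u * betw s v * gapw s)%:E)%E =
  (`|u - v| `^ e / (e * (e - 1)))%:E.
Proof.
wlog uv : u v / u < v.
  move=> h; rewrite neq_lt => /orP[uv|vu].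
    by apply: h => //; rewrite lt_eqF.
  rewrite distrC -h ?lt_eqF//; apply: eq_integral => s _; congr EFin; ring.
move=> _; rewrite /square_measure fubini_tonelli1; last 2 first.
- apply/measurable_EFinP; apply: measurable_funM; last exact: measurable_gapw.
  by apply: measurable_funM; apply: measurable_betw.
- by move=> s; rewrite lee_fin !mulr_ge0 ?betw_ge0 ?gapw_ge0.
have [e1 e0] := andP e01.
(* The integral over y > v converges because e - 2 < -1. It leaves the exponent e - 1, and e < 0
   makes the integral over z < u converge in turn. *)
transitivity (\int[mu]_(z in `]-oo, u[) ((v - z) `^ (e - 1) / - (e - 1))%:E)%E.
  rewrite [RHS]integral_mkcond; apply: eq_integral => z _.
  rewrite /fubini_F patchE mem_setE in_itv/=.
  case: ifPn => zu.
    transitivity (\int[mu]_(y in `]v, +oo[) ((y - z) `^ (e - 2))%:E)%E.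
      rewrite [RHS]integral_mkcond; apply: eq_integral => y _.
      rewrite patchE mem_setE in_itv/= andbT !betwE/= zu (lt_trans zu uv)/=.
      case: ifPn => vy; last by rewrite mulr0 mul0r.
      by rewrite (lt_trans uv vy) !mul1r.
    rewrite integral_itv_obnd_cbnd; last first.
      apply/measurable_EFinP; apply: measurable_funTS.
      by apply: measurable_powRf; exact: measurable_funB.
    rewrite integral_powR_y ?(lt_trans zu uv)//; last by lra.
    by congr ((_ `^ _) / - _)%:E; ring.
  by apply: integral0_eq => y _; rewrite !betwE/= (negbTE zu) mul0r mul0r.
rewrite integral_itv_bndo_bndc; last first.
  apply/measurable_EFinP; apply: measurable_funTS; apply: measurable_funM => //.
  by apply: measurable_powRf; exact: measurable_funB.
under eq_integral do rewrite mulrC EFinM.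
rewrite ge0_integralZl//; last 3 first.
- apply/measurable_EFinP; apply: measurable_funTS.
  by apply: measurable_powRf; exact: measurable_funB.
- by move=> z _; rewrite lee_fin powR_ge0.
- by rewrite lee_fin invr_ge0; lra.
rewrite integral_powR_Ny//; last by lra.
rewrite -EFinM ltr0_norm ?subr_lt0// (opprB u v) (subrK 1 e); congr EFin.
have e00 : e != 0 by rewrite lt_eqF.
have e10 : e - 1 != 0 by rewrite lt_eqF//; lra.
by field; rewrite e00 e10.
Qed.

Local Notation TR := (measurableTypeR R).

Let measurable_diag : measurable [set x : TR * TR | x.1 = x.2].
Proof.
rewrite (_ : [set _ | _] = (fun x : TR * TR => (x.1 : R) - x.2) @^-1` [set 0]).
  have h : measurable_fun [set: TR * TR] (fun x : TR * TR => (x.1 : R) - x.2).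
    by apply: measurable_funB.
  by rewrite -[X in measurable X]setTI; apply: h.
apply/seteqP; split => x /=; first by move=> ->; rewrite subrr.
by move/eqP; rewrite subr_eq0 => /eqP.
Qed.

Let diag_null : (mu \x mu)%E [set x : TR * TR | x.1 = x.2] = 0%E.
Proof.
rewrite /product_measure1; apply: integral0_eq => x _ /=.
rewrite (_ : xsection _ _ = [set x]) ?lebesgue_measure_set1//.
apply/seteqP; split => y; rewrite /xsection/= inE/=; first by move=> ->.
by move=> ->.
Qed.

Definition riesz (x : TR * TR) : R := `|(x.1 : R) - x.2| `^ e.

Let measurable_riesz : measurable_fun setT riesz.
Proof.
apply: measurable_powRf.
have h : measurable_fun [set: TR * TR] (fun x : TR * TR => (x.1 : R) - x.2).
  by apply: measurable_funB.
exact: (measurableT_comp (@normr_measurable R setT) h).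
Qed.

Let riesz_ge0 x : 0 <= riesz x. Proof. exact: powR_ge0. Qed.

Let b (p : (TR * TR) * TR) : R := betw p.1 p.2.

Let measurable_b : measurable_fun setT b.
Proof.
apply: measurable_betw => //.
  exact: (measurableT_comp measurable_fst measurable_fst).
exact: (measurableT_comp measurable_snd measurable_fst).
Qed.

Let b01 p : 0 <= b p <= 1. Proof. by rewrite betw_ge0 betw_le1. Qed.

Let w (s : TR * TR) : R := e * (e - 1) * gapw s.

Let ee_gt0 : 0 < e * (e - 1).
Proof. by have /andP[h1 h2] := e01; rewrite nmulr_lgt0//; lra. Qed.

Let measurable_w : measurable_fun setT w.
Proof. by apply: measurable_funM => //; exact: measurable_gapw. Qed.

Let w_ge0 s : 0 <= w s.
Proof. by rewrite mulr_ge0 ?gapw_ge0 ?(ltW ee_gt0). Qed.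

Let riesz_mixture (x : TR * TR) : ~ [set x : TR * TR | x.1 = x.2] x ->
  (\int[mu2]_s (b (s, x.1) * b (s, x.2) * w s)%:E = (riesz x)%:E)%E.
Proof.
move=> /= /eqP xx; rewrite /riesz.
transitivity (\int[mu2]_s ((e * (e - 1))%:E * (betw s x.1 * betw s x.2 * gapw s)%:E))%E.
  by apply: eq_integral => s _; rewrite -EFinM; congr EFin; rewrite /b /w/=; ring.
rewrite ge0_integralZl//.
- rewrite riesz_kernel_intervals// -EFinM; congr EFin.
  by rewrite mulrCA divff ?mulr1// gt_eqF.
- apply/measurable_EFinP; apply: measurable_funM; last exact: measurable_gapw.
  by apply: measurable_funM; apply: measurable_betw.
- by move=> s _; rewrite lee_fin !mulr_ge0 ?betw_ge0 ?gapw_ge0.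
- by rewrite lee_fin ltW.
Qed.

Definition riesz_finite (f : TR -> R) : Prop := finite_energy mu riesz f.

Definition riesz_energy (f g : TR -> R) : R := energy mu riesz f g.

Lemma riesz_finiteZD (a : R) f g : riesz_finite f -> riesz_finite g ->
  riesz_finite (fun u => a * f u + g u).
Proof.
exact: (finite_energyZD measurable_b b01 measurable_w w_ge0 measurable_riesz
  riesz_ge0 measurable_diag diag_null riesz_mixture).
Qed.

Lemma riesz_finite_cross f g : riesz_finite f -> riesz_finite g ->
  mu2.-integrable setT (EFin \o (fun x => f x.1 * g x.2 * riesz x)).
Proof.
exact: (finite_energy_cross measurable_b b01 measurable_w w_ge0 measurable_riesz
  riesz_ge0 measurable_diag diag_null riesz_mixture).
Qed.

Lemma riesz_energy_ge0 f : riesz_finite f -> 0 <= riesz_energy f f.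
Proof.
exact: (energy_ge0 measurable_b b01 measurable_w w_ge0 measurable_riesz
  riesz_ge0 measurable_diag diag_null riesz_mixture).
Qed.

Lemma riesz_energyZDl (a : R) f g h : riesz_finite f -> riesz_finite g -> riesz_finite h ->
  riesz_energy (fun u => a * f u + g u) h = a * riesz_energy f h + riesz_energy g h.
Proof.
exact: (energyZDl measurable_b b01 measurable_w w_ge0 measurable_riesz
  riesz_ge0 measurable_diag diag_null riesz_mixture).
Qed.

Lemma riesz_energyZDr (a : R) f g h : riesz_finite f -> riesz_finite g -> riesz_finite h ->
  riesz_energy h (fun u => a * f u + g u) = a * riesz_energy h f + riesz_energy h g.
Proof.
exact: (energyZDr measurable_b b01 measurable_w w_ge0 measurable_riesz
  riesz_ge0 measurable_diag diag_null riesz_mixture).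
Qed.

Lemma riesz_energyZD_le (a : R) f g : riesz_finite f -> riesz_finite g ->
  riesz_energy (fun u => a * f u + g u) (fun u => a * f u + g u) <=
  2 * a ^+ 2 * riesz_energy f f + 2 * riesz_energy g g.
Proof.
exact: (energyZD_le measurable_b b01 measurable_w w_ge0 measurable_riesz
  riesz_ge0 measurable_diag diag_null riesz_mixture).
Qed.

Lemma riesz_finite_le_ae (f g : TR -> R) (c u0 : R) : 0 <= c ->
  measurable_fun setT f -> (forall u, u <> u0 -> `|f u| <= c * `|g u|) ->
  riesz_finite g -> riesz_finite f.
Proof.
move=> c0 mf fg.
apply: (finite_energy_le_ae measurable_b b01 measurable_w w_ge0 measurable_riesz
  riesz_ge0 measurable_diag diag_null riesz_mixture c0 mf (M := [set u0])) => //.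
exact: lebesgue_measure_set1.
Qed.

Lemma riesz_energy_iterated (f g : TR -> R) : riesz_finite f -> riesz_finite g ->
  \int[mu]_v \int[mu]_u (f u * g v * `|u - v| `^ e) = riesz_energy f g.
Proof.
move=> ef eg; have i := riesz_finite_cross ef eg.
exact: (Rintegral21_prod i).
Qed.

(* A slice of the integrable tensor [f u * f v * |u - v| ^ e] at a point [u] where
   [f] does not vanish dominates [f], the kernel being bounded below on bounded sets. *)
Lemma riesz_finite_tensor (f : TR -> R) (T a0 a1 : R) : 0 < T -> a0 < a1 ->
  measurable_fun setT f -> (forall u, u \notin `[0, T] -> f u = 0) ->
  (forall u, a0 < u < a1 -> f u != 0) ->
  mu2.-integrable setT (EFin \o (fun x => f x.1 * f x.2 * riesz x)) ->
  riesz_finite f.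
Proof.
move=> T0 a01 mf supp f0 i; split => //.
have [N [mN N0 subN]] := ae_integrable1 i.
have [u [nNu fu]] : exists u, ~ N u /\ a0 < u < a1.
  apply: contrapT => /forallNP H.
  have sub : `]a0, a1[ `<=` N.
    move=> u /=; rewrite in_itv/= => ua.
    by apply: contrapT => nNu; exact: (H u).
  have : (mu `]a0, a1[%classic <= mu N)%E.
    by apply: le_measure; rewrite ?inE//; exact: measurable_itv.
  rewrite N0 lebesgue_measure_itv/= lte_fin a01 -EFinD lee_fin; lra.
have iu : mu.-integrable setT (EFin \o (fun v => f u * f v * `|u - v| `^ e)).
  by apply: contrapT => h; apply: nNu; exact: subN.
have fu0 : 0 < `|f u| by rewrite normr_gt0 f0.
have u0T : u \in `[0, T].
  by apply: contrapT => /negP/supp; move/eqP; rewrite (negbTE (f0 _ fu)).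
(* For distinct u and v in [0, T], |u - v| <= T and e < 0 give T^e <= |u - v|^e, so [C] times the
   slice at [u] dominates [|f v|]. *)
pose C := (`|f u| * T `^ e)^-1.
have C0 : 0 <= C by rewrite invr_ge0 mulr_ge0 ?powR_ge0.
have TE : 0 < T `^ e by exact: powR_gt0.
(* At v = u the slice is 0 by default and dominates nothing; the term supported on the null set
   [[set u]] repairs this. *)
apply: (@le_integrable_EFin _ _ _ mu setT measurableT _
  (fun v => C * `|f u * f v * `|u - v| `^ e| + `|f u| * \1_[set u] v)) => //.
  move=> v _; have [->|vu] := eqVneq v u.
    rewrite indicE mem_set// mulr1 lerDr mulr_ge0//.
  rewrite indicE memNset ?mulr0 ?addr0; last by move/eqP; rewrite (negbTE vu).
  have [vT|vT] := boolP (v \in `[0, T]); last by rewrite (supp v vT) normr0 mulr_ge0.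
  rewrite !normrM (ger0_norm (powR_ge0 _ _)).
  have : T `^ e <= `|u - v| `^ e.
    have [e1 e0] := andP e01.
    apply: ler_npowR; rewrite ?(ltW e0)//.
      by rewrite normr_gt0 subr_eq0 eq_sym.
    move: u0T vT; rewrite !in_itv/= => /andP[h1 h2] /andP[h3 h4].
    by rewrite ler_norml; apply/andP; split; lra.
  move: (`|u - v| `^ e) => k Tk; rewrite /C.
  rewrite [leRHS](_ : _ = `|f v| * (k / T `^ e)); last by field; rewrite !gt_eqF.
  by rewrite ler_peMr// ler_pdivlMr// mul1r.
apply: integrableD_EFin => //.
  by apply: integrableZl_EFin => //; exact: (integrable_norm iu).
apply: integrableZl_EFin => //; apply/integrableP; split.
  by apply/measurable_EFinP; exact: measurable_indic.
rewrite [X in (X < _)%E](_ : _ = (\int[mu]_v (\1_[set u] v)%:E)%E); last first.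
  by apply: eq_integral => v _; rewrite gee0_abs ?lee_fin.
rewrite integral_indic// setIT; have h : mu [set u] = 0%:E by exact: lebesgue_measure_set1.
by apply: (le_lt_trans _ (ltry 0)); rewrite -h.
Qed.

(** Take z in the first quarter of ]a0, a1[ and y in the third. Then ]z, y[ stays where [f >= c] and
    contains the second quarter, of length l, so its coefficient is at least c l, and the gap y - z
    <= 4 l bounds the weight below. Nothing is needed about [f] outside ]a0, a1[. *)
Lemma riesz_energy_gt0 (f : TR -> R) (a0 a1 c : R) : riesz_finite f -> a0 < a1 -> 0 < c ->
  (forall u, a0 < u < a1 -> c <= f u) -> 0 < riesz_energy f f.
Proof.
move=> ef a01 c0 fc.
pose l := (a1 - a0) / 4.
have l0 : 0 < l by rewrite divr_gt0// subr_gt0.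
have lE : a1 = a0 + 4 * l by rewrite /l; field.
pose A : set (TR * TR) := `[a0 + l / 2, a0 + l] `*` `[a0 + 2 * l, a0 + 3 * l].
have mA : measurable A by apply: measurableX; exact: measurable_itv.
have mI (p q : R) : p <= q -> mu `[p, q]%classic = (q - p)%:E.
  move=> pq; rewrite lebesgue_measure_itv/= lte_fin; case: ltP => // qp.
  by rewrite (@le_anti _ _ p q) ?subrr// pq qp.
have muA : (mu2 A = (l / 2 * l)%:E)%E.
  transitivity (mu `[(a0 + l / 2)%R, (a0 + l)%R]%classic *
                mu `[(a0 + 2 * l)%R, (a0 + 3 * l)%R]%classic)%E.
    by rewrite /square_measure; apply: product_measure1E; exact: measurable_itv.
  have h1 : a0 + l / 2 <= a0 + l by lra.
  have h2 : a0 + 2 * l <= a0 + 3 * l by lra.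
  by rewrite (mI (a0 + l / 2) (a0 + l) h1) (mI (a0 + 2 * l) (a0 + 3 * l) h2) -EFinM; congr EFin; field.
pose delta := e * (e - 1) * ((4 * l) `^ (e - 2) * (c * l) ^+ 2).
have A0 : (0 < mu2 A)%E by rewrite muA lte_fin mulr_gt0// divr_gt0.
have Ay : (mu2 A < +oo)%E by rewrite muA ltry.
have d0 : 0 < delta.
  have l4 : 0 < 4 * l by rewrite mulr_gt0.
  apply: mulr_gt0; first exact: ee_gt0.
  apply: mulr_gt0; first exact: powR_gt0.
  by apply: exprn_gt0; exact: mulr_gt0.
suff dA s : A s -> delta <= w s * mixture_coef mu b f s ^+ 2.
  exact: (energy_gt0 measurable_b b01 measurable_w w_ge0 measurable_riesz
    riesz_ge0 measurable_diag diag_null riesz_mixture ef mA A0 Ay d0 dA).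
case: s => z y [/= zA yA].
have [z1 z2] : a0 + l / 2 <= z /\ z <= a0 + l by apply/andP; move: zA; rewrite in_itv.
have [y1 y2] : a0 + 2 * l <= y /\ y <= a0 + 3 * l by apply/andP; move: yA; rewrite in_itv.
have zy0 : 0 < y - z by lra.
have [e1 e0] := andP e01.
have h1 : (4 * l) `^ (e - 2) <= gapw (z, y).
  by rewrite /gapw/= ler_npowR//; lra.
have [intf _] := ef.
have i1 : mu.-integrable setT (EFin \o (fun u : TR => c * \1_`]a0 + l, a0 + 2 * l[ u)).
  by apply: integrableZl_EFin => //; exact: integrable_indic_itv.
have ib := integrable_mixture measurable_b b01 (z, y) intf.
have h2 : c * l <= mixture_coef mu b f (z, y).
  rewrite (_ : c * l = \int[mu]_u (c * \1_`]a0 + l, a0 + 2 * l[ u)).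
    apply: (le_Rintegral measurableT i1 ib) => u _.
    rewrite indicE; have [|nu] := boolP (u \in _).
      rewrite inE/= in_itv/= => /andP[u1 u2]; rewrite mulr1 /b betwE/=.
      have cf : c <= f u by apply: fc; apply/andP; split; lra.
      by rewrite (le_lt_trans z2 u1) (lt_le_trans u2 y1) mulr1.
    rewrite mulr0 /b betwE/=; case: andP => [[zu uy]|_]; last by rewrite mulr0.
    rewrite mulr1 (le_trans (ltW c0))//; apply: fc.
    by apply/andP; split; lra.
  rewrite RintegralZl//; last exact: integrable_indic_itv.
  have mJ : mu `]a0 + l, a0 + 2 * l[%classic = l%:E.
    rewrite lebesgue_measure_itv/= lte_fin ifT; last by lra.
    by rewrite -EFinD; congr EFin; ring.
  congr (_ * _); rewrite /Rintegral integral_indic; [|by []|exact: measurable_itv].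
  by rewrite setIT; exact: (esym (congr1 fine mJ)).
have h3 : (4 * l) `^ (e - 2) * (c * l) ^+ 2 <=
    gapw (z, y) * mixture_coef mu b f (z, y) ^+ 2.
  have cl0 : 0 <= c * l by rewrite mulr_ge0// ltW.
  rewrite ler_pM ?powR_ge0 ?sqr_ge0//.
  by rewrite ler_pXn2r// nnegrE//; exact: le_trans h2.
by rewrite /delta /w -[leRHS]mulrA; apply: ler_wpM2l => //; exact: ltW.
Qed.

End riesz_energy.

(** * Gaussian expectations *)

(** The Radon-Nikodym derivative agrees almost everywhere with [normal_pdf], as both have the same
    integrals over measurable sets. *)
Lemma integral_normal_prob (R : realType) (m s : R) (f : measurableTypeR R -> \bar R) :
  measurable_fun setT f -> (\int[normal_prob m s]_x `|f x| < +oo)%E ->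
  (\int[normal_prob m s]_x f x =
   \int[lebesgue_measure]_x (f x * (normal_pdf m s x)%:E))%E.
Proof.
move=> mf finf.
rewrite -(Radon_Nikodym_change_of_variables (normal_prob_dominates m s))//=;
  last by apply/integrableP; split.
apply: ae_eq_integral => //.
- apply: emeasurable_funM => //; apply: (measurable_int lebesgue_measure).
  by apply: Radon_Nikodym_integrable; exact: normal_prob_dominates.
- apply: emeasurable_funM => //=; apply/measurableT_comp => //=.
  exact: measurable_normal_pdf.
- apply: ae_eqe_mul2l => /=.
  rewrite Radon_NikodymE//=; first exact: normal_prob_dominates.
  move=> abmu; case: cid => /= h [h1 h2 h3].
  apply: integral_ae_eq => //=.
  + by apply/measurableT_comp =>//; exact: measurable_normal_pdf.
  + by move=> E E01 mE; rewrite -h3.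
Qed.

Section normal_calculus.
Context {R : realType} (m s : R).
Hypothesis s0 : s != 0.
Local Notation mu := (@lebesgue_measure R).
Local Notation p := (normal_pdf m s).
Let r := Num.sqrt 2 * s.

Let r0 : r != 0. Proof. by rewrite mulf_neq0// gt_eqF// sqrtr_gt0. Qed.

Let r2 : r ^+ 2 = 2 * s ^+ 2.
Proof. by rewrite exprMn sqr_sqrtr. Qed.

Let s20 : 0 < s ^+ 2. Proof. by rewrite exprn_even_gt0. Qed.

Let q := normal_pdf m r.
Let K := (1 + 8 * s ^+ 2) * (normal_peak s / normal_peak r).

Let K0 : 0 < K.
Proof.
rewrite mulr_gt0 ?divr_gt0 ?normal_peak_gt0//.
by rewrite ltr_pwDl// mulr_ge0// ltW.
Qed.

(** Doubling the variance absorbs polynomial factors. With y = (x - m)^2 and z = y / (4 s^2), the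
    exponential of [p] is that of [q] times exp (- z), and exp z >= 1 + z beats 1 + 2 y = 1 + 8 s^2
    z at the cost of the factor 1 + 8 s^2 in [K]. *)
Lemma poly_normal_pdf_le (x : R) : (1 + 2 * (x - m) ^+ 2) * p x <= K * q x.
Proof.
have -> : p x = normal_peak s * normal_fun m s x by rewrite normal_pdfE.
have -> : q x = normal_peak r * normal_fun m r x by rewrite /q normal_pdfE.
have pr := normal_peak_gt0 r0.
have -> : K * (normal_peak r * normal_fun m r x) =
    normal_peak s * ((1 + 8 * s ^+ 2) * normal_fun m r x).
  by rewrite /K; field; rewrite gt_eqF.
rewrite mulrCA ler_wpM2l ?normal_peak_ge0//.
set y := (x - m) ^+ 2; have y0 : 0 <= y by exact: sqr_ge0.
have -> : normal_fun m s x = normal_fun m r x * expR (- (y / (s ^+ 2 *+ 4))).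
  rewrite /normal_fun -expRD r2 -/y; congr expR.
  by field.
rewrite mulrCA mulrC ler_wpM2r ?normal_fun_ge0//.
rewrite expRN ler_pdivrMr ?expR_gt0//.
set z := y / _; have z0 : 0 <= z by rewrite divr_ge0// mulrn_wge0// ltW.
have -> : 2 * y = 8 * s ^+ 2 * z.
  by rewrite /z; field.
have := expR_ge1Dx z; have := s20; set t := s ^+ 2 => t0 h.
apply: (@le_trans _ _ ((1 + 8 * t) * (1 + z))); first by nra.
by rewrite ler_wpM2l// addr_ge0// mulr_ge0// ltW.
Qed.

Lemma normal_pdf_poly_bound (x : R) :
  [/\ p x <= K * q x, `|x - m| * p x <= K * q x & (x - m) ^+ 2 * p x <= K * q x].
Proof.
have := poly_normal_pdf_le x; set y := x - m.
have p0 : 0 <= p x := normal_pdf_ge0 _ _ _.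
have y2 : `|y| ^+ 2 = y ^+ 2 by rewrite real_normK// num_real.
have := normr_ge0 y; move: y2; set z := `|y| => <- z0 h; split.
- by apply: le_trans h; rewrite ler_peMl// lerDl mulr_ge0 ?exprn_ge0.
- apply: le_trans h; rewrite ler_wpM2r//; have := sqr_ge0 (z - 1); rewrite sqrrB1 expr2; nra.
- apply: le_trans h; rewrite ler_wpM2r//; have := sqr_ge0 z; lra.
Qed.

Lemma integrable_normal_pdfM (f : R -> R) (C : R) :
  measurable_fun setT f ->
  (forall x, `|f x| <= C * (1 + `|x - m| + (x - m) ^+ 2)) ->
  mu.-integrable setT (fun x => (f x * p x)%:E).
Proof.
move=> mf fC.
have C0 : 0 <= C.
  by have := le_trans (normr_ge0 _) (fC m); rewrite subrr normr0 expr0n/= !addr0 mulr1.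
have hq : mu.-integrable setT (fun x => (3 * C * K)%:E * (q x)%:E)%E.
  by apply: integrableZl => //; exact: integrable_normal_pdf.
apply: le_integrable hq => //.
  apply/measurable_EFinP; apply: measurable_funM => //.
  exact: measurable_normal_pdf.
move=> x _ /=; rewrite lee_fin normrM (ger0_norm (normal_pdf_ge0 _ _ _)).
rewrite [leRHS]ger0_norm; last first.
  by rewrite mulr_ge0 ?normal_pdf_ge0// mulr_ge0 ?(ltW K0)// mulr_ge0.
apply: (@le_trans _ _ (C * (1 + `|x - m| + (x - m) ^+ 2) * p x)).
  by rewrite ler_wpM2r ?normal_pdf_ge0.
have [h1 h2 h3] := normal_pdf_poly_bound x.
rewrite (_ : 3 * C * K * q x = C * (3 * (K * q x))); last by ring.
rewrite -mulrA ler_wpM2l// !mulrDl mul1r.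
move: h1 h2 h3; set k := K * q x; set z1 := p x; set z2 := _ * z1; set z3 := _ * z1; lra.
Qed.

Lemma is_derive_normal_pdf (x : R) : is_derive x 1 p (- ((x - m) / s ^+ 2) * p x).
Proof.
have -> : p = fun x => normal_peak s * expR (- (x - m) ^+ 2 / (s ^+ 2 *+ 2)).
  by rewrite normal_pdfE.
apply: is_derive_eq.
rewrite /= !scaler0 ?addr0 ?add0r; rewrite /GRing.scale/=.
rewrite -mulr_natr; field.
by rewrite s0.
Qed.

(* Integration by parts against the density, i.e. Stein's identity. *)
Lemma normal_pdf_stein (u u' : R -> R) (C : R) :
  (forall x : R, is_derive x 1 u (u' x)) -> continuous u' ->
  (forall x, `|u x| <= C * (1 + `|x - m|)) -> (forall x, `|u' x| <= C) ->
  s ^+ 2 * \int[mu]_x (u' x * p x) = \int[mu]_x ((x - m) * u x * p x).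
Proof.
move=> du cu' uC u'C.
have C0 : 0 <= C := le_trans (normr_ge0 _) (u'C 0).
have cu : continuous u.
  by move=> x; apply/differentiable_continuous/derivable1_diffP; exact: (@ex_derive _ _ _ _ _ _ _ (du x)).
have cp : continuous p by exact: continuous_normal_pdf.
have mu' : measurable_fun setT u' by exact: continuous_measurable_fun.
have mu1 : measurable_fun setT u by exact: continuous_measurable_fun.
have i1 : mu.-integrable setT (EFin \o (fun x => u' x * p x)).
  apply: (@integrable_normal_pdfM _ C mu') => x; apply: (le_trans (u'C x)).
  by rewrite ler_peMr// -addrA lerDl addr_ge0// sqr_ge0.
have i2 : mu.-integrable setT (EFin \o (fun x => (x - m) * u x * p x)).
  apply: (@integrable_normal_pdfM _ C).
    by apply: measurable_funM => //; apply: measurable_funB.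
  move=> x; rewrite normrM mulrC; apply: (@le_trans _ _ (C * (1 + `|x - m|) * `|x - m|)).
    by rewrite ler_wpM2r.
  rewrite -mulrA ler_wpM2l// mulrDl mul1r -expr2 real_normK ?num_real//.
  by rewrite lerD2r lerDr.
pose F x := s ^+ 2 * (u x * p x).
pose f x := s ^+ 2 * (u' x * p x) - (x - m) * u x * p x.
have dF (x : R) : is_derive x 1 F (f x).
  have du_ := du x; have dp_ := is_derive_normal_pdf x.
  rewrite /F; apply: is_derive_eq; rewrite /f /GRing.scale/=.
  by field.
have cf : continuous f.
  move=> x; apply: cvgB; first by apply: cvgM; [exact: cvg_cst|apply: cvgM; [exact: cu'|exact: cp]].
  apply: cvgM; last exact: cp.
  apply: cvgM; last exact: cu.
  by apply: cvgB; [exact: cvg_id|exact: cvg_cst].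
have cF : continuous F.
  by move=> x; apply/differentiable_continuous/derivable1_diffP; exact: (@ex_derive _ _ _ _ _ _ _ (dF x)).
have intf : mu.-integrable setT (EFin \o f).
  rewrite (_ : _ \o _ = (fun x => (s ^+ 2)%:E * (u' x * p x)%:E - ((x - m) * u x * p x)%:E)%E)//.
  by apply: integrableB => //; exact: integrableZl.
suff int0 : \int[mu]_x f x = 0.
  apply/eqP; rewrite -subr_eq0 -int0 /f RintegralB//.
    by rewrite RintegralZl.
  exact: integrableZl_EFin.
pose a (n : nat) : R := m - n.+1%:R; pose b (n : nat) : R := m + n.+1%:R.
(* At distance n + 1 from the mean, the linear growth of [u] against the quadratic decay of [p]
   leaves a bound in 1 / (n + 1), so the boundary terms vanish. *)
have Fle (n : nat) x : `|x - m| = n.+1%:R ->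
    `|F x| <= 2 * s ^+ 2 * C * K * normal_peak r * n.+1%:R^-1.
  move=> xn; have z1 : 1 <= n.+1%:R :> R by rewrite ler1n.
  have z0 : 0 < n.+1%:R :> R by rewrite ltr0n.
  have p0 : 0 <= p x := normal_pdf_ge0 _ _ _.
  rewrite /F normrM (ger0_norm (ltW s20)) normrM (ger0_norm p0).
  rewrite (_ : _ * _^-1 = s ^+ 2 * (C * (2 * (K * normal_peak r)) / n.+1%:R)); last first.
    by field; rewrite nat1r pnatr_eq0.
  rewrite ler_wpM2l ?(ltW s20)//.
  have := poly_normal_pdf_le x.
  rewrite -[(x - m) ^+ 2]real_normK ?num_real// xn => h1.
  have h2 : K * q x <= K * normal_peak r by rewrite ler_wpM2l ?(ltW K0)// normal_pdf_ub.
  have := le_trans h1 h2; move: (K * normal_peak r) => B h3.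
  rewrite ler_pdivlMr//.
  apply: (@le_trans _ _ (C * (1 + n.+1%:R) * p x * n.+1%:R)).
    by rewrite ler_wpM2r ?(ltW z0)// ler_wpM2r//; have := uC x; rewrite xn.
  rewrite -!mulrA ler_wpM2l//; apply: (@le_trans _ _ (2 * ((1 + 2 * n.+1%:R ^+ 2) * p x))).
    rewrite mulrCA [leRHS]mulrA [leRHS]mulrC ler_wpM2l//.
    move: z1; set z := n.+1%:R => z1; rewrite expr2; nra.
  by rewrite ler_pM2l.
have Fab : (fun n => F (b n) - F (a n)) @ \oo --> (0 : R).
  have Fz (c : nat -> R) : (forall n, `|c n - m| = n.+1%:R) -> (fun n => F (c n)) @ \oo --> (0 : R).
    move=> cE; apply/norm_cvg0P => /=.
    apply: (@squeeze_cvgr _ _ _ _ (cst 0)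
      (fun n => 2 * s ^+ 2 * C * K * normal_peak r * n.+1%:R^-1)).
    - by apply: nearW => n /=; rewrite normr_ge0 Fle.
    - exact: cvg_cst.
    - rewrite -[X in _ --> X](mulr0 (2 * s ^+ 2 * C * K * normal_peak r)).
      by apply: cvgM; [exact: cvg_cst|exact: cvg_harmonic].
  rewrite -[X in _ --> X](subr0 0); apply: cvgB; apply: Fz => n.
    by rewrite /b addrAC subrr add0r ger0_norm.
  by rewrite /a addrAC subrr add0r normrN ger0_norm.
have h : (fun n => \int[mu]_x ((f \_ `[a n, b n]) x)) @ \oo --> \int[mu]_x f x.
  apply: fine_cvg; rewrite fineK; last exact: integrable_fin_num.
  have mf : measurable_fun setT f by exact: continuous_measurable_fun.
  apply: (@dominated_cvg _ _ _ mu _ measurableT _ _ (fun x => `|f x|%:E)) => //.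
  - move=> n; apply/measurable_EFinP; apply/(measurable_restrictT _ _).1 => //.
    exact: measurable_funTS.
  - move=> x _; apply: cvg_near_cst; near=> n.
    rewrite patchE mem_set//= in_itv/= /a /b.
    have : `|x - m| <= n.+1%:R.
      rewrite (@le_trans _ _ n%:R) ?ler_nat//; near: n; exact: nbhs_infty_ger.
    by rewrite ler_norml => /andP[h1 h2]; apply/andP; split; lra.
  - by rewrite (_ : (fun x => _) = (abse \o (EFin \o f)))//; exact: integrable_abse.
  - move=> n x _ /=; rewrite lee_fin patchE; case: ifP => // _.
    by rewrite normr0.
have : (fun n => \int[mu]_x ((f \_ `[a n, b n]) x)) = (fun n => F (b n) - F (a n)).
  apply/funext => n; rewrite -Rintegral_mkcond /Rintegral.
  rewrite (@continuous_FTC2 _ f F)//.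
  - by rewrite /a /b ltrD2l gtrN.
  - exact: continuous_subspaceT.
  - split.
    + by move=> x _; exact: (@ex_derive _ _ _ _ _ _ _ (dF x)).
    + by apply: cvg_at_right_filter; exact: (cF).
    + by apply: cvg_at_left_filter; exact: (cF).
  - by move=> x _; rewrite derive1E; exact: (@derive_val _ _ _ _ _ _ _ (dF x)).
move=> e; rewrite e in h; exact: (cvg_unique _ h Fab).
Unshelve. all: by end_near. Qed.

End normal_calculus.

Section normal_moments.
Context {R : realType} (m s : R).
Hypothesis s0 : s != 0.
Local Notation mu := (@lebesgue_measure R).
Local Notation p := (normal_pdf m s).

Lemma normal_pdf_mean : \int[mu]_x (x * p x) = m.
Proof.
have mp : measurable_fun setT p by exact: measurable_normal_pdf.
have i1 : mu.-integrable setT (EFin \o p) by exact: integrable_normal_pdf.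
have ix : mu.-integrable setT (EFin \o (fun x => (x - m) * p x)).
  apply: (@integrable_normal_pdfM _ m s s0 (fun x => x - m) 1).
    exact: measurable_funB.
  by move=> x; rewrite mul1r addrAC lerDr addr_ge0// sqr_ge0.
have h : \int[mu]_x ((x - m) * p x) = 0.
  transitivity (\int[mu]_x ((x - m) * cst 1 x * p x)).
    by apply: eq_Rintegral => x _; rewrite mulr1.
  rewrite -(@normal_pdf_stein R m s s0 (cst 1) (cst 0) 1).
  - under eq_Rintegral do rewrite mul0r.
    by rewrite Rintegral_cst// mul0r mulr0.
  - by move=> x; exact: cvg_cst.
  - by move=> x; rewrite /= normr1 mul1r lerDl.
  - by move=> x; rewrite /= normr0.
have <- : \int[mu]_x ((x - m) * p x + m * p x) = \int[mu]_x (x * p x).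
  by apply: eq_Rintegral => x _; ring.
rewrite RintegralD//; last first.
  exact: integrableZl_EFin.
by rewrite h add0r RintegralZl// /Rintegral integral_normal_pdf mulr1.
Qed.

Lemma normal_pdf_variance : \int[mu]_x ((x - m) ^+ 2 * p x) = s ^+ 2.
Proof.
transitivity (\int[mu]_x ((x - m) * (x - m) * p x)).
  by apply: eq_Rintegral => x _; rewrite expr2.
have du (x : R) : is_derive x 1 (fun x => x - m) (cst 1 x).
  by apply: is_derive_eq; rewrite subr0.
rewrite -(@normal_pdf_stein R m s s0 (fun x => x - m) (cst 1) 1 du).
- under eq_Rintegral do rewrite mul1r.
  by rewrite /Rintegral integral_normal_pdf mulr1.
- by move=> x; exact: cvg_cst.
- by move=> x; rewrite mul1r lerDr.
- by move=> x; rewrite normr1.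
Qed.

(** As a function of the frequency t, the integral satisfies C' = - s^2 t C: differentiate under the
    integral sign and apply Stein's identity to the sine. An integrating factor and [C 0 = cos th]
    conclude. *)
Lemma normal_pdf_cos (b th : R) :
  \int[mu]_x (cos (b * (x - m) + th) * p x) = expR (- (s ^+ 2 * b ^+ 2 / 2)) * cos th.
Proof.
pose f (t x : R) := cos (t * (x - m) + th) * p x.
pose C t := \int[mu]_x f t x.
have mp : measurable_fun setT p by exact: measurable_normal_pdf.
have mx : measurable_fun setT (fun x : R => x - m) by exact: measurable_funB.
have mth (t : R) : measurable_fun setT (fun x : R => t * (x - m) + th).
  by apply: measurable_funD => //; exact: measurable_funM.
have intf (t : R) : mu.-integrable setT (EFin \o f t).
  apply: (@integrable_normal_pdfM _ m s s0 _ 1).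
    exact: (measurableT_comp (continuous_measurable_fun (@continuous_cos R)) (mth t)).
  move=> x; rewrite mul1r (le_trans (cos_max _))//.
  by rewrite -addrA lerDl addr_ge0// sqr_ge0.
have df (t x : R) : is_derive t 1 (f ^~ x) (- sin (t * (x - m) + th) * (x - m) * p x).
  rewrite /f; apply: is_derive_eq; rewrite /GRing.scale/=; ring.
have Cd (t : R) : is_derive t 1 C (- (s ^+ 2 * t) * C t).
  have tI : `]t - 1, t + 1[%classic t.
    by rewrite /= in_itv/= ltrBlDr ltrDl ltr01.
  have h1 : forall x y, `]t - 1, t + 1[%classic x -> [set: R] y -> derivable (f^~ y) x 1.
    by move=> x y _ _; exact: (@ex_derive _ _ _ _ _ _ _ (df x y)).
  have p1 x y : partial1of2 f x y = - sin (x * (y - m) + th) * (y - m) * p y.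
    by rewrite partial1of2E; exact: (@derive_val _ _ _ _ _ _ _ (df x y)).
  pose G y := `|y - m| * p y.
  have G0 y : 0 <= G y by rewrite mulr_ge0// normal_pdf_ge0.
  have iG : mu.-integrable setT (EFin \o G).
    apply: (@integrable_normal_pdfM _ m s s0 (fun y => `|y - m|) 1).
      exact: measurableT_comp.
    by move=> x; rewrite normr_id mul1r addrAC lerDr addr_ge0// sqr_ge0.
  have h2 x y : `]t - 1, t + 1[%classic x -> [set: R] y -> `|partial1of2 f x y| <= G y.
    move=> _ _; rewrite p1 /G normrM (ger0_norm (normal_pdf_ge0 _ _ _)).
    rewrite ler_wpM2r ?normal_pdf_ge0// normrM ler_piMl// normrN.
    exact: sin_max.
  have D := differentiation_under_integral measurableT tI (fun x _ => intf x) h1 G0 iG h2.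
  have D' := derivable_under_integral measurableT tI (fun x _ => intf x) h1 G0 iG h2.
  apply: DeriveDef; first exact: D'.
  rewrite -derive1E D.
  have du (x : R) : is_derive x 1 (fun x => sin (t * (x - m) + th))
      (t * cos (t * (x - m) + th)).
    by apply: is_derive_eq; rewrite /GRing.scale/=; ring.
  have st := @normal_pdf_stein R m s s0 _ _ (1 + `|t|) du.
  transitivity (- \int[mu]_x ((x - m) * sin (t * (x - m) + th) * p x)).
    rewrite -mulN1r -RintegralZl//.
      by apply: eq_Rintegral => x _; rewrite p1; ring.
    apply: (@integrable_normal_pdfM _ m s s0 _ 1).
      apply: measurable_funM => //.
      exact: (measurableT_comp (continuous_measurable_fun (@continuous_sin R)) (mth t)).
    move=> x; rewrite normrM mul1r.
    apply: (@le_trans _ _ (`|x - m|)); first by rewrite ler_piMr// sin_max.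
    by rewrite addrAC lerDr addr_ge0// sqr_ge0.
  rewrite -st.
  - rewrite (_ : \int[mu]_x _ = t * C t).
      by ring.
    rewrite /C -RintegralZl//; apply: eq_Rintegral => x _; rewrite /f; ring.
  - move=> x; apply: cvgM; first exact: cvg_cst.
    apply: continuous_comp; last exact: continuous_cos.
    apply: cvgD; last exact: cvg_cst.
    by apply: cvgM; [exact: cvg_cst|apply: cvgB; [exact: cvg_id|exact: cvg_cst]].
  - move=> x; apply: (le_trans (sin_max _)).
    by rewrite mulrDl mul1r -addrA lerDl addr_ge0// mulr_ge0// addr_ge0.
  - move=> x; rewrite normrM (@le_trans _ _ `|t|)// ?lerDr//.
    by rewrite ler_piMr// cos_max.
pose D t := C t * expR (s ^+ 2 * t ^+ 2 / 2).
have D0 (t : R) : is_derive t 1 D 0.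
  have Ct := Cd t.
  by rewrite /D; apply: is_derive_eq; rewrite /GRing.scale/=; field.
have := is_derive_0_is_cst b 0 D0.
rewrite /D expr0n/= mulr0 mul0r expR0 mulr1.
have -> : C 0 = cos th.
  rewrite /C /f; under eq_Rintegral do rewrite mul0r add0r.
  by rewrite RintegralZl ?integrable_normal_pdf// /Rintegral integral_normal_pdf mulr1.
by move=> <-; rewrite mulrCA -expRD addrC subrr expR0 mulr1.
Qed.

Lemma normal_pdf_cos_center (th : R) :
  \int[mu]_x (cos (x - m + th) * p x) = expR (- (s ^+ 2 / 2)) * cos th.
Proof.
have := normal_pdf_cos 1 th; rewrite expr1n mulr1 => <-.
by apply: eq_Rintegral => x _; rewrite mul1r.
Qed.

End normal_moments.

(** * Trigonometric determination of laws and independence *)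

Section trigonometric_class.
Context {R : realType}.
Variable K : set (R -> R).
Hypothesis K_lin : forall (a : R) f g, K f -> K g -> K (fun x => a * f x + g x).
Hypothesis K_lim : forall (f_ : nat -> R -> R) (f : R -> R) (C : R),
  (forall n, K (f_ n)) -> (forall n x, `|f_ n x| <= C) ->
  (forall x, f_ n x @[n --> \oo] --> f x) -> K f.
Hypothesis K_trig : forall b th : R, K (fun x => cos (b * x + th)).

Let K0 : K (fun=> 0).
Proof.
have := K_lin (-1) (K_trig 0 0) (K_trig 0 0); congr K.
by apply/funext => x; ring.
Qed.

(** Each factor sin u is absorbed by 2 sin u cos v = sin (u + v) + sin (u - v), a sine being a
    cosine shifted by pi / 2. The extra cosine is what carries the induction. *)
Let Ksin_cos (b th : R) (n : nat) (b' th' : R) :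
  K (fun x => sin (b * x + th) ^+ n * cos (b' * x + th')).
Proof.
elim: n b' th' => [|n IH] b' th'.
  by under eq_fun do rewrite expr0 mul1r; exact: K_trig.
have h := K_lin 2^-1 (IH (b + b') (th + th' - pi / 2))
   (K_lin 2^-1 (IH (b - b') (th - th' - pi / 2)) K0).
move: h; congr K; apply/funext => x.
rewrite [(b + b') * x + _](_ : _ = (b * x + th) + (b' * x + th') - pi / 2); last by ring.
rewrite [(b - b') * x + _](_ : _ = (b * x + th) - (b' * x + th') - pi / 2); last by ring.
set u := b * x + th; set v := b' * x + th'.
by rewrite !cosBpihalf (sinD u v) (sinB u v) exprSr; field.
Qed.

Let Kpoly (b th : R) (p : {poly R}) : K (fun x => p.[sin (b * x + th)]).
Proof.
pose S n := fun x : R => \sum_(i < n) p`_i * sin (b * x + th) ^+ i.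
suff KS n : K (S n).
  by have := KS (size p); congr K; apply/funext => x; rewrite horner_coef.
elim: n => [|n IH].
  by rewrite /S; under eq_fun do rewrite big_ord0; exact: K0.
have := K_lin p`_n (Ksin_cos b th n 0 0) IH; congr K; apply/funext => x.
by rewrite /S big_ord_recr /= mul0r addr0 cos0 mulr1 addrC.
Qed.

(* The iterates of s |-> (3s - s^3)/2 converge to the sign on [-1, 1]. *)
Let g (p : {poly R}) : {poly R} := 2^-1 *: (3 *: p - p ^+ 3).
Let G n := iter n g 'X.

Let GS n x : (G n.+1).[x] = (3 * (G n).[x] - (G n).[x] ^+ 3) / 2.
Proof. by rewrite /G iterS /g !hornerE mulrC. Qed.

Let G0 n : (G n).[0] = 0.
Proof. by elim: n => [|n IH]; rewrite ?GS ?IH /G/= ?hornerE// expr0n/=; ring. Qed.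

Let GN n x : (G n).[- x] = - (G n).[x].
Proof. by elim: n => [|n IH]; rewrite ?GS ?IH /G/= ?hornerE//; ring. Qed.

(** One iteration multiplies 1 - y by (1 - y)(2 + y) / 2, which is at most 1 - x / 2 as long as y >=
    x; the convergence to 1 is geometric. *)
Let Gpos n x : 0 < x -> x <= 1 ->
  [/\ x <= (G n).[x], (G n).[x] <= 1 & 1 - (G n).[x] <= (1 - x / 2) ^+ n].
Proof.
move=> x0 x1; elim: n => [|n [h1 h2 h3]].
  by rewrite /G/= hornerX expr0; split=> //; lra.
rewrite GS; move: h1 h2 h3; set y := (G n).[x] => h1 h2 h3.
have y3 : 1 - (3 * y - y ^+ 3) / 2 = (1 - y) * ((1 - y) * (2 + y) / 2).
  by field.
have y4 : 0 <= (1 - y) * (2 + y) / 2 <= 1 - x / 2 by nra.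
case/andP : y4 => y40 y41; split.
- apply: (le_trans h1); rewrite -subr_ge0.
  rewrite [leRHS](_ : _ = y * ((1 - y) * (1 + y)) / 2); last by field.
  by rewrite divr_ge0// mulr_ge0 ?mulr_ge0//; lra.
- by rewrite -subr_ge0 y3 mulr_ge0//; lra.
- by rewrite y3 exprSr ler_pM//; lra.
Qed.

Let Gsg x : `|x| <= 1 -> (G n).[x] @[n --> \oo] --> Num.sg x.
Proof.
have pos y : 0 < y -> y <= 1 -> (G n).[y] @[n --> \oo] --> (1 : R).
  move=> y0 y1.
  have h : 1 - (G n).[y] @[n --> \oo] --> (0 : R).
    apply: (@squeeze_cvgr _ _ _ _ (cst 0) (fun n => (1 - y / 2) ^+ n)).
    - apply: nearW => n /=; have [_ h1 h2] := Gpos n y0 y1.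
      by rewrite subr_ge0 h1.
    - exact: cvg_cst.
    - by apply: cvg_expr; rewrite ger0_norm; lra.
  have -> : (fun n => (G n).[y]) = (fun n => 1 - (1 - (G n).[y])).
    by apply/funext => n; rewrite subKr.
  by rewrite -[X in _ --> X](subr0 1); apply: cvgB h; exact: cvg_cst.
move=> x1; have [x0|x0|<-] := ltgtP 0 x.
- by rewrite gtr0_sg//; apply: pos => //; rewrite -(gtr0_norm x0).
- rewrite ltr0_sg//; rewrite -[x]opprK; under eq_fun do rewrite GN.
  by apply: cvgN; apply: pos; rewrite ?oppr_gt0// -(ltr0_norm x0).
- by rewrite sgr0; under eq_fun do rewrite G0; exact: cvg_cst.
Qed.

Let Gle1 n x : `|x| <= 1 -> `|(G n).[x]| <= 1.
Proof.
have pos y : 0 < y -> y <= 1 -> `|(G n).[y]| <= 1.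
  by move=> y0 y1; have [h1 h2 _] := Gpos n y0 y1; rewrite ger0_norm//; lra.
move=> x1; have [x0|x0|<-] := ltgtP 0 x.
- by apply: pos => //; rewrite -(gtr0_norm x0).
- by rewrite -[x]opprK GN normrN pos ?oppr_gt0// -(ltr0_norm x0).
- by rewrite G0 normr0.
Qed.

Let Ksg_sin b th : K (fun x => Num.sg (sin (b * x + th))).
Proof.
apply: (K_lim (f_ := fun n x => (G n).[sin (b * x + th)]) (C := 1)).
- by move=> n; exact: Kpoly.
- by move=> n x; apply: Gle1; exact: sin_max.
- by move=> x; apply: Gsg; exact: sin_max.
Qed.

Let sg_le1 (x : R) : `|Num.sg x| <= 1.
Proof. by rewrite normr_sg; case: (x != 0). Qed.

(** For large n the point (x - c) / (n + 1) lies within pi / 2 of 0, where the sine has the sign of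
    its argument. *)
Let Ksg c : K (fun x => Num.sg (x - c)).
Proof.
apply: (K_lim (f_ := fun n x => Num.sg (sin (n.+1%:R^-1 * x - n.+1%:R^-1 * c))) (C := 1)).
- by move=> n; exact: Ksg_sin.
- by move=> n x.
move=> x; apply: cvg_near_cst; near=> n.
rewrite -mulrBr; set y := x - c.
have n0 : 0 < n.+1%:R^-1 :> R by rewrite invr_gt0.
have yn : n.+1%:R^-1 * `|y| < pi / 2.
  rewrite (@lt_le_trans _ _ 1) ?pihalf_ge1//.
  rewrite mulrC ltr_pdivrMr// mul1r.
  by rewrite (@le_lt_trans _ _ n%:R) ?ltr_nat//; near: n; exact: nbhs_infty_ger.
have [y0|y0|<-] := ltgtP 0 y.
- move: yn; rewrite gtr0_norm// => yn.
  by rewrite !gtr0_sg// sin_gt0_pihalf// yn andbT mulr_gt0.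
- move: yn; rewrite ltr0_norm// => yn.
  rewrite [RHS]ltr0_sg// ltr0_sg// -oppr_gt0 -sinN -mulrN.
  by rewrite sin_gt0_pihalf// yn andbT mulr_gt0// oppr_gt0.
- by rewrite mulr0 sin0.
Unshelve. all: by end_near. Qed.

Lemma trigonometric_class_half_line (c : R) : K (\1_`]c, +oo[ : R -> R).
Proof.
have K1 : K (fun=> 1).
  by have := K_trig 0 0; congr K; apply/funext => x; rewrite mul0r addr0 cos0.
(* The threshold is shifted to c + 1 / (n + 1) because the sign is 0 at its jump: without the shift
   the limit would be 1 / 2 at c. *)
apply: (K_lim (f_ := fun n x => 2^-1 * Num.sg (x - (c + n.+1%:R^-1)) + (2^-1 * 1 + 0)) (C := 1)).
- by move=> n; apply: K_lin; [exact: Ksg|exact: (K_lin _ K1 K0)].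
- move=> n x; rewrite (le_trans (ler_normD _ _))// normrM mulr1 addr0 ger0_norm//.
  have := sg_le1 (x - (c + n.+1%:R^-1)); lra.
move=> x; rewrite indicE; have [cx|xc] := ltP c x.
  rewrite mem_set ?in_itv//=; last by rewrite in_itv/= cx.
  have xc0 : 0 < x - c by rewrite subr_gt0.
  apply: cvg_near_cst; near=> n.
  rewrite gtr0_sg; first by rewrite mulr1n; field.
  rewrite subr_gt0 -ltrBrDl.
  by near: n; exact: near_infty_natSinv_lt (PosNum xc0).
rewrite memNset; last by rewrite /= in_itv/= andbT; apply/negP; rewrite -leNgt.
apply: cvg_near_cst; apply: nearW => n.
rewrite ltr0_sg; first by rewrite mulr0n; field.
by rewrite subr_lt0 (le_lt_trans xc)// ltrDl invr_gt0.
Unshelve. all: by end_near. Qed.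

End trigonometric_class.

Lemma cvg_norm_le {R : realType} (u : nat -> R) (l C : R) :
  u n @[n --> \oo] --> l -> (forall n, `|u n| <= C) -> `|l| <= C.
Proof.
move=> ul uC; have h : `|u n| @[n --> \oo] --> `|l| by exact: cvg_norm.
rewrite -(cvg_lim (@Rhausdorff R) h).
by apply: limr_le; [exact: cvgP h|exact: nearW].
Qed.

Section bounded_expectation.
Context d {Omega : measurableType d} {R : realType} (P : probability Omega R).

Lemma bounded_integrable (f : Omega -> R) (C : R) :
  measurable_fun setT f -> (forall w, `|f w| <= C) ->
  P.-integrable setT (EFin \o f).
Proof.
move=> mf fC; apply: measurable_bounded_integrable => //.
  by rewrite (le_lt_trans (probability_le1 _ _))// ltry.
exists C; split; first exact: num_real.
by move=> M CM w _ /=; rewrite (le_trans (fC w))// ltW.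
Qed.

Lemma bounded_convergence (f_ : nat -> Omega -> R) (f : Omega -> R) (C : R) :
  (forall n, measurable_fun setT (f_ n)) -> (forall n w, `|f_ n w| <= C) ->
  (forall w, f_ n w @[n --> \oo] --> f w) ->
  \int[P]_w f_ n w @[n --> \oo] --> \int[P]_w f w.
Proof.
move=> mf fC ff.
have mf' : measurable_fun setT f.
  by apply: (measurable_fun_cvg mf) => w _; exact: ff.
have fC' w : `|f w| <= C by apply: (cvg_norm_le (ff w)) => n; exact: fC.
apply: fine_cvg; rewrite fineK; last first.
  by apply: integrable_fin_num => //; exact: bounded_integrable fC'.
apply: (@dominated_cvg _ _ _ P _ measurableT _ _ (fun=> C%:E)) => //.
- by move=> n; exact/measurable_EFinP.
- by move=> w _; apply: cvg_EFin; [exact: nearW|exact: ff].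
- exact: finite_measure_integrable_cst.
- by move=> n w _; rewrite /= lee_fin.
Qed.

End bounded_expectation.

(** Open half-lines are stable under intersection and generate the Borel sets, and the ]-n, +oo[
    exhaust the line with finite mass. *)
Lemma half_line_measure_unique {R : realType}
    (m1 m2 : {measure set R -> \bar R}) :
  (forall c : R, m1 `]c, +oo[%classic = m2 `]c, +oo[%classic) ->
  (forall c : R, m1 `]c, +oo[%classic < +oo)%E ->
  forall A, measurable A -> m1 A = m2 A.
Proof.
move=> m12 m1y A mA.
apply: (@measure_unique _ R R (@RGenOInfty.G R)
  (fun n => `](- n%:R), +oo[%classic) _ _ _ _ m1 m2) => //.
- exact: RGenOInfty.measurableE.
- move=> _ _ [a ->] [b ->]; exists (Num.max a b).
  apply/seteqP; split => x /=; rewrite !in_itv/= !andbT gt_max.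
    by case=> -> ->.
  by move/andP.
- by move=> n; exists (- n%:R).
- apply/seteqP; split => // x _; exists (Num.bound x) => //=.
  by rewrite in_itv/= andbT ltrNl unstable.ltrNbound.
- by move=> _ [a ->].
Qed.

Section cosine_transform.
Context d {Omega : measurableType d} {R : realType} (P : probability Omega R).

Let mcos : measurable_fun setT (@cos R).
Proof. exact: continuous_measurable_fun (@continuous_cos R). Qed.

Lemma measurable_cosD (f : Omega -> R) th :
  measurable_fun setT f -> measurable_fun setT (fun w => cos (f w + th)).
Proof.
move=> mf; have mg : measurable_fun setT (fun w => f w + th) by exact: measurable_funD.
exact: (measurableT_comp mcos mg).
Qed.

(** With cos (b Y + th') in place of the indicator, the product-to-sum formula only involves l + b Y
    and l - b Y, which stay in [M]; the trigonometric class does the rest. The conclusion is the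
    last hypothesis for a new weight, so the lemma can be iterated. *)
Lemma half_line_weight (M : set (Omega -> R)) (kappa Y : Omega -> R) (C : R) :
  measurable_fun setT kappa -> (forall w, `|kappa w| <= C) ->
  measurable_fun setT Y -> (forall l, M l -> measurable_fun setT l) ->
  (forall l b, M l -> M (fun w => l w + b * Y w)) ->
  (forall l th, M l -> \int[P]_w (kappa w * cos (l w + th)) = 0) ->
  forall c l th, M l ->
    \int[P]_w (kappa w * \1_`]c, +oo[ (Y w) * cos (l w + th)) = 0.
Proof.
move=> mk kC mY mM MY k0 c l th Ml.
pose K : set (R -> R) := [set f : R -> R | [/\ measurable_fun setT f,
  exists D : R, forall x : R, `|f x| <= D &
  \int[P]_w (kappa w * f (Y w) * cos (l w + th)) = 0]].
have mcl := measurable_cosD th (mM _ Ml).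
have mkf (f : R -> R) : measurable_fun setT f ->
    measurable_fun setT (fun w => kappa w * f (Y w) * cos (l w + th)).
  move=> mf; apply: measurable_funM => //; apply: measurable_funM => //.
  exact: (measurableT_comp mf mY).
have kfC (f : R -> R) (D : R) : (forall x, `|f x| <= D) ->
    forall w, `|kappa w * f (Y w) * cos (l w + th)| <= C * D.
  move=> fD w; rewrite !normrM -[leRHS]mulr1.
  by rewrite ler_pM ?cos_max// ler_pM.
suff : K \1_`]c, +oo[ by case.
apply: trigonometric_class_half_line.
- move=> a f g [mf [D fD] f0] [mg [E gE] g0]; split.
  + by apply: measurable_funD => //; exact: measurable_funM.
  + exists (`|a| * D + E) => x; rewrite (le_trans (ler_normD _ _))// lerD//.
    by rewrite normrM ler_wpM2l.
  + transitivity (\int[P]_w (a * (kappa w * f (Y w) * cos (l w + th)) +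
                   kappa w * g (Y w) * cos (l w + th))).
      by apply: eq_Rintegral => w _; ring.
    have if_ := bounded_integrable P (mkf _ mf) (kfC _ _ fD).
    have ig := bounded_integrable P (mkf _ mg) (kfC _ _ gE).
    rewrite RintegralD//; first by rewrite RintegralZl// f0 g0 mulr0 addr0.
    by apply: (bounded_integrable P (C := `|a| * (C * D))) => [|w];
      [apply: measurable_funM => //; exact: mkf|rewrite normrM ler_wpM2l// kfC].
- move=> f_ f D Kf fD ff; split.
  + by apply: (measurable_fun_cvg (h := f_)) => [n|x _]; [case: (Kf n)|exact: ff].
  + by exists D => x; apply: (cvg_norm_le (ff x)) => n; exact: fD.
  + have mf_ n : measurable_fun setT (f_ n) by case: (Kf n).
    have fw w : kappa w * f_ n (Y w) * cos (l w + th) @[n --> \oo] -->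
        kappa w * f (Y w) * cos (l w + th).
      apply: cvgM; last exact: cvg_cst.
      by apply: cvgM; [exact: cvg_cst|exact: ff].
    have h := @bounded_convergence _ _ _ P _ _ _ (fun n => mkf _ (mf_ n)) (fun n => kfC _ _ (fD n)) fw.
    have e : (fun n => \int[P]_w (kappa w * f_ n (Y w) * cos (l w + th))) = (fun=> 0).
      by apply/funext => n; case: (Kf n).
    by rewrite e in h; rewrite (cvg_unique _ h (cvg_cst 0)).
- move=> b th'; split.
  + have h : measurable_fun setT (fun x : R => b * x + th').
      by apply: measurable_funD => //; exact: measurable_funM.
    exact: (measurableT_comp mcos h).
  + by exists 1 => x; exact: cos_max.
  + transitivity (\int[P]_w (2^-1 * (kappa w * cos (l w + b * Y w + (th + th'))) +
                    2^-1 * (kappa w * cos (l w + - b * Y w + (th - th'))))).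
      apply: eq_Rintegral => w _.
      rewrite (_ : l w + b * Y w + _ = (l w + th) + (b * Y w + th')); last by ring.
      rewrite (_ : l w + - b * Y w + _ = (l w + th) - (b * Y w + th')); last by ring.
      move: (l w + th) (b * Y w + th') => u v.
      by rewrite cosD cosB; field.
    have ik u b' : P.-integrable setT (EFin \o (fun w => kappa w * cos (l w + b' * Y w + u))).
      apply: (bounded_integrable P (C := C)) => [|w].
        by apply: measurable_funM => //; apply: measurable_cosD; apply/mM/MY.
      by rewrite normrM -[leRHS]mulr1 ler_pM// cos_max.
    rewrite RintegralD//.
    - by rewrite !RintegralZl// !k0 ?mulr0 ?addr0//; exact: MY.
    - exact: integrableZl_EFin.
    - exact: integrableZl_EFin.
Qed.

End cosine_transform.

(** The bounded measurable functions with the same expectation under both laws satisfy the closure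
    conditions of a trigonometric class, hence include the half-lines. *)
Lemma distribution_eq_cos (R : realType) d1 d2 (O1 : measurableType d1)
    (O2 : measurableType d2) (P1 : probability O1 R) (P2 : probability O2 R)
    (X1 : {RV P1 >-> R}) (X2 : {RV P2 >-> R}) :
  (forall b th : R, \int[P1]_w cos (b * X1 w + th) = \int[P2]_w cos (b * X2 w + th)) ->
  forall A, measurable A -> distribution P1 X1 A = distribution P2 X2 A.
Proof.
move=> X12.
have mX1 : measurable_fun setT X1 by [].
have mX2 : measurable_fun setT X2 by [].
pose K : set (R -> R) := [set f : R -> R | [/\ measurable_fun setT f,
  exists D : R, forall x : R, `|f x| <= D &
  \int[P1]_w f (X1 w) = \int[P2]_w f (X2 w)]].
have mf1 (f : R -> R) : measurable_fun setT f -> measurable_fun setT (fun w => f (X1 w)).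
  by move=> mf; exact: (measurableT_comp mf mX1).
have mf2 (f : R -> R) : measurable_fun setT f -> measurable_fun setT (fun w => f (X2 w)).
  by move=> mf; exact: (measurableT_comp mf mX2).
have KP c : K \1_`]c, +oo[.
  apply: trigonometric_class_half_line.
  - move=> a f g [mf [D fD] f0] [mg [E gE] g0]; split.
    + by apply: measurable_funD => //; exact: measurable_funM.
    + exists (`|a| * D + E) => x; rewrite (le_trans (ler_normD _ _))// lerD//.
      by rewrite normrM ler_wpM2l.
    + have i1 := bounded_integrable P1 (mf1 _ mf) (fun w => fD (X1 w)).
      have i2 := bounded_integrable P2 (mf2 _ mf) (fun w => fD (X2 w)).
      have i3 := bounded_integrable P1 (mf1 _ mg) (fun w => gE (X1 w)).
      have i4 := bounded_integrable P2 (mf2 _ mg) (fun w => gE (X2 w)).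
      rewrite !RintegralD//; first by rewrite !RintegralZl// f0 g0.
      * exact: integrableZl_EFin.
      * exact: integrableZl_EFin.
  - move=> f_ f D Kf fD ff.
    have mf_ n : measurable_fun setT (f_ n) by case: (Kf n).
    split.
    + by apply: (measurable_fun_cvg mf_) => x _; exact: ff.
    + by exists D => x; apply: (cvg_norm_le (ff x)) => n; exact: fD.
    + have h1 := @bounded_convergence _ _ _ P1 (fun n w => f_ n (X1 w))
        (fun w => f (X1 w)) D (fun n => mf1 _ (mf_ n)) (fun n w => fD n (X1 w))
        (fun w => ff (X1 w)).
      have h2 := @bounded_convergence _ _ _ P2 (fun n w => f_ n (X2 w))
        (fun w => f (X2 w)) D (fun n => mf2 _ (mf_ n)) (fun n w => fD n (X2 w))
        (fun w => ff (X2 w)).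
      have e : (fun n => \int[P1]_w f_ n (X1 w)) = (fun n => \int[P2]_w f_ n (X2 w)).
        by apply/funext => n; case: (Kf n).
      by rewrite e in h1; exact: (cvg_unique _ h1 h2).
  - move=> b th; split => //.
    + by apply: measurable_cosD; exact: measurable_funM.
    + by exists 1 => x; exact: cos_max.
move=> A mA; apply: (@half_line_measure_unique R (distribution P1 X1) (distribution P2 X2)) => // c; last first.
  by rewrite (le_lt_trans (probability_le1 _ _))// ltry.
have [_ _] := KP c.
have indE d (O : measurableType d) (P : probability O R) (X : {RV P >-> R}) :
    \int[P]_w \1_`]c, +oo[ (X w) = fine (distribution P X `]c, +oo[%classic).
  rewrite /Rintegral /distribution /pushforward -[in RHS](setIT (X @^-1` _)) -integral_indic//.
  by rewrite -[X in measurable X]setTI; exact: measurable_funPT.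
rewrite !indE.
by move=> e; rewrite -[LHS]fineK ?fin_num_measure// e fineK// fin_num_measure.
Qed.

(** * Independence from finitely many variables *)

Section independence.
Context d {Omega : measurableType d} {R : realType} (P : probability Omega R).
Context (n : nat) (Y : 'I_n -> Omega -> R) (Z : {RV P >-> R}).
Hypothesis mY : forall i, measurable_fun setT (Y i).

Let lc (a : 'I_n -> R) (w : Omega) : R := \sum_(i < n) a i * Y i w.

Hypothesis YZ : forall (a : 'I_n -> R) (b th th' : R),
  \int[P]_w (cos (lc a w + th) * cos (b * Z w + th')) =
  \int[P]_w cos (lc a w + th) * \int[P]_w cos (b * Z w + th').

(** Lists of constraints make intersection a concatenation, the whole space the empty list, and
    allow a coordinate to be unconstrained. *)
Definition orthants : set (set Omega) :=
  [set B | exists s : seq ('I_n * R), B = [set w | all (fun p => p.2 < Y p.1 w) s]].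

Lemma orthantsI : setI_closed orthants.
Proof.
move=> _ _ [s ->] [s' ->]; exists (s ++ s').
by apply/seteqP; split => w /=; rewrite all_cat => /andP.
Qed.

Let mlc a : measurable_fun setT (lc a).
Proof. by apply: measurable_sum => i; exact: measurable_funM. Qed.

Let M : set (Omega -> R) := [set l | exists a, l = lc a].

Let MY l i b : M l -> M (fun w => l w + b * Y i w).
Proof.
move=> [a ->]; exists (fun j => a j + b * (j == i)%:R); apply/funext => w.
rewrite /lc; under [RHS]eq_bigr do rewrite mulrDl; rewrite big_split/=; congr +%R.
rewrite (bigD1 i)//= eqxx mulr1 big1 ?addr0// => j /negbTE ->.
by rewrite mulr0 mul0r.
Qed.

Let mM l : M l -> measurable_fun setT l.
Proof. by move=> [a ->]. Qed.

Let all_cons_indic s p w :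
  \1_[set w | all (fun q : 'I_n * R => q.2 < Y q.1 w) (p :: s)] w =
  \1_[set w | all (fun q : 'I_n * R => q.2 < Y q.1 w) s] w * \1_`]p.2, +oo[ (Y p.1 w) :> R.
Proof.
rewrite !indicE -natrM mulnb; congr (_%:R); congr (nat_of_bool _).
apply/idP/andP.
  by rewrite inE/= => /andP[h1 h2]; rewrite !inE/= in_itv/= h1.
by rewrite !inE/= in_itv/= andbT => -[-> ->].
Qed.

Lemma orthants_measurable : orthants `<=` measurable.
Proof.
move=> _ [s ->]; elim: s => [|p s IH].
  by rewrite (_ : [set _ | _] = setT)//; apply/seteqP; split.
rewrite (_ : [set _ | _] = (Y p.1 @^-1` `]p.2, +oo[%classic) `&`
   [set w | all (fun q : 'I_n * R => q.2 < Y q.1 w) s]).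
  apply: measurableI => //.
  by rewrite -[X in measurable X]setTI; apply: mY.
by apply/seteqP; split => w /=; rewrite in_itv/= andbT => /andP.
Qed.

(* The orthant is built up one half-space at a time, which keeps the integrals
   against all [cos (l + th)] equal to zero. *)
Let weight_orthant (kappa : Omega -> R) (C : R) s :
  measurable_fun setT kappa -> (forall w, `|kappa w| <= C) ->
  (forall l th, M l -> \int[P]_w (kappa w * cos (l w + th)) = 0) ->
  \int[P]_w (kappa w * \1_[set w | all (fun q : 'I_n * R => q.2 < Y q.1 w) s] w) = 0.
Proof.
move=> mk kC k0.
pose k s w := kappa w * \1_[set w | all (fun q : 'I_n * R => q.2 < Y q.1 w) s] w.
have mks s' : measurable_fun setT (k s').
  apply: measurable_funM => //; apply: measurable_indic.
  by apply: orthants_measurable; exists s'.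
have kCs s' w : `|k s' w| <= C.
  rewrite /k normrM -[leRHS]mulr1 ler_pM// indicE.
  by case: (_ \in _); rewrite ?normr1 ?normr0.
suff h : forall l th, M l -> \int[P]_w (k s w * cos (l w + th)) = 0.
  have M0 : M (lc (fun=> 0)) by exists (fun=> 0).
  have := h _ 0 M0; under eq_Rintegral => w _.
    rewrite /lc big1 ?addr0 ?cos0 ?mulr1//; last by move=> i _; rewrite mul0r.
    over.
  by [].
elim: s => [|p s IH] l th Ml.
  under eq_Rintegral => w _.
    rewrite /k (_ : \1__ w = 1); last by rewrite indicE mem_set.
    rewrite mulr1; over.
  exact: k0.
under eq_Rintegral => w _ do rewrite /k all_cons_indic mulrA -/(k s w).
apply: (half_line_weight (P := P) (M := M) (kappa := k s) (C := C)) => //.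
by move=> l' b Ml'; exact: MY.
Qed.

Let mZ : measurable_fun setT Z. Proof. by []. Qed.

Let rectangle B c : orthants B ->
  P (B `&` Z @^-1` `]c, +oo[%classic) = (P B * P (Z @^-1` `]c, +oo[%classic))%E.
Proof.
move=> oB; have mB := orthants_measurable oB.
have mD : measurable (Z @^-1` `]c, +oo[%classic).
  by rewrite -[X in measurable X]setTI; exact: mZ.
case: (oB) => s BE.
have i1B : P.-integrable setT (EFin \o (\1_B : Omega -> R)) by exact: integrable_indic.
have mcosZ b th : measurable_fun setT (fun w => cos (b * Z w + th)).
  by apply: measurable_cosD; exact: measurable_funM.
have icosZ b th : P.-integrable setT (EFin \o (fun w => cos (b * Z w + th))).
  by apply: (bounded_integrable P (C := 1)) => [|w]; [exact: mcosZ|exact: cos_max].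
have iB : \int[P]_w \1_B w = fine (P B) by rewrite /Rintegral integral_indic// setIT.
have h1 b th : \int[P]_w (\1_B w * cos (b * Z w + th)) =
     fine (P B) * \int[P]_w cos (b * Z w + th).
  (* By [YZ] this centered cosine integrates to 0 against every [cos (lc a w + th')], so the
     indicator of the orthant can be inserted. *)
  pose kappa w := cos (b * Z w + th) - \int[P]_w cos (b * Z w + th).
  have := @weight_orthant kappa (1 + `|\int[P]_w cos (b * Z w + th)|) s.
  rewrite -BE => h.
  have {h} : \int[P]_w (kappa w * \1_B w) = 0.
    apply: h.
    - by apply: measurable_funB.
    - by move=> w; rewrite (le_trans (ler_normB _ _))// lerD2r cos_max.
    - move=> _ th' [a ->].
      have m1 : measurable_fun setT (fun w => cos (lc a w + th')).
        exact: measurable_cosD.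
      transitivity (\int[P]_w (cos (lc a w + th') * cos (b * Z w + th) -
           \int[P]_w cos (b * Z w + th) * cos (lc a w + th'))).
        by apply: eq_Rintegral => w _; rewrite /kappa; ring.
      have i1 : P.-integrable setT (EFin \o (fun w => cos (lc a w + th'))).
        by apply: (bounded_integrable P (C := 1)) => // w; exact: cos_max.
      rewrite RintegralB//; last 2 first.
      - apply: (bounded_integrable P (C := 1)) => [|w].
          by apply: measurable_funM.
        by rewrite normrM -[leRHS]mulr1 ler_pM// cos_max.
      - exact: integrableZl_EFin.
      by rewrite RintegralZl// YZ mulrC subrr.
  rewrite /kappa; under eq_Rintegral do rewrite mulrBl.
  rewrite RintegralB//; last 2 first.
  - apply: (bounded_integrable P (C := 1)) => [|w].
      by apply: measurable_funM => //; exact: measurable_indic.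
    rewrite normrM -[leRHS]mulr1 ler_pM// ?cos_max// indicE.
    by case: (_ \in _); rewrite ?normr1 ?normr0.
  - exact: integrableZl_EFin.
  rewrite RintegralZl// iB => /eqP; rewrite subr_eq0 => /eqP h.
  rewrite mulrC -h; by apply: eq_Rintegral => w _; rewrite mulrC.
(* The roles are exchanged: the weight is the centered indicator of [B], orthogonal to the cosines
   of [Z] by [h1], and a half-line of [Z] is inserted. *)
pose kappa w := \1_B w - fine (P B) : R.
have mkappa : measurable_fun setT kappa.
  by apply: measurable_funB => //; exact: measurable_indic.
pose M2 : set (Omega -> R) := [set l | exists b, l = fun w => b * Z w].
have := @half_line_weight _ _ _ P M2 kappa Z (1 + `|fine (P B)|) mkappa _ mZ _ _ _ c (fun w => 0 * Z w) 0.
have M20 : M2 (fun w => 0 * Z w) by exists 0.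
have h2 w : `|kappa w| <= 1 + `|fine (P B)|.
  rewrite (le_trans (ler_normB _ _))// lerD2r indicE.
  by case: (_ \in _); rewrite ?normr1 ?normr0.
have h3 l : M2 l -> measurable_fun setT l.
  by move=> [b ->]; exact: measurable_funM.
have h4 l b : M2 l -> M2 (fun w => l w + b * Z w).
  by move=> [b' ->]; exists (b' + b); apply/funext => w; rewrite mulrDl.
have h5 l th : M2 l -> \int[P]_w (kappa w * cos (l w + th)) = 0.
  move=> [b ->]; rewrite /kappa; under eq_Rintegral do rewrite mulrBl.
  rewrite RintegralB//; last 2 first.
  - apply: (bounded_integrable P (C := 1)) => [|w].
      by apply: measurable_funM => //; exact: measurable_indic.
    rewrite normrM -[leRHS]mulr1 ler_pM// ?cos_max// indicE.
    by case: (_ \in _); rewrite ?normr1 ?normr0.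
  - exact: integrableZl_EFin.
  by rewrite RintegralZl// h1 subrr.
move=> /(_ h2 h3 h4 h5 M20).
set D := Z @^-1` _ in mD *.
have DE w : \1_`]c, +oo[ (Z w) = \1_D w :> R by [].
under eq_Rintegral do rewrite mul0r addr0 cos0 mulr1 DE mulrBl.
rewrite RintegralB//; last 2 first.
- apply: (bounded_integrable P (C := 1)) => [|w].
    by apply: measurable_funM => //; exact: measurable_indic.
  by rewrite !indicE; do 2 case: (_ \in _); rewrite ?mulr1 ?mulr0 ?normr1 ?normr0.
- by apply: integrableZl_EFin => //; exact: integrable_indic.
rewrite RintegralZl//; last exact: integrable_indic.
under eq_Rintegral do rewrite -[_ * _]/((\1_B \* \1_D) _) -indicI.
rewrite /Rintegral !integral_indic//; last exact: measurableI.
rewrite !setIT => /eqP; rewrite subr_eq0 => /eqP e.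
by rewrite -[LHS]fineK ?fin_num_measure ?e ?EFinM ?fineK ?fin_num_measure//; exact: measurableI.
Qed.

Let mZD (D : set R) : measurable D -> measurable (Z @^-1` D).
Proof. by move=> mD; rewrite -[X in measurable X]setTI; exact: mZ. Qed.

(** Two uniqueness arguments for finite measures: in [D] for a fixed orthant, determined by
    half-lines; then in [B] for a fixed [D], determined by the orthants. *)
Lemma orthants_independent B D : <<s orthants >> B -> measurable D ->
  P (B `&` Z @^-1` D) = (P B * P (Z @^-1` D))%E.
Proof.
move=> sB mD.
have PfB (B' : set Omega) : measurable B' -> (P B' = (NngNum (fine_ge0 (measure_ge0 P B')))%:num%:E)%E.
  by move=> mB'; rewrite /= fineK// fin_num_measure.
have oB B' E : orthants B' -> measurable E ->
    P (B' `&` Z @^-1` E) = (P B' * P (Z @^-1` E))%E.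
  move=> oB' mE; have mB' := orthants_measurable oB'.
  pose m1 := pushforward (mrestr P mB') Z.
  pose m2 := mscale (NngNum (fine_ge0 (measure_ge0 P B'))) (distribution P Z).
  have : m1 E = m2 E.
    apply: half_line_measure_unique => // c.
    - change (P (Z @^-1` `]c, +oo[%classic `&` B') =
        (fine (P B'))%:E * P (Z @^-1` `]c, +oo[%classic))%E.
      by rewrite setIC rectangle// fineK// fin_num_measure.
    - change (P (Z @^-1` `]c, +oo[%classic `&` B') < +oo)%E.
      rewrite (le_lt_trans (probability_le1 _ _)) ?ltry//.
      by apply: measurableI => //; exact: mZD.
  by rewrite /m1 /m2 /pushforward /mrestr /mscale setIC -PfB.
have mZE := mZD mD.
pose m1 := mrestr P mZE.
pose m2 := mscale (NngNum (fine_ge0 (measure_ge0 P (Z @^-1` D)))) P.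
have : m1 B = m2 B.
  apply: (g_sigma_algebra_measure_unique orthants orthants_measurable (fun=> setT)) => //.
  - by move=> _; exists [::]; apply/seteqP; split.
  - by apply/seteqP; split => // w _; exists 0%N.
  - exact: orthantsI.
  - move=> A oA; change (P (A `&` Z @^-1` D) = (fine (P (Z @^-1` D)))%:E * P A)%E.
    by rewrite oB// fineK ?fin_num_measure// muleC.
  - move=> _; change (P (setT `&` Z @^-1` D) < +oo)%E; rewrite (le_lt_trans (probability_le1 _ _)) ?ltry//.
    exact: measurableI.
by rewrite /m1 /m2 /mrestr /mscale -PfB// muleC.
Qed.

End independence.

(** * Square-integrable random variables *)

Section square_integrable.
Context d {Omega : measurableType d} {R : realType} (P : probability Omega R).
Implicit Types X Y Z : Omega -> R.

Definition sq_int X : Prop := measurable_fun setT X /\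
  P.-integrable setT (EFin \o (fun w => X w ^+ 2)).

Lemma sq_intM X Y : sq_int X -> sq_int Y ->
  P.-integrable setT (EFin \o (fun w => X w * Y w)).
Proof.
move=> [mX iX] [mY iY]; have i := integrableD_EFin measurableT iX iY.
apply: (@le_integrable_EFin _ _ _ P setT measurableT _ (fun w => X w ^+ 2 + Y w ^+ 2)) => //.
  exact: measurable_funM.
move=> w _; rewrite normrM.
rewrite -[X w ^+ 2]real_normK ?num_real// -[Y w ^+ 2]real_normK ?num_real//.
have := normr_ge0 (X w); have := normr_ge0 (Y w).
move: `|X w| `|Y w| => a b a0 b0; have := sqr_ge0 (a - b).
rewrite sqrrB; have := mulr_ge0 b0 a0; rewrite mulr2n; lra.
Qed.

Lemma sq_int_cst (c : R) : sq_int (fun=> c).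
Proof. by split => //; exact: finite_measure_integrable_cst. Qed.

Lemma sq_int_integrable X : sq_int X -> P.-integrable setT (EFin \o X).
Proof.
move=> hX; have := sq_intM hX (sq_int_cst 1).
by under eq_fun do rewrite mulr1.
Qed.

Lemma sq_intZD (a : R) X Y : sq_int X -> sq_int Y -> sq_int (fun w => a * X w + Y w).
Proof.
move=> hX hY; have [mX iX] := hX; have [mY iY] := hY.
split; first by apply: measurable_funD => //; exact: measurable_funM.
have i := integrableD_EFin measurableT (integrableD_EFin measurableT
  (integrableZl_EFin measurableT (a ^+ 2) iX)
  (integrableZl_EFin measurableT (2 * a) (sq_intM hX hY))) iY.
move: i; congr (_.-integrable _ (_ \o _)); apply/funext => w; ring.
Qed.

Lemma sq_intZ (a : R) X : sq_int X -> sq_int (fun w => a * X w).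
Proof.
by move=> hX; have := sq_intZD a hX (sq_int_cst 0); under eq_fun do rewrite addr0.
Qed.

Lemma sq_intB X Y : sq_int X -> sq_int Y -> sq_int (fun w => X w - Y w).
Proof.
move=> hX hY; have := sq_intZD (-1) hY hX.
by congr sq_int; apply/funext => w; ring.
Qed.

Lemma RintegralZD (a : R) X Y : P.-integrable setT (EFin \o X) ->
  P.-integrable setT (EFin \o Y) ->
  \int[P]_w (a * X w + Y w) = a * \int[P]_w X w + \int[P]_w Y w.
Proof.
move=> iX iY; rewrite RintegralD//; last exact: integrableZl_EFin.
by rewrite RintegralZl.
Qed.

Lemma sq_intZDM (a : R) X Y Z : sq_int X -> sq_int Y -> sq_int Z ->
  \int[P]_w ((a * X w + Y w) * Z w) = a * \int[P]_w (X w * Z w) + \int[P]_w (Y w * Z w).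
Proof.
move=> hX hY hZ; rewrite -RintegralZD; try exact: sq_intM.
by apply: eq_Rintegral => w _; ring.
Qed.

Lemma sq_intZD_le (a : R) X Y : sq_int X -> sq_int Y ->
  \int[P]_w ((a * X w + Y w) ^+ 2) <=
  2 * a ^+ 2 * \int[P]_w (X w ^+ 2) + 2 * \int[P]_w (Y w ^+ 2).
Proof.
move=> hX hY; have [_ iX] := hX; have [_ iY] := hY; have [_ iXY] := sq_intZD a hX hY.
rewrite -RintegralZl// -RintegralZl//.
have i1 := integrableZl_EFin measurableT (2 * a ^+ 2) iX.
have i2 := integrableZl_EFin measurableT 2 iY.
rewrite -RintegralD//; apply: le_Rintegral => //.
  exact: integrableD_EFin.
move=> w _; rewrite -subr_ge0.
by rewrite [leRHS](_ : _ = (a * X w - Y w) ^+ 2) ?sqr_ge0//; ring.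
Qed.

Lemma Rintegral_sqr_ge0 X : 0 <= \int[P]_w (X w ^+ 2).
Proof. by apply: Rintegral_ge0 => w _; exact: sqr_ge0. Qed.

End square_integrable.

(** A substitute for the Cauchy-Schwarz inequality in L^2 limits: a product x y is bounded by eps
    x^2 + y^2 / eps, and eps is fixed before n grows. *)
Lemma cvg_am_gm {R : realType} (u : nat -> R) (l C : R) (a : nat -> R) :
  0 <= C -> a n @[n --> \oo] --> (0 : R) ->
  (forall n (eps : R), 0 < eps -> eps <= 1 -> `|u n - l| <= C * (eps + a n / eps)) ->
  u n @[n --> \oo] --> l.
Proof.
move=> C0 a0 ua; apply/cvgrPdist_le => /= e e0.
pose eps := Num.min 1 (e / (2 * (C + 1))).
have eps0 : 0 < eps.
  by rewrite lt_min ltr01/= divr_gt0// mulr_gt0// ltr_wpDl.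
have epse : C * eps <= e / 2.
  apply: (@le_trans _ _ ((C + 1) * (e / (2 * (C + 1))))).
    rewrite ler_pM ?(ltW eps0)//; first by rewrite lerDl.
    by rewrite ge_min lexx orbT.
  rewrite [leLHS](_ : _ = e / 2)//; field.
  by rewrite gt_eqF// ltr_wpDl.
have h : C * (a n / eps) @[n --> \oo] --> (0 : R).
  rewrite -[X in _ --> X](mulr0 C); apply: cvgM; first exact: cvg_cst.
  rewrite -[X in _ --> X](mul0r eps^-1); apply: cvgM => //; exact: cvg_cst.
near=> n; rewrite distrC (le_trans (ua n eps eps0 _))//.
  by rewrite ge_min lexx.
rewrite mulrDr [leRHS](splitr e) lerD//.
by near: n; move: h => /cvgr_le; apply; exact: divr_gt0.
Unshelve. all: by end_near. Qed.

(** * Centered Gaussian variables and their L^2 limits *)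

Section gaussian_space.
Context d {Omega : measurableType d} {R : realType} (P : probability Omega R).

(** The characteristic function at frequency 1 only, with the phase standing for its real and
    imaginary parts. Knowing the law requires the property for all multiples of [X], hence the
    quantifiers over [b] further on. *)
Definition centered_gaussian (X : Omega -> R) : Prop := sq_int P X /\
  forall th : R, \int[P]_w cos (X w + th) =
    expR (- (\int[P]_w (X w ^+ 2) / 2)) * cos th.

Lemma cos_lipschitz (x y : R) : `|cos x - cos y| <= `|x - y|.
Proof.
wlog yx : x y / y <= x.
  by move=> h; have [/h//|/ltW/h] := leP y x; rewrite distrC [leRHS]distrC.
have [c _ ->] := @MVT_segment R cos (fun z => - sin z) y x yx (fun z _ => is_derive_cos z)
  (continuous_subspaceT (@continuous_cos R)).
by rewrite normrM ler_piMl// normrN sin_max.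
Qed.

(** Convergence to 0 in the extended reals makes the expectation finite from some index on; one such
    index already puts [X] in L^2. *)
Lemma sq_int_lim (X : Omega -> R) (S : nat -> Omega -> R) :
  measurable_fun setT X -> (forall k, sq_int P (S k)) ->
  (fun k => 'E_P[fun w => ((S k w - X w) ^+ 2)%R]%E) @ \oo --> (0%E : \bar R) ->
  sq_int P X /\ (fun k => \int[P]_w ((S k w - X w) ^+ 2)) @ \oo --> (0 : R).
Proof.
move=> mX hS h; rewrite unlock in h.
have /fine_cvgP[[k0 _ hk] h1] := h.
have [k sk] : exists k, sq_int P (fun w => S k w - X w).
  exists k0; have [mS _] := hS k0; split; first exact: measurable_funB.
  apply/integrableP; split.
    by apply/measurable_EFinP; apply: measurable_funX; exact: measurable_funB.
  rewrite [X in (X < _)%E](_ : _ = (\int[P]_w ((S k0 w - X w) ^+ 2)%:E)%E).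
    by rewrite ltey_eq; have /= -> := hk k0 (leqnn _).
  by apply: eq_integral => w _; rewrite gee0_abs// lee_fin sqr_ge0.
split; last exact: h1.
have := sq_intB (hS k) sk; congr (sq_int P); apply/funext => w; ring.
Qed.

Lemma centered_gaussian_lim (X : Omega -> R) (S : nat -> Omega -> R) :
  sq_int P X -> (forall k, centered_gaussian (S k)) ->
  (fun k => \int[P]_w ((S k w - X w) ^+ 2)) @ \oo --> (0 : R) ->
  (fun k => \int[P]_w (S k w ^+ 2)) @ \oo --> \int[P]_w (X w ^+ 2) /\
  centered_gaussian X.
Proof.
move=> hX hS SX; have [mX iX] := hX.
have hD k : sq_int P (fun w => S k w - X w) by have [h _] := hS k; exact: sq_intB.
have iS k : P.-integrable setT (EFin \o (fun w => S k w ^+ 2)) by have [[]] := hS k.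
have iD k : P.-integrable setT (EFin \o (fun w => (S k w - X w) ^+ 2)) by have [] := hD k.
have var : (fun k => \int[P]_w (S k w ^+ 2)) @ \oo --> \int[P]_w (X w ^+ 2).
  (* The constant comes from |s^2 - x^2| <= eps x^2 + (1 + 1 / eps) (s - x)^2 together with 1 + 1 /
     eps <= 2 / eps for eps <= 1. *)
  apply: (@cvg_am_gm _ _ _ (\int[P]_w (X w ^+ 2) + 2)
     (fun k => \int[P]_w ((S k w - X w) ^+ 2))) => //.
    by rewrite addr_ge0// Rintegral_sqr_ge0.
  move=> k eps eps0 eps1; rewrite -RintegralB//.
  apply: (le_trans (le_normr_Rintegral _ _)) => //; first exact: integrableB_EFin.
  have i1 := integrableZl_EFin measurableT eps iX.
  have i2 := integrableZl_EFin measurableT (1 + eps^-1) (iD k).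
  apply: (@le_trans _ _ (\int[P]_w (eps * X w ^+ 2 + (1 + eps^-1) * (S k w - X w) ^+ 2))).
    apply: le_Rintegral => //.
    - by apply: integrable_norm; exact: integrableB_EFin.
    - exact: integrableD_EFin.
    move=> w _; set x := X w; set s := S k w.
    rewrite (_ : s ^+ 2 - x ^+ 2 = (s - x) ^+ 2 + 2 * x * (s - x)); last by ring.
    rewrite (le_trans (ler_normD _ _))// ger0_norm ?sqr_ge0//.
    have q : `|2 * x * (s - x)| <= eps * x ^+ 2 + eps^-1 * (s - x) ^+ 2.
      have e0 : eps != 0 by rewrite gt_eqF.
      rewrite ler_norml; apply/andP; split; rewrite -subr_ge0.
        rewrite [leRHS](_ : _ = eps^-1 * (eps * x + (s - x)) ^+ 2); last by field.
        by rewrite mulr_ge0 ?invr_ge0 ?sqr_ge0// ltW.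
      rewrite [leRHS](_ : _ = eps^-1 * (eps * x - (s - x)) ^+ 2); last by field.
      by rewrite mulr_ge0 ?invr_ge0 ?sqr_ge0// ltW.
    rewrite [leRHS](_ : _ = (s - x) ^+ 2 + (eps * x ^+ 2 + eps^-1 * (s - x) ^+ 2)); last by ring.
    by rewrite lerD2l.
  rewrite RintegralD// !RintegralZl//.
  have := Rintegral_sqr_ge0 P X; have := Rintegral_sqr_ge0 P (fun w => S k w - X w).
  move: (\int[P]_w ((S k w - X w) ^+ 2)) (\int[P]_w (X w ^+ 2)) => a v a0 v0.
  have ae0 : 0 <= a / eps by rewrite divr_ge0// ltW.
  have aae : a <= a / eps by rewrite ler_pdivlMr// ler_piMr.
  rewrite mulrDl mul1r [eps^-1 * a]mulrC; nra.
split => //; split => // th.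
have h1 : (fun k => \int[P]_w cos (S k w + th)) @ \oo --> \int[P]_w cos (X w + th).
  have icos (Y : Omega -> R) : measurable_fun setT Y -> P.-integrable setT (EFin \o (fun w => cos (Y w + th))).
    move=> mY; apply: (bounded_integrable P (C := 1)); first exact: measurable_cosD.
    by move=> w; exact: cos_max.
  apply: (@cvg_am_gm _ _ _ 1 (fun k => \int[P]_w ((S k w - X w) ^+ 2))) => //.
  move=> k eps eps0 eps1; have [[mS _] _] := hS k.
  rewrite mul1r -RintegralB//; try exact: icos.
  apply: (le_trans (le_normr_Rintegral _ _)) => //.
    by apply: integrableB_EFin => //; exact: icos.
  have i2 := integrableZl_EFin measurableT eps^-1 (iD k).
  have i3 : P.-integrable setT (EFin \o (fun=> eps)) by exact: finite_measure_integrable_cst.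
  apply: (@le_trans _ _ (\int[P]_w (eps + eps^-1 * (S k w - X w) ^+ 2))).
    apply: le_Rintegral => //.
    - by apply: integrable_norm; apply: integrableB_EFin => //; exact: icos.
    - exact: integrableD_EFin.
    move=> w _; apply: (le_trans (cos_lipschitz _ _)).
    rewrite opprD addrACA subrr addr0.
    set x := S k w - X w; rewrite -[x ^+ 2]real_normK ?num_real//.
    have := normr_ge0 x; move: `|x| => z z0.
    have e0 : eps != 0 by rewrite gt_eqF.
    rewrite -subr_ge0 [leRHS](_ : _ = eps^-1 * ((z - eps) ^+ 2 + eps * z)); last by field.
    by rewrite mulr_ge0 ?invr_ge0 ?(ltW eps0)// addr_ge0 ?sqr_ge0// mulr_ge0// ltW.
  rewrite RintegralD// RintegralZl// Rintegral_cst//.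
  rewrite (_ : fine (P setT) = 1); last by rewrite probability_setT.
  by rewrite mulr1 mulrC.
have h2 : (fun k => \int[P]_w cos (S k w + th)) @ \oo -->
    expR (- (\int[P]_w (X w ^+ 2) / 2)) * cos th.
  rewrite (_ : (fun k => _) = (fun k => expR (- (\int[P]_w (S k w ^+ 2) / 2)) * cos th)).
    apply: cvgM; last exact: cvg_cst.
    apply: (cvg_comp _ expR); last exact: continuous_expR.
    by apply: cvgN; apply: cvgM => //; exact: cvg_cst.
  by apply/funext => k; have [_ ->] := hS k.
exact: (cvg_unique _ h1 h2).
Qed.

Lemma gaussian_law_centered (S : {RV P >-> R}) :
  gaussian_law (distribution P S) -> sq_int P S -> \int[P]_w S w = 0 ->
  centered_gaussian S.
Proof.
move=> [m [s law]] hS ES0; split => // th.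
have mS : measurable_fun setT S by [].
have mX2 : measurable_fun setT (fun x : R => x ^+ 2) by exact: exprn_measurable.
have [_ iS2] := hS; have iS := sq_int_integrable hS.
have [s0|s0] := eqVneq s 0.
  have lawD : forall psi : R -> R, measurable_fun setT psi ->
      P.-integrable setT (EFin \o (psi \o S)) -> \int[P]_w psi (S w) = psi m.
    move=> psi mpsi ipsi; rewrite /Rintegral.
    rewrite -(integral_distribution (f := EFin \o psi))//; last exact/measurable_EFinP.
    rewrite (@eq_measure_integral _ _ _ _ (\d_m)); last first.
      by move=> A mA _; have := law A mA; rewrite s0 eqxx.
    by rewrite integral_dirac//; [rewrite diracT mul1e|exact/measurable_EFinP].
  have m0 : m = 0.
    by rewrite -ES0 (lawD id)//.
  rewrite (lawD (fun x => cos (x + th))).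
  - rewrite (lawD (fun x => x ^+ 2))//.
    by rewrite m0 expr0n/= mul0r oppr0 expR0 mul1r add0r.
  - by apply: measurable_cosD.
  - apply: (bounded_integrable P (C := 1)); first exact: measurable_cosD.
    by move=> w; exact: cos_max.
have lawN : forall psi : R -> R, measurable_fun setT psi ->
    P.-integrable setT (EFin \o (psi \o S)) ->
    \int[P]_w psi (S w) = \int[lebesgue_measure]_x (psi x * normal_pdf m s x).
  move=> psi mpsi ipsi; have mE : measurable_fun setT (EFin \o psi) by exact/measurable_EFinP.
  have mid : measurable_fun setT (fun x : measurableTypeR R => x : R) by [].
  (* [normal_prob] is a measure on [measurableTypeR R] and the distribution one on [R]; pushing
     forward by the identity reconciles the two types. *)
  have lawE (f : R -> \bar R) : (\int[distribution P S]_x f x =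
      \int[pushforward (normal_prob m s) (fun x : measurableTypeR R => x : R)]_x f x)%E.
    apply: eq_measure_integral => A mA _.
    by have := law A mA; rewrite (negbTE s0).
  have fin : (\int[normal_prob m s]_x `|(psi x)%:E| < +oo)%E.
    have mA : measurable_fun setT (fun x : R => `|(psi x)%:E|%E) by exact: measurableT_comp.
    have -> : (\int[normal_prob m s]_x `|(psi x)%:E| =
        \int[distribution P S]_x `|(psi x)%:E|)%E.
      by rewrite lawE ge0_integral_pushforward.
    rewrite ge0_integral_distribution//.
    by have [] := integrableP _ _ _ ipsi.
  rewrite /Rintegral -(integral_distribution (f := EFin \o psi))//.
  rewrite lawE integral_pushforward//; last first.
    by apply/integrableP; split.
  by rewrite integral_normal_prob.
have m0 : m = 0.
  by rewrite -(normal_pdf_mean m s0) -ES0 (lawN id).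
have var : \int[P]_w (S w ^+ 2) = s ^+ 2.
  rewrite (lawN (fun x => x ^+ 2))//.
  rewrite -(normal_pdf_variance m s0); apply: eq_Rintegral => x _.
  by rewrite m0 subr0.
rewrite var (lawN (fun x => cos (x + th))).
- rewrite -(normal_pdf_cos_center m s0); apply: eq_Rintegral => x _.
  by rewrite m0 subr0.
- exact: measurable_cosD.
- apply: (bounded_integrable P (C := 1)); first exact: measurable_cosD.
  by move=> w; exact: cos_max.
Qed.

End gaussian_space.

(** * Wiener integrals *)

Lemma step_fun_out {R : realType} (T : R) (c : seq (R * R)) (u : R) :
  nodes_in T c -> u \notin `[0, T] -> step_fun c u = 0.
Proof.
move=> /allP cT uT; rewrite /step_fun big_seq big1// => p /cT.
rewrite in_itv/= => /andP[p0 pT].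
rewrite indicE memNset ?mulr0//= in_itv/= => /andP[u0 up].
by move: uT; rewrite in_itv/= u0 (le_trans up pT).
Qed.

Section fbm_energy.
Context {R : realType} (H T : R).
Hypothesis hH : 1 / 2 < H < 1.
Local Notation mu := (@lebesgue_measure R).
Local Notation e := (2 * H - 2).
Local Notation TR := (measurableTypeR R).

Lemma hurst_exponent : -1 < e < 0.
Proof. by have /andP[h1 h2] := hH; apply/andP; split; lra. Qed.
Let e01 := hurst_exponent.

Lemma hurst_const_gt0 : 0 < H * (2 * H - 1).
Proof. by have /andP[h1 h2] := hH; rewrite mulr_gt0//; lra. Qed.

Lemma fbm_covE (t s : R) : riesz_finite e (\1_`[0, s] : TR -> R) ->
  riesz_finite e (\1_`[0, t] : TR -> R) ->
  fbm_cov H t s = H * (2 * H - 1) * riesz_energy e (\1_`[0, s]) (\1_`[0, t]).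
Proof.
move=> es et; rewrite /fbm_cov -(riesz_energy_iterated e01 es et); congr (_ * _).
rewrite Rintegral_mkcond; apply: eq_Rintegral => v _.
rewrite patchE [X in if X then _ else _](_ : _ = (v \in `[0, t]%classic))//.
rewrite [\1_`[0, t] v]indicE; case: ifP => vt.
  rewrite Rintegral_mkcond; apply: eq_Rintegral => u _.
  by rewrite patchE indicE; case: ifP => us; rewrite ?mulr1 ?mul1r ?mul0r.
rewrite -[LHS]/(0 : R); under eq_Rintegral do rewrite mulr0 mul0r.
by rewrite Rintegral_cst// mul0r.
Qed.

Lemma innerHE (f g : R -> R) : (forall u, u \notin `[0, T] -> f u = 0) ->
  (forall u, u \notin `[0, T] -> g u = 0) ->
  riesz_finite e (f : TR -> R) -> riesz_finite e (g : TR -> R) ->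
  innerH H T f g = H * (2 * H - 1) * riesz_energy e f g.
Proof.
move=> sf sg ef eg; rewrite /innerH -(riesz_energy_iterated e01 ef eg); congr (_ * _).
have memE (u : R) : (u \in `[0, T]%classic) = (u \in `[0, T]).
  by apply/idP/idP => [/set_mem//|?]; exact/mem_set.
rewrite Rintegral_mkcond; apply: eq_Rintegral => v _.
rewrite patchE memE; case: ifPn => vT.
  rewrite Rintegral_mkcond; apply: eq_Rintegral => u _.
  by rewrite patchE memE; case: ifPn => // uT; rewrite sf// mul0r mul0r.
under eq_Rintegral do rewrite (sg v vT) mulr0 mul0r.
by rewrite Rintegral_cst// mul0r.
Qed.

(** [mem_absH] says nothing directly about the integrability of [phi] itself; [riesz_finite_tensor]
    extracts it, using the interval without zeros. Vanishing outside [0, T] extends integrability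
    from the square to the plane. *)
Lemma mem_absH_finite (phi : R -> R) (a0 a1 : R) : 0 < T -> a0 < a1 ->
  (forall u, u \notin `[0, T] -> phi u = 0) ->
  (forall u, a0 < u < a1 -> phi u != 0) ->
  mem_absH H T phi -> riesz_finite e (phi : TR -> R).
Proof.
move=> T0 a01 supp phi0 [mphi iphi].
have memE (u : R) : (u \in `[0, T]%classic) = (u \in `[0, T]).
  by apply/idP/idP => [/set_mem//|?]; exact/mem_set.
have mphi' : measurable_fun setT (phi : TR -> R).
  have := (measurable_restrictT phi (measurable_itv `[0, T])).1 mphi.
  congr (measurable_fun _ _); apply/funext => u.
  by rewrite patchE memE; case: ifPn => // uT; rewrite supp.
apply: (@riesz_finite_tensor R _ e01 phi T a0 a1) => //.
have mTT : measurable (`[0, T]%classic `*` `[0, T]%classic : set (TR * TR)).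
  by apply: measurableX; exact: measurable_itv.
have := (integrable_mkcond _ mTT).1 iphi.
congr (_.-integrable _ _); apply/funext => -[u v] /=.
rewrite patchE; case: ifPn => //.
rewrite notin_setE/= => nuv; rewrite /riesz/=.
have [uT|uT] := boolP (u \in `[0, T]); last by rewrite supp// !mul0r.
have [vT|vT] := boolP (v \in `[0, T]); last by rewrite (supp v)// mulr0 mul0r.
by exfalso; apply: nuv.
Qed.

Lemma step_fun_cons (p : R * R) c :
  step_fun (p :: c) = (fun u => p.1 * \1_`[0, p.2] u + step_fun c u).
Proof. by apply/funext => u; rewrite /step_fun big_cons. Qed.

Lemma step_fun_nil : step_fun [::] = (fun=> 0 : R).
Proof. by apply/funext => u; rewrite /step_fun big_nil. Qed.

Lemma riesz_finite0 : riesz_finite e ((fun=> 0) : TR -> R).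
Proof.
split; first exact: (integrable0 mu setT).
rewrite [X in EFin \o X](_ : _ = fun=> 0); last first.
  by apply/funext => z; rewrite mul0r mul0r.
exact: (integrable0 (square_measure mu) setT).
Qed.

Hypothesis finite_indic : forall t, t \in `[0, T] ->
  riesz_finite e (\1_`[0, t] : TR -> R).

Lemma riesz_finite_step (c : seq (R * R)) : nodes_in T c ->
  riesz_finite e (step_fun c : TR -> R).
Proof.
elim: c => [_|p c IH /andP[pT cT]]; first by rewrite step_fun_nil; exact: riesz_finite0.
rewrite step_fun_cons.
exact: (riesz_finiteZD e01 p.1 (finite_indic pT) (IH cT)).
Qed.

Context d (Omega : measurableType d) (P : probability Omega R).
Context (W : R -> {RV P >-> R}).
Hypothesis hW : fractional_brownian_motion H T W.

Lemma step_integralE c (w : Omega) :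
  step_integral W c w = \sum_(p <- c) p.1 * W p.2 w.
Proof.
rewrite /step_integral; elim: c => [|p c IH]; first by rewrite !big_nil.
by rewrite !big_cons -IH.
Qed.

Lemma step_integral_cons p c (w : Omega) :
  step_integral W (p :: c) w = p.1 * W p.2 w + step_integral W c w.
Proof. by rewrite !step_integralE big_cons. Qed.

(** Kept in the extended reals: for [s = t] the finite right-hand side yields the
    square-integrability of [W t]. *)
Lemma fbm_covariance t s : t \in `[0, T] -> s \in `[0, T] ->
  (\int[P]_w (W t w * W s w)%:E = (fbm_cov H t s)%:E)%E.
Proof.
move=> tT sT; have [_ EW cW] := hW.
rewrite -(cW t s tT sT) unlock !EW//= unlock; apply: eq_integral => w _.
by rewrite !fctE /= !subr0.
Qed.

Lemma fbm_sq_int t : t \in `[0, T] -> sq_int P (W t).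
Proof.
move=> tT; split => //; apply/integrableP; split.
  by apply/measurable_EFinP; apply: measurable_funX.
rewrite [X in (X < _)%E](_ : _ = (\int[P]_w (W t w * W t w)%:E)%E).
  by rewrite fbm_covariance// ltry.
by apply: eq_integral => w _; rewrite gee0_abs ?expr2// lee_fin sqr_ge0.
Qed.

Lemma fbm_mean t : t \in `[0, T] -> \int[P]_w W t w = 0.
Proof.
by move=> tT; have [_ EW _] := hW; have := EW t tT; rewrite unlock /Rintegral => ->.
Qed.

Lemma step_integral_sq_int c : nodes_in T c -> sq_int P (step_integral W c).
Proof.
elim: c => [_|p c IH /andP[pT cT]].
  have := sq_int_cst P 0; congr sq_int; apply/funext => w.
  by rewrite step_integralE big_nil.
have := sq_intZD p.1 (fbm_sq_int pT) (IH cT).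
by congr sq_int; apply/funext => w; rewrite step_integral_cons.
Qed.

Lemma step_integral_mean c : nodes_in T c -> \int[P]_w step_integral W c w = 0.
Proof.
elim: c => [_|p c IH /andP[pT cT]].
  under eq_Rintegral do rewrite step_integralE big_nil.
  by rewrite Rintegral_cst// mul0r.
under eq_Rintegral do rewrite step_integral_cons.
rewrite RintegralZD ?fbm_mean ?IH ?mulr0 ?addr0//.
  exact: (sq_int_integrable (fbm_sq_int pT)).
exact: (sq_int_integrable (step_integral_sq_int cT)).
Qed.

(** Both sides expand bilinearly, down to the covariance of pairs of indicators; [one] peels one
    list against a single indicator, [two] one list against another. *)
Lemma step_integral_isometry c : nodes_in T c ->
  \int[P]_w (step_integral W c w ^+ 2) =
  H * (2 * H - 1) * riesz_energy e (step_fun c) (step_fun c).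
Proof.
move=> cT.
pose C := H * (2 * H - 1).
have riesz0l g : riesz_finite e g -> riesz_energy e (fun=> 0) g = 0.
  move=> eg; have := riesz_energyZDl e01 (-1) riesz_finite0 riesz_finite0 eg.
  by under [X in riesz_energy _ X]eq_fun do rewrite mulr0 addr0; move=> ->; ring.
have riesz0r g : riesz_finite e g -> riesz_energy e g (fun=> 0) = 0.
  move=> eg; have := riesz_energyZDr e01 (-1) riesz_finite0 riesz_finite0 eg.
  by under [X in riesz_energy _ _ X]eq_fun do rewrite mulr0 addr0; move=> ->; ring.
have one t c' : t \in `[0, T] -> nodes_in T c' ->
    \int[P]_w (step_integral W c' w * W t w) =
    C * riesz_energy e (\1_`[0, t]) (step_fun c').
  move=> tT; elim: c' => [_|p c' IH /andP[pT c'T]].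
    under eq_Rintegral do rewrite step_integralE big_nil mul0r.
    rewrite Rintegral_cst// mul0r step_fun_nil riesz0r ?mulr0//.
    exact: finite_indic.
  under eq_Rintegral do rewrite step_integral_cons.
  have fp := fbm_sq_int pT; have ft := fbm_sq_int tT.
  have fc := step_integral_sq_int c'T.
  rewrite (sq_intZDM _ fp fc ft) IH// step_fun_cons.
  have ip := finite_indic pT; have it := finite_indic tT.
  have ic := riesz_finite_step c'T.
  rewrite (riesz_energyZDr e01 _ ip ic it).
  rewrite [\int[P]_w (W p.2 w * W t w)](_ : _ = fbm_cov H p.2 t); last first.
    by rewrite /Rintegral fbm_covariance.
  by rewrite fbm_covE// -/C; ring.
have two c1 c2 : nodes_in T c1 -> nodes_in T c2 ->
    \int[P]_w (step_integral W c1 w * step_integral W c2 w) =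
    C * riesz_energy e (step_fun c1) (step_fun c2).
  move=> + c2T; elim: c1 => [_|p c1 IH /andP[pT c1T]].
    under eq_Rintegral do rewrite step_integralE big_nil mul0r.
    rewrite Rintegral_cst// mul0r step_fun_nil riesz0l ?mulr0//.
    exact: riesz_finite_step.
  under eq_Rintegral do rewrite step_integral_cons.
  rewrite (sq_intZDM _ (fbm_sq_int pT) (step_integral_sq_int c1T) (step_integral_sq_int c2T)).
  rewrite IH// step_fun_cons.
  rewrite (riesz_energyZDl e01 _ (finite_indic pT) (riesz_finite_step c1T) (riesz_finite_step c2T)).
  under eq_Rintegral do rewrite mulrC.
  by rewrite one// -/C; ring.
by rewrite -two//; apply: eq_Rintegral => w _; rewrite expr2.
Qed.

Lemma step_integral_gaussian c : nodes_in T c ->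
  centered_gaussian P (step_integral W c).
Proof.
move=> cT; have [gW _ _] := hW.
apply: gaussian_law_centered; [exact: gW|exact: step_integral_sq_int|].
exact: step_integral_mean.
Qed.

End fbm_energy.

Section wiener_integrals.
Context {R : realType} (H T : R).
Hypothesis hH : 1 / 2 < H < 1.
Local Notation e := (2 * H - 2).
Local Notation TR := (measurableTypeR R).
Let e01 : -1 < e < 0 := hurst_exponent hH.

(** The integrand of the scheme at the node [r]. For [al < 1] it is unbounded near [r], but its
    value at [r] itself is the default 0. *)
Definition riemann_liouville (al r : R) : TR -> R :=
  fun s => \1_`[0, r] s * (r - s) `^ (al - 1).

Lemma riemann_liouvilleE (al r s : R) : 0 <= s <= r ->
  riemann_liouville al r s = (r - s) `^ (al - 1).
Proof.
by move=> sr; rewrite /riemann_liouville indicE mem_set ?mul1r//= in_itv.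
Qed.

Lemma riemann_liouville_out (al r s : R) : s \notin `[0, r] ->
  riemann_liouville al r s = 0.
Proof. by move=> sr; rewrite /riemann_liouville indicE memNset ?mul0r//=; apply/negP. Qed.

Lemma riemann_liouville_supp (al r s : R) : r <= T -> s \notin `[0, T] ->
  riemann_liouville al r s = 0.
Proof.
move=> rT sT; apply: riemann_liouville_out; apply: contra sT.
by rewrite !in_itv/= => /andP[-> /le_trans->].
Qed.

Lemma riemann_liouville_finite (al r : R) : 0 < r -> r <= T ->
  mem_absH H T (riemann_liouville al r) -> riesz_finite e (riemann_liouville al r).
Proof.
move=> r0 rT; apply: (mem_absH_finite hH (lt_le_trans r0 rT) r0).
  by move=> u; exact: riemann_liouville_supp.
move=> u /andP[u0 ur]; rewrite riemann_liouvilleE ?(ltW u0) ?(ltW ur)//.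
by rewrite gt_eqF// powR_gt0// subr_gt0.
Qed.

(* The Wiener integrals only provide the finiteness of the energy of their
   integrands; the integrand at time [T] dominates the indicators. *)
Lemma indic_finite (al t : R) : al < 1 -> t \in `[0, T] ->
  riesz_finite e (riemann_liouville al T) -> riesz_finite e (\1_`[0, t] : TR -> R).
Proof.
move=> al1; rewrite in_itv/= => /andP[t0 tT]; set c := T `^ (1 - al).
(* On [0, T[ the kernel is at least T^(al - 1) = 1 / c. The point [T] is excepted because the kernel
   is 0 there by default. *)
apply: (@riesz_finite_le_ae _ _ e01 _ _ c T); first exact: powR_ge0.
  exact: (measurable_indic (D := setT) (measurable_itv `[0, t])).
move=> u uT; rewrite indicE; have [|ut] := boolP (u \in _); last first.
  by rewrite normr0 mulr_ge0// powR_ge0.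
rewrite inE/= in_itv/= => /andP[u0 ut].
have uT' : u < T by rewrite lt_neqAle (le_trans ut tT) andbT; apply/eqP.
rewrite riemann_liouvilleE ?u0 ?(ltW uT')// normr1 ger0_norm ?powR_ge0//.
have T0 : 0 < T := le_lt_trans u0 uT'.
apply: (@le_trans _ _ (c * T `^ (al - 1))).
  rewrite /c -powRD; last by apply/implyP => _; rewrite gt_eqF.
  by rewrite (_ : 1 - al + (al - 1) = 0) ?powRr0//; ring.
apply: ler_wpM2l; first exact: powR_ge0.
by apply: ler_npowR; rewrite ?subr_le0 ?(ltW al1)// ?subr_gt0// gerBl.
Qed.

Hypothesis finite_indic : forall t, t \in `[0, T] ->
  riesz_finite e (\1_`[0, t] : TR -> R).
Context d (Omega : measurableType d) (P : probability Omega R).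
Context (W : R -> {RV P >-> R}).
Hypothesis hW : fractional_brownian_motion H T W.

(** A form of [is_wiener_integral] stable under linear combinations: it uses [riesz_energy] instead
    of [innerH] and carries the support and finiteness conditions along. *)
Definition wiener_pair (phi : TR -> R) (X : Omega -> R) : Prop :=
  [/\ forall u, u \notin `[0, T] -> phi u = 0, riesz_finite e phi, sq_int P X &
   exists c : nat -> seq (R * R), [/\ forall k, nodes_in T (c k),
     (fun k => riesz_energy e (fun u => step_fun (c k) u - phi u)
                              (fun u => step_fun (c k) u - phi u)) @ \oo --> (0 : R) &
     (fun k => \int[P]_w ((step_integral W (c k) w - X w) ^+ 2)) @ \oo --> (0 : R)]].

Lemma riesz_finiteB (f g : TR -> R) : riesz_finite e f -> riesz_finite e g ->
  riesz_finite e (fun u => f u - g u).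
Proof.
move=> ef eg; have := riesz_finiteZD e01 (-1) eg ef.
by congr riesz_finite; apply/funext => u; ring.
Qed.

Lemma is_wiener_integral_pair (phi : TR -> R) (X : {RV P >-> R}) :
  (forall u, u \notin `[0, T] -> phi u = 0) -> riesz_finite e phi ->
  is_wiener_integral H T W phi X -> wiener_pair phi X.
Proof.
move=> supp ephi [_ [c [cT hc hX]]].
have [sX cX] : sq_int P X /\
    (fun k => \int[P]_w ((step_integral W (c k) w - X w) ^+ 2)) @ \oo --> (0 : R).
  apply: sq_int_lim => // k.
  exact: (step_integral_sq_int hW (cT k)).
split => //; exists c; split => //.
have C0 := hurst_const_gt0 hH.
set C := H * (2 * H - 1) in C0.
have E k : riesz_energy e (fun u => step_fun (c k) u - phi u)
    (fun u => step_fun (c k) u - phi u) =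
    C^-1 * innerH H T (step_fun (c k) \- phi) (step_fun (c k) \- phi).
  have es := riesz_finite_step hH finite_indic (cT k).
  have sD u : u \notin `[0, T] -> (step_fun (c k) \- phi) u = 0.
    by move=> uT; rewrite /= (step_fun_out (cT k) uT) (supp u uT) subr0.
  have h := innerHE hH sD sD (riesz_finiteB es ephi) (riesz_finiteB es ephi).
  apply/esym; transitivity (C^-1 * (C * riesz_energy e (fun u => step_fun (c k) u - phi u)
    (fun u => step_fun (c k) u - phi u))); first exact: congr1 h.
  by rewrite mulrA mulVf ?mul1r// gt_eqF.
rewrite (funext E) -[X in _ --> X](mulr0 C^-1).
by apply: cvgM => //; exact: cvg_cst.
Qed.

Lemma wiener_pair0 : wiener_pair (fun=> 0) (fun=> 0).
Proof.
have e0 := riesz_finite0 H; split => //; first exact: sq_int_cst.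
exists (fun=> [::]); split => //.
  rewrite (_ : (fun k : nat => _) = fun=> 0); first exact: cvg_cst.
  apply/funext => _; rewrite step_fun_nil.
  have -> : (fun u : TR => (0 : R) - 0) = fun=> 0 by apply/funext => u; rewrite subr0.
  have := riesz_energyZDl e01 (-1) e0 e0 e0.
  have -> : (fun u : TR => -1 * (0 : R) + 0) = fun=> 0.
    by apply/funext => u; rewrite mulr0 addr0.
  by move=> ->; ring.
rewrite (_ : (fun k : nat => _) = fun=> 0); first exact: cvg_cst.
apply/funext => _; under eq_Rintegral do rewrite step_integralE big_nil subr0 expr0n/=.
by rewrite Rintegral_cst// mul0r.
Qed.

Lemma step_fun_ZD (a : R) c1 c2 (u : R) :
  step_fun ([seq (a * p.1, p.2) | p <- c1] ++ c2) u = a * step_fun c1 u + step_fun c2 u.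
Proof.
rewrite /step_fun big_cat/= big_map mulr_sumr; congr (_ + _).
by apply: eq_bigr => p _; rewrite mulrA.
Qed.

Lemma step_integral_ZD (a : R) c1 c2 (w : Omega) :
  step_integral W ([seq (a * p.1, p.2) | p <- c1] ++ c2) w =
  a * step_integral W c1 w + step_integral W c2 w.
Proof.
rewrite !step_integralE big_cat/= big_map mulr_sumr; congr (_ + _).
by apply: eq_bigr => p _; rewrite mulrA.
Qed.

Lemma wiener_pairZD (a : R) phi psi X Y : wiener_pair phi X -> wiener_pair psi Y ->
  wiener_pair (fun u => a * phi u + psi u) (fun w => a * X w + Y w).
Proof.
move=> [sphi ephi hX [c1 [c1T cphi cX]]] [spsi epsi hY [c2 [c2T cpsi cY]]].
split.
- by move=> u uT; rewrite (sphi u uT) (spsi u uT) mulr0 addr0.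
- exact: (riesz_finiteZD e01 a ephi epsi).
- exact: sq_intZD.
exists (fun k => [seq (a * p.1, p.2) | p <- c1 k] ++ c2 k); split.
- move=> k; rewrite /nodes_in all_cat; apply/andP; split; last exact: c2T.
  by rewrite all_map; exact: c1T.
- apply: (@squeeze_cvgr _ _ _ _ (fun=> 0) (fun k =>
     2 * a ^+ 2 * riesz_energy e (fun u => step_fun (c1 k) u - phi u)
                                 (fun u => step_fun (c1 k) u - phi u) +
     2 * riesz_energy e (fun u => step_fun (c2 k) u - psi u)
                        (fun u => step_fun (c2 k) u - psi u))).
  + near=> k.
    have e1 := riesz_finiteB (riesz_finite_step hH finite_indic (c1T k)) ephi.
    have e2 := riesz_finiteB (riesz_finite_step hH finite_indic (c2T k)) epsi.
    have E : (fun u : TR => step_fun ([seq (a * p.1, p.2) | p <- c1 k] ++ c2 k) u -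
        (a * phi u + psi u)) =
        (fun u => a * (step_fun (c1 k) u - phi u) + (step_fun (c2 k) u - psi u)).
      by apply/funext => u; rewrite step_fun_ZD; ring.
    rewrite E; apply/andP; split; last exact: (riesz_energyZD_le e01 a e1 e2).
    exact: (riesz_energy_ge0 e01 (riesz_finiteZD e01 a e1 e2)).
  + exact: cvg_cst.
  + have -> : (0 : R) = 2 * a ^+ 2 * 0 + 2 * 0 by rewrite !mulr0 addr0.
    by apply: cvgD; apply: cvgM => //; exact: cvg_cst.
- apply: (@squeeze_cvgr _ _ _ _ (fun=> 0) (fun k =>
     2 * a ^+ 2 * \int[P]_w ((step_integral W (c1 k) w - X w) ^+ 2) +
     2 * \int[P]_w ((step_integral W (c2 k) w - Y w) ^+ 2))).
  + near=> k.
    have e1 := sq_intB (step_integral_sq_int hW (c1T k)) hX.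
    have e2 := sq_intB (step_integral_sq_int hW (c2T k)) hY.
    rewrite Rintegral_sqr_ge0/=; apply: le_trans (sq_intZD_le a e1 e2).
    rewrite le_eqVlt; apply/orP; left; apply/eqP; apply: eq_Rintegral => w _.
    by rewrite step_integral_ZD; ring.
  + exact: cvg_cst.
  + have -> : (0 : R) = 2 * a ^+ 2 * 0 + 2 * 0 by rewrite !mulr0 addr0.
    by apply: cvgD; apply: cvgM => //; exact: cvg_cst.
Unshelve. all: by end_near. Qed.

(** The energy of [phi] is at most twice that of the approximation error plus twice that of the step
    function; the first tends to 0, the second is a variance by the isometry and converges. The
    factor 2 is harmless for a lower bound on the variance. *)
Lemma wiener_pair_gaussian phi X : wiener_pair phi X ->
  centered_gaussian P X /\
  H * (2 * H - 1) * riesz_energy e phi phi <= 2 * \int[P]_w (X w ^+ 2).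
Proof.
move=> [supp ephi hX [c [cT cphi cX]]].
have gS k := step_integral_gaussian hW (cT k).
have [var gX] := centered_gaussian_lim hX gS cX; split => //.
have C0 := hurst_const_gt0 hH.
set C := H * (2 * H - 1) in C0 *.
pose D k := riesz_energy e (fun u => step_fun (c k) u - phi u)
                           (fun u => step_fun (c k) u - phi u).
have lim : (fun k => 2 * C * D k + 2 * \int[P]_w (step_integral W (c k) w ^+ 2))
    @ \oo --> 2 * C * 0 + 2 * \int[P]_w (X w ^+ 2).
  by apply: cvgD; apply: cvgM => //; exact: cvg_cst.
rewrite mulr0 add0r in lim.
apply: (cvgr_to_ge lim); near=> k.
have es := riesz_finite_step hH finite_indic (cT k).
rewrite (step_integral_isometry hH finite_indic hW (cT k)) -/C.
have := riesz_energyZD_le e01 (-1) (riesz_finiteB es ephi) es.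
have -> : (fun u => -1 * (step_fun (c k) u - phi u) + step_fun (c k) u) = phi.
  by apply/funext => u; ring.
rewrite -/(D k) sqrrN expr1n mulr1.
move: (riesz_energy e phi phi) (riesz_energy e _ _) (D k) => x y z h.
have := ler_wpM2l (ltW C0) h; rewrite mulrDr; lra.
Unshelve. all: by end_near. Qed.

Lemma wiener_pair_sum (I : Type) (s : seq I) (a : I -> R) (phi : I -> TR -> R)
    (X : I -> Omega -> R) : (forall i, wiener_pair (phi i) (X i)) ->
  wiener_pair (fun u => \sum_(i <- s) a i * phi i u) (fun w => \sum_(i <- s) a i * X i w).
Proof.
move=> hX; elim: s => [|i s IH].
  under eq_fun do rewrite big_nil.
  by under [X in wiener_pair _ X]eq_fun do rewrite big_nil; exact: wiener_pair0.
under eq_fun do rewrite big_cons.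
under [X in wiener_pair _ X]eq_fun do rewrite big_cons.
exact: wiener_pairZD.
Qed.

End wiener_integrals.

(** * Orthogonal projection and factorization of cosines *)

Section orthogonality.
Context d {Omega : measurableType d} {R : realType} (P : probability Omega R).

Lemma sq_int_sum (I : Type) (s : seq I) (a : I -> R) (Y : I -> Omega -> R) :
  (forall i, sq_int P (Y i)) -> sq_int P (fun w => \sum_(i <- s) a i * Y i w).
Proof.
move=> hY; elim: s => [|i s IH].
  by under eq_fun do rewrite big_nil; exact: sq_int_cst.
have := sq_intZD (a i) (hY i) IH.
by congr sq_int; apply/funext => w; rewrite big_cons.
Qed.

Lemma Rintegral_sumM (I : Type) (s : seq I) (a : I -> R) (Y : I -> Omega -> R) Z :
  (forall i, sq_int P (Y i)) -> sq_int P Z ->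
  \int[P]_w ((\sum_(i <- s) a i * Y i w) * Z w) =
  \sum_(i <- s) a i * \int[P]_w (Y i w * Z w).
Proof.
move=> hY hZ; elim: s => [|i s IH].
  under eq_Rintegral do rewrite big_nil mul0r.
  by rewrite Rintegral_cst// mul0r big_nil.
rewrite big_cons -IH -(sq_intZDM (a i) (hY i) (sq_int_sum s a hY) hZ).
by apply: eq_Rintegral => w _; rewrite big_cons.
Qed.

(* Gram-Schmidt: the residual of [Y m] on [Y 0], ..., [Y (m - 1)] is nonzero,
   which allows one to correct the residual of [X]. *)
Lemma orthogonal_projection (Y : nat -> Omega -> R) m :
  (forall i, (i < m)%N -> sq_int P (Y i)) ->
  (forall i (a : nat -> R), (i < m)%N ->
    0 < \int[P]_w ((Y i w - \sum_(j < i) a j * Y j w) ^+ 2)) ->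
  forall X, sq_int P X -> exists a : nat -> R, forall j, (j < m)%N ->
    \int[P]_w ((X w - \sum_(i < m) a i * Y i w) * Y j w) = 0.
Proof.
elim: m => [_ _ X hX|m IH hY pos X hX]; first by exists (fun=> 0).
have hY' i : (i < m)%N -> sq_int P (Y i) by move=> /ltnW; exact: hY.
have pos' i (a : nat -> R) : (i < m)%N ->
    0 < \int[P]_w ((Y i w - \sum_(j < i) a j * Y j w) ^+ 2).
  by move=> /ltnW; exact: pos.
have hm := hY m (ltnSn m).
have hYm (i : 'I_m) : sq_int P (Y i) by apply: hY'; exact: ltn_ord.
have hsum c : sq_int P (fun w => \sum_(i < m) c i * Y i w).
  exact: (sq_int_sum _ (fun i : 'I_m => c i) hYm).
have [a ha] := IH hY' pos' X hX.
have [b hb] := IH hY' pos' _ hm.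
pose Z w := X w - \sum_(i < m) a i * Y i w.
pose V w := Y m w - \sum_(i < m) b i * Y i w.
have hZ : sq_int P Z := sq_intB hX (hsum a).
have hV : sq_int P V := sq_intB hm (hsum b).
have V0 : 0 < \int[P]_w (V w * V w).
  by have := pos m b (ltnSn m); under eq_Rintegral do rewrite expr2.
(* Subtracting a multiple of [V] keeps the orthogonality to the earlier variables; [l] makes the
   result orthogonal to [V], hence to [Y m]. *)
pose l := \int[P]_w (Z w * V w) / \int[P]_w (V w * V w).
pose U w := - l * V w + Z w.
have hU : sq_int P U := sq_intZD (- l) hV hZ.
have UY j : (j < m)%N -> \int[P]_w (U w * Y j w) = 0.
  by move=> jm; rewrite (sq_intZDM _ hV hZ (hY' j jm)) (ha j jm) (hb j jm) mulr0 addr0.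
have UV : \int[P]_w (U w * V w) = 0.
  by rewrite (sq_intZDM _ hV hZ hV) /l mulNr divfK ?addNr// gt_eqF.
exists (fun i => if i == m then l else a i - l * b i) => j jm.
have UE w : X w - \sum_(i < m.+1) (if i == m :> nat then l else a i - l * b i) * Y i w = U w.
  rewrite big_ord_recr/= eqxx.
  rewrite (eq_bigr (fun i : 'I_m => a i * Y i w + - l * (b i * Y i w))); last first.
    by move=> i _; rewrite (ltn_eqF (ltn_ord i)); ring.
  by rewrite big_split/= -mulr_sumr /U /V /Z; ring.
under eq_Rintegral do rewrite UE.
move: jm; rewrite ltnS leq_eqVlt => /predU1P[->|]; last exact: UY.
transitivity (\int[P]_w ((1 * V w + \sum_(i < m) b i * Y i w) * U w)).
  by apply: eq_Rintegral => w _; rewrite /V mul1r subrK mulrC.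
rewrite (sq_intZDM _ hV (hsum b) hU).
rewrite (Rintegral_sumM _ (fun i : 'I_m => b i) hYm hU).
under eq_Rintegral do rewrite mulrC.
rewrite UV mulr0 add0r big1// => i _.
under eq_Rintegral do rewrite mulrC.
by rewrite UY ?mulr0.
Qed.

Lemma cos_mul (x y : R) : cos x * cos y = (cos (x + y) + cos (x - y)) / 2.
Proof. by rewrite cosB cosD; field. Qed.

(** Orthogonality gives [L + Z] and [L - Z] the same variance, the sum of the two; in the
    product-to-sum formula the common exponential then factors. *)
Lemma gaussian_cos_factor (L Z : Omega -> R) (th th' : R) :
  centered_gaussian P L -> centered_gaussian P Z ->
  (forall b, centered_gaussian P (fun w => b * Z w + L w)) ->
  \int[P]_w (L w * Z w) = 0 ->
  \int[P]_w (cos (L w + th) * cos (Z w + th')) =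
  (\int[P]_w cos (L w + th)) * (\int[P]_w cos (Z w + th')).
Proof.
move=> [hL gL] [hZ gZ] gLZ orth.
have var b : \int[P]_w ((b * Z w + L w) ^+ 2) =
    b ^+ 2 * \int[P]_w (Z w ^+ 2) + \int[P]_w (L w ^+ 2).
  have hbZ := sq_intZD b hZ hL; have [_ iZ] := hZ; have [_ iL] := hL.
  have iZL := sq_intM hL hZ.
  have iS := integrableD_EFin measurableT (integrableZl_EFin measurableT (b ^+ 2) iZ) iL.
  rewrite -RintegralZD// -[RHS]add0r -[X in X + _](mulr0 (2 * b)) -orth -RintegralZD//.
  by apply: eq_Rintegral => w _; ring.
have icos X th0 : sq_int P X -> P.-integrable setT (EFin \o (fun w => cos (X w + th0))).
  move=> [mX _]; apply: (bounded_integrable P (C := 1)); first exact: measurable_cosD.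
  by move=> w; exact: cos_max.
transitivity (2^-1 * \int[P]_w cos (1 * Z w + L w + (th + th')) +
    2^-1 * \int[P]_w cos (- 1 * Z w + L w + (th - th'))).
  rewrite -[X in _ + X]RintegralZl//; last by apply: icos; have [] := gLZ (-1).
  rewrite -RintegralZD; [|by apply: icos; have [] := gLZ 1|
    by apply: integrableZl_EFin => //; apply: icos; have [] := gLZ (-1)].
  apply: eq_Rintegral => w _; rewrite cos_mul.
  have -> : L w + th + (Z w + th') = 1 * Z w + L w + (th + th') by ring.
  have -> : L w + th - (Z w + th') = - 1 * Z w + L w + (th - th') by ring.
  by rewrite mulrC mulrDr.
have [_ ->] := gLZ 1; have [_ ->] := gLZ (-1).
rewrite !var gL gZ sqrrN expr1n mul1r.
move: (\int[P]_w (Z w ^+ 2)) (\int[P]_w (L w ^+ 2)) => vz vl.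
have -> : - ((vz + vl) / 2) = - (vl / 2) + - (vz / 2) by field.
rewrite expRD cosB cosD; by field.
Qed.

End orthogonality.

(** * The Gamma function *)

Lemma derivable_oo_LRcontinuous_gt0 {R : realType} (F : R -> R) (a b : R) :
  0 < a -> a < b -> (forall x, 0 < x -> derivable F x 1) -> derivable_oo_LRcontinuous F a b.
Proof.
move=> a0 ab dF; have cF x : 0 < x -> {for x, continuous F}.
  by move=> /dF h; apply/differentiable_continuous/derivable1_diffP.
split.
- by move=> x; rewrite in_itv/= => /andP[ax xb]; apply: dF; exact: lt_trans ax.
- by apply: cvg_at_right_filter; exact: cF.
- by apply: cvg_at_left_filter; apply: cF; exact: lt_trans ab.
Qed.

Section gamma.
Context {R : realType} (al : R).
Hypothesis al01 : 0 < al < 1.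
Local Notation mu := (@lebesgue_measure R).

Lemma integral_powR_itv (a : R) : 0 < a < 1 ->
  (\int[mu]_(t in `[a, 1%R]) (t `^ (al - 1))%:E <= (al^-1)%:E)%E.
Proof.
move=> /andP[a0 a1]; have /andP[al0 _] := al01.
have dF (x : R) : 0 < x -> is_derive x 1 (fun t : R => t `^ al / al) (x `^ (al - 1)).
  move=> x0; have h := is_derive1_powR al x0.
  apply: is_derive_eq; rewrite scaler0 add0r /GRing.scale/= mulrA mulVf ?mul1r//.
  by rewrite gt_eqF.
rewrite (@continuous_FTC2 _ _ (fun t => t `^ al / al))//.
- by rewrite -EFinB lee_fin powR1 mul1r gerBl divr_ge0 ?powR_ge0// ltW.
- apply: continuous_in_subspaceT => t; rewrite inE/= in_itv/= => /andP[at_ _].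
  have t0 := lt_le_trans a0 at_.
  apply/differentiable_continuous/derivable1_diffP.
  exact: (@ex_derive _ _ _ _ _ _ _ (is_derive1_powR (al - 1) t0)).
- apply: derivable_oo_LRcontinuous_gt0 => // x x0.
  exact: (@ex_derive _ _ _ _ _ _ _ (dF x x0)).
- move=> x; rewrite in_itv/= => /andP[ax _]; rewrite derive1E.
  exact: (@derive_val _ _ _ _ _ _ _ (dF x (lt_trans a0 ax))).
Qed.

Lemma integral_powR_near0 :
  (\int[mu]_(t in `]0%R, 1%R]) (t `^ (al - 1))%:E <= (al^-1)%:E)%E.
Proof.
(* The shift by 2 keeps the left endpoint strictly below 1, as [integral_powR_itv] requires. *)
pose A n : set R := `[n.+2%:R^-1, 1]%classic.
have -> : `]0%R, 1%R]%classic = \bigcup_n A n.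
  apply/seteqP; split=> [x /=|x [n _]]; rewrite /A/= !in_itv/=.
    move=> /andP[x0 x1]; have [n xn] := ltr_add_invr x0.
    exists n => //=; rewrite in_itv/= x1 andbT.
    rewrite add0r in xn; apply: le_trans (ltW xn).
    by rewrite lef_pV2 ?posrE// ler_nat.
  by move=> /andP[h ->]; rewrite andbT (lt_le_trans _ h)// invr_gt0.
apply: (@cvge_to_le _ _ _ _ _ _ _ (ge0_nondecreasing_set_cvg_integral _ _ _ _)).
- apply/nondecreasing_seqP => n; apply/subsetPset => x; rewrite /A/= !in_itv/=.
  move=> /andP[h ->]; rewrite andbT; apply: le_trans h.
  by rewrite lef_pV2 ?posrE// ler_nat.
- by move=> n; exact: measurable_itv.
- move=> n; apply/measurable_EFinP; apply: measurable_funTS.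
  exact: measurable_powR.
- by move=> n x _; rewrite lee_fin powR_ge0.
- apply: nearW => n; apply: integral_powR_itv.
  by rewrite invr_gt0 ltr0n/= invf_lt1// ltr1n.
Qed.

Let g (t : R) := t `^ (al - 1) * expR (- t).

Let g_ge0 t : 0 <= g t.
Proof. by rewrite mulr_ge0 ?powR_ge0 ?expR_ge0. Qed.

Let measurable_g D : measurable_fun D g.
Proof.
apply: measurable_funM; first by apply: measurable_funTS; exact: measurable_powR.
apply: measurable_funTS; apply: measurableT_comp; first exact: measurable_expR.
apply: continuous_measurable_fun => x; apply: cvgN; exact: cvg_id.
Qed.

(** Bounded by t^(al - 1) up to 1 and by the exponential density beyond. Finiteness matters for the
    sign: a divergent integral would make [Gamma al] equal to 0. *)
Lemma integral_Gamma_lty :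
  (\int[mu]_(t in `]0%R, +oo[) (g t)%:E < +oo)%E.
Proof.
have -> : `]0%R, +oo[%classic = `]0%R, 1%R]%classic `|` `]1%R, +oo[%classic :> set R.
  by rewrite -itv_bndbnd_setU// bnd_simp.
rewrite ge0_integral_setU//=; last first.
- apply/disj_setPS => x [] /=; rewrite !in_itv/= => /andP[_ x1].
  by rewrite andbT ltNge x1.
- by move=> x _; rewrite lee_fin g_ge0.
- by apply/measurable_EFinP; exact: measurable_g.
rewrite lte_add_pinfty//.
  apply: (@le_lt_trans _ _ (al^-1)%:E); last exact: ltry.
  apply: le_trans integral_powR_near0; apply: ge0_le_integral => //.
  - by move=> x _; rewrite lee_fin g_ge0.
  - by apply/measurable_EFinP; exact: measurable_g.
  - by apply/measurable_EFinP; apply: measurable_funTS; exact: measurable_powR.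
  - move=> x; rewrite /= in_itv/= => /andP[x0 _]; rewrite lee_fin /g.
    by rewrite ler_piMr ?powR_ge0// expR_le1 oppr_le0 ltW.
apply: (@le_lt_trans _ _ (\int[mu]_x (exponential_pdf 1 x)%:E)%E); last first.
  by rewrite integral_exponential_pdf ?ltry.
apply: (@le_trans _ _ (\int[mu]_(x in `]1%R, +oo[) (exponential_pdf 1 x)%:E)%E).
  apply: ge0_le_integral => //.
  - by move=> x _; rewrite lee_fin g_ge0.
  - by apply/measurable_EFinP; exact: measurable_g.
  - apply/measurable_EFinP; apply: measurable_funTS.
    exact: measurable_exponential_pdf.
  - move=> x; rewrite /= in_itv/= andbT => x1; have x0 : 0 < x by exact: lt_trans x1.
    rewrite lee_fin /g /exponential_pdf patchE mem_set; last first.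
      by rewrite /= in_itv/= andbT ltW.
    rewrite mul1r mulN1r ler_piMl ?expR_ge0//.
    have /andP[_ al1] := al01.
    have := @ler_npowR R (al - 1) 1 x _ ltr01 (ltW x1); rewrite powR1; apply.
    by rewrite subr_le0 ltW.
apply: ge0_subset_integral => //.
- apply/measurable_EFinP; exact: measurable_exponential_pdf.
- by move=> x _; rewrite lee_fin exponential_pdf_ge0.
Qed.

Lemma Gamma_gt0 : 0 < Gamma al.
Proof.
rewrite /Gamma /Rintegral; apply: fine_gt0; rewrite integral_Gamma_lty andbT.
(* Both factors of the integrand decrease, so its value at 2 is a lower bound on [1, 2]. *)
pose c : R := 2 `^ (al - 1) * expR (- 2).
have c0 : 0 < c by rewrite mulr_gt0 ?powR_gt0 ?expR_gt0.
apply: (@lt_le_trans _ _ c%:E); first by rewrite lte_fin.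
apply: (@le_trans _ _ (\int[mu]_(t in `[1%R, 2%R]) (g t)%:E)%E).
  have -> : c%:E = (\int[mu]_(t in `[1%R, 2%R]) c%:E)%E.
    have m12 : mu `[1%R, 2%R]%classic = 1%E.
      rewrite lebesgue_measure_itv/= lte_fin ltr1n -EFinD.
      by rewrite (_ : 2 - 1 = 1 :> R)//; ring.
    rewrite integral_cst//; transitivity (c%:E * 1)%E; first by rewrite mule1.
    by apply: (congr1 (fun x => (c%:E * x)%E)); exact: esym m12.
  apply: ge0_le_integral => //.
  - by move=> x _; rewrite lee_fin ltW.
  - by apply/measurable_EFinP; exact: measurable_g.
  move=> x; rewrite /= in_itv/= => /andP[x1 x2]; rewrite lee_fin /c /g.
  have /andP[_ al1] := al01.
  apply: ler_pM; rewrite ?powR_ge0 ?expR_ge0//; last by rewrite ler_expR lerN2.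
  by apply: ler_npowR => //; [rewrite subr_le0 ltW|exact: lt_le_trans x1].
apply: ge0_subset_integral => //.
- by apply/measurable_EFinP; exact: measurable_g.
- by move=> x _; rewrite lee_fin g_ge0.
- by move=> x; rewrite /= !in_itv/= andbT => /andP[x1 _]; exact: lt_le_trans x1.
Qed.

End gamma.

(** * Absolute continuity *)

Section absolute_continuity.
Context d {Omega : measurableType d} {R : realType} (P : probability Omega R).

(** The cosine transform identifies the law of [v + c * Z] with [normal_prob v s], which has a
    density. The parameter [s] has the sign of [c]; only [s != 0] is used. *)
Lemma affine_gaussian_null (Z : Omega -> R) (v c : R) (A : set R) :
  (forall b, centered_gaussian P (fun w => b * Z w)) ->
  0 < \int[P]_w (Z w ^+ 2) -> c != 0 ->
  measurable A -> lebesgue_measure A = 0%E -> P [set w | A (v + c * Z w)] = 0%E.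
Proof.
move=> gZ; set V := \int[P]_w (Z w ^+ 2) => V0 c0 mA A0.
have mZ : measurable_fun setT Z.
  have [[mZ _] _] := gZ 1; move: mZ; congr measurable_fun.
  by apply/funext => w; rewrite mul1r.
pose s := c * Num.sqrt V.
have s0 : s != 0 by rewrite mulf_neq0// gt_eqF// sqrtr_gt0.
have sE : s ^+ 2 = c ^+ 2 * V by rewrite exprMn sqr_sqrtr// ltW.
have mX : measurable_fun setT (fun w => v + c * Z w).
  by apply: measurable_funD => //; exact: measurable_funM.
pose X1 : {RV P >-> R} := mfun_Sub (mem_set mX).
have mid : @measurable_fun _ _ (measurableTypeR R) R setT id by [].
pose X2 : {RV (normal_prob v s) >-> R} :=
  @mfun_Sub _ _ (measurableTypeR R) R id (mem_set mid).
have X1E w : X1 w = v + c * Z w by [].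
have X2E x : X2 x = x by [].
change (distribution P X1 A = 0%E).
rewrite (distribution_eq_cos (X2 := X2))//.
  change (normal_prob v s A = 0%E).
  by have /null_content_dominatesP := normal_prob_dominates v s; apply.
move=> b th.
have -> : \int[P]_w cos (b * X1 w + th) = \int[P]_w cos (b * c * Z w + (b * v + th)).
  by apply: eq_Rintegral => w _; rewrite X1E; congr cos; ring.
have [_ ->] := gZ (b * c).
have [_ iZ] : sq_int P Z.
  have [hZ _] := gZ 1; move: hZ; congr sq_int.
  by apply/funext => w; rewrite mul1r.
have -> : \int[P]_w ((b * c * Z w) ^+ 2) = s ^+ 2 * b ^+ 2.
  under eq_Rintegral do rewrite exprMn.
  by rewrite RintegralZl// sE -/V; ring.
rewrite -(normal_pdf_cos v s0) /Rintegral integral_normal_prob.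
- congr fine; apply: eq_integral => x _; rewrite X2E -EFinM.
  by congr (cos _ * _)%:E; ring.
- by apply/measurable_EFinP; apply: measurable_cosD; exact: measurable_funM.
- have /integrableP[_] : (normal_prob v s).-integrable setT
      (EFin \o (fun x => cos (b * X2 x + th))).
    apply: (bounded_integrable _ (C := 1)); last by move=> w; exact: cos_max.
    by apply: measurable_cosD; exact: measurable_funM.
  by [].
Qed.

(* Conditionally on [V] the sum is [v + c Z], so Fubini's theorem applies. *)
Lemma independent_sum_null (V : Omega -> R) (Z : {RV P >-> R}) (c : R) (A : set R) :
  measurable_fun setT V ->
  (forall B D : set R, measurable B -> measurable D ->
    P (V @^-1` B `&` Z @^-1` D) = (P (V @^-1` B) * P (Z @^-1` D))%E) ->
  measurable A -> (forall v, P [set w | A (v + c * Z w)] = 0%E) ->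
  P [set w | A (V w + c * Z w)] = 0%E.
Proof.
move=> mV indep mA null.
have mZ : measurable_fun setT Z by [].
have mVZ : measurable_fun setT (fun w => (V w, Z w)) by exact: measurable_fun_pair.
pose V' : {RV P >-> R} := mfun_Sub (mem_set mV).
pose VZ : {mfun Omega >-> (R * R)%type} := mfun_Sub (mem_set mVZ).
pose E : set (R * R) := [set x | A (x.1 + c * x.2)].
have mE : measurable E.
  have h : measurable_fun setT (fun x : R * R => x.1 + c * x.2).
    by apply: measurable_funD => //; exact: measurable_funM.
  by rewrite -[X in measurable X]setTI; exact: h.
have prod := @product_measure_unique _ _ _ _ _ (distribution P V') (distribution P Z)
  (distribution P VZ) indep E mE.
change (distribution P VZ E = 0%E); rewrite -prod.
rewrite /product_measure1 integral0_eq// => v _.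
change (P (Z @^-1` xsection E v) = 0%E); rewrite -(null v); congr (P _).
by apply/seteqP; split => w; rewrite /preimage/= /xsection/= inE.
Qed.

End absolute_continuity.

Section gaussian_orthogonality.
Context d {Omega : measurableType d} {R : realType} (P : probability Omega R).
Context (n : nat) (Y : 'I_n -> Omega -> R) (Z : {RV P >-> R}).

Lemma gaussian_orthogonal_independent (B : set Omega) (D : set R) :
  (forall a b, centered_gaussian P (fun w => b * Z w + \sum_(i < n) a i * Y i w)) ->
  (forall i, sq_int P (Y i)) -> (forall i, \int[P]_w (Y i w * Z w) = 0) ->
  <<s orthants Y >> B -> measurable D ->
  P (B `&` Z @^-1` D) = (P B * P (Z @^-1` D))%E.
Proof.
move=> gYZ hY orth; apply: orthants_independent => [i|a b th th'].
  by have [] := hY i.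
have gY : centered_gaussian P (fun w => \sum_(i < n) a i * Y i w).
  have := gYZ a 0; congr centered_gaussian.
  by apply/funext => w; rewrite mul0r add0r.
have gZ c : centered_gaussian P (fun w => c * Z w).
  have := gYZ (fun=> 0) c; congr centered_gaussian.
  by apply/funext => w; rewrite big1 ?addr0// => i _; rewrite mul0r.
apply: gaussian_cos_factor; [exact: gY|exact: gZ|move=> c|].
  have := gYZ a (c * b); congr centered_gaussian.
  by apply/funext => w; rewrite mulrA.
have hZ : sq_int P Z.
  have [hZ _] := gZ 1; move: hZ; congr sq_int.
  by apply/funext => w; rewrite mul1r.
rewrite (Rintegral_sumM _ _ hY (sq_intZ b hZ)) big1// => i _.
have -> : \int[P]_w (Y i w * (b * Z w)) = b * \int[P]_w (Y i w * Z w).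
  rewrite -RintegralZl//; last exact: (sq_intM (hY i) hZ).
  by apply: eq_Rintegral => w _; ring.
by rewrite orth mulr0 mulr0.
Qed.

(** The preimage of a half-line is an orthant with a single constraint. *)
Lemma orthants_measurable_fun (i : 'I_n) :
  measurable_fun setT (Y i : g_sigma_algebraType (orthants Y) -> R).
Proof.
apply: (measurability _ (RGenOInfty.measurableE R)).
move=> _ [_ [c ->] <-]; apply: sub_sigma_algebra; exists [:: (i, c)].
by apply/seteqP; split => w /=; rewrite in_itv/= !andbT => // -[].
Qed.

End gaussian_orthogonality.

(** * The Euler-Maruyama scheme *)

Lemma g_sigma_algebra_measurable_fun d {Omega : measurableType d} {R : realType}
    (G : set (set Omega)) (V : Omega -> R) : G `<=` measurable ->
  measurable_fun setT (V : g_sigma_algebraType G -> R) -> measurable_fun setT V.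
Proof.
move=> sG mV _ A mA; rewrite setTI.
have : <<s G >> (V @^-1` A) by have := mV measurableT A mA; rewrite setTI.
by apply: smallest_sub => //; exact: sigma_algebra_measurable.
Qed.

Lemma Cb_measurable {R : realType} (f : R -> R) : Cb 1 f -> measurable_fun setT f.
Proof.
move=> /(_ 0%N isT)[df _ _]; apply: continuous_measurable_fun => y.
by apply/differentiable_continuous/derivable1_diffP; exact: df.
Qed.

Theorem theorem2p3 (R : realType)
    (d : measure_display) (Omega : measurableType d) (P : probability Omega R)
    (T : R) (T_gt0 : 0 < T)
    (F : R -> set (set Omega)) (hF : usual_conditions P T F)
    (H : R) (hH : 1 / 2 < H < 1)
    (W : R -> {RV P >-> R}) (hW : fractional_brownian_motion H T W)
    (alpha : R) (halpha : 1 - H < alpha < 1)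
    (sigma : R) (sigma_neq0 : sigma != 0)
    (x0 : R) (f : R -> R) (hf : Cb 1 f)
    (N : nat) (N_ge1 : (1 <= N)%N)
    (h : R) (hh : h = T / N%:R)
    (t : nat -> R) (ht : forall n, t n = n%:R * h)
    (I : nat -> {RV P >-> R})
    (hI : forall n, (1 <= n <= N)%N ->
      is_wiener_integral H T W
        (fun s => \1_`[0, t n] s * (t n - s) `^ (alpha - 1)) (I n))
    (x : nat -> {RV P >-> R})
    (hx0 : forall w, x 0%N w = x0)
    (hx : forall n, (1 <= n <= N)%N -> \forall w \ae P,
      x n w = x0
        + 1 / Gamma alpha *
          (\sum_(1 <= j < n.+1) f (x j.-1 w) *
             \int[lebesgue_measure]_(s in `[t j.-1, t j])
               ((t n - s) `^ (alpha - 1)))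
        + sigma / Gamma alpha * I n w) :
  forall n, (1 <= n <= N)%N -> distribution P (x n) `<< lebesgue_measure.
Proof.
move=> n /andP[n1 nN].
have /andP[h1 h2] := hH; have /andP[h3 al1] := halpha.
have al0 : 0 < alpha by lra.
have N0 : 0 < N%:R :> R by rewrite ltr0n.
have h0 : 0 < h by rewrite hh divr_gt0.
have tN : t N = T by rewrite ht hh mulrCA mulfV ?mulr1// gt_eqF.
have t0 k : (0 < k)%N -> 0 < t k by move=> k0; rewrite ht mulr_gt0// ltr0n.
have t_le i j : (i <= j)%N -> t i <= t j.
  by move=> ij; rewrite !ht ler_wpM2r ?(ltW h0)// ler_nat.
have tT k : (k <= N)%N -> t k <= T by move=> /t_le; rewrite tN.
have e01 := hurst_exponent hH.
pose phi k := riemann_liouville alpha (t k).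
have finphi k : (1 <= k <= N)%N -> riesz_finite (2 * H - 2) (phi k).
  move=> kN; have [k1 k2] := andP kN.
  exact: (riemann_liouville_finite hH (t0 _ k1) (tT _ k2) (proj1 (hI k kN))).
(* The last node is [T], so its kernel dominates the indicators on the whole of [0, T]. *)
have finind s : s \in `[0, T] -> riesz_finite (2 * H - 2) (\1_`[0, s] : measurableTypeR R -> R).
  move=> sT; have := finphi N; rewrite /phi tN N_ge1 leqnn => /(_ isT).
  exact: indic_finite.
have wp k : (1 <= k <= N)%N -> wiener_pair H T W (phi k) (I k).
  move=> kN; have [k1 k2] := andP kN.
  apply: (is_wiener_integral_pair hH finind hW _ (finphi k kN) (hI k kN)).
  by move=> u; apply: riemann_liouville_supp; exact: tT.
(* From here on [n = m.+1] and [Y i = I i.+1]: the integral [Y m] is projected on [Y 0], ...,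
   [Y (m - 1)]. *)
case: n n1 nN => // m _ mN.
pose Y i : Omega -> R := I i.+1.
have wpY i : (i <= m)%N -> wiener_pair H T W (phi i.+1) (Y i).
  by move=> im; apply: wp; rewrite ltnS (leq_trans _ mN).
have hY i : (i <= m)%N -> sq_int P (Y i) by move=> /wpY[].
have wpres i (a : nat -> R) : (i <= m)%N -> wiener_pair H T W
    (fun u => -1 * (\sum_(j < i) a j * phi j.+1 u) + phi i.+1 u)
    (fun w => -1 * (\sum_(j < i) a j * Y j w) + Y i w).
  move=> im; apply: (wiener_pairZD hH finind hW (-1) _ (wpY i im)).
  apply: (wiener_pair_sum hH finind hW _ (fun j : 'I_i => a j)) => j.
  by apply: wpY; exact: leq_trans (ltnW (ltn_ord j)) im.
have pos i (a : nat -> R) : (i <= m)%N ->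
    0 < \int[P]_w ((Y i w - \sum_(j < i) a j * Y j w) ^+ 2).
  move=> im; have wpi := wpres i a im.
  have [_ hle] := wiener_pair_gaussian hH finind hW wpi.
  have [_ efin _ _] := wpi.
  have -> : \int[P]_w ((Y i w - \sum_(j < i) a j * Y j w) ^+ 2) =
      \int[P]_w ((-1 * (\sum_(j < i) a j * Y j w) + Y i w) ^+ 2).
    by apply: eq_Rintegral => w _; congr (_ ^+ 2); ring.
  have ti : t i < t i.+1 by rewrite !ht ltr_pM2r// ltr_nat.
  (* On ]t_i, t_(i+1)[ the earlier kernels vanish whatever their coefficients, and (t_(i+1) -
     u)^(alpha - 1) >= h^(alpha - 1) since alpha < 1. *)
  have c0 : 0 < h `^ (alpha - 1) by rewrite powR_gt0.
  have := riesz_energy_gt0 e01 efin ti c0 => epos.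
  rewrite -(pmulr_rgt0 _ (ltr0n R 2)); apply: lt_le_trans hle.
  rewrite mulr_gt0 ?hurst_const_gt0//; apply: epos => u /andP[iu ui].
  have ti0 : 0 <= t i by rewrite ht mulr_ge0// ltW.
  rewrite big1 ?mulr0 ?add0r; last first.
    move=> j _; rewrite /phi riemann_liouville_out ?mulr0//.
    rewrite in_itv/= negb_and -!ltNge; apply/orP; right.
    by apply: le_lt_trans iu; apply: t_le.
  rewrite /phi riemann_liouvilleE ?(ltW ui) ?(le_trans ti0 (ltW iu))//.
  apply: ler_npowR; rewrite ?subr_gt0 ?subr_le0 ?(ltW al1)//.
  have -> : t i.+1 = h + t i by rewrite !ht -natr1; ring.
  by rewrite lerBlDr lerD2l ltW.
have hYm i : (i < m)%N -> sq_int P (Y i) by move=> /ltnW; exact: hY.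
have posm i (a : nat -> R) : (i < m)%N ->
    0 < \int[P]_w ((Y i w - \sum_(j < i) a j * Y j w) ^+ 2).
  by move=> /ltnW im; exact: (pos i a im).
have [a ha] := orthogonal_projection hYm posm (hY m (leqnn m)).
pose z w := Y m w - \sum_(i < m) a i * Y i w.
have [zeta wpz] : exists zeta, wiener_pair H T W zeta z.
  have := wpres m a (leqnn m); set zeta := (fun u => _) => wpm.
  exists zeta; move: wpm; congr wiener_pair.
  by apply/funext => w; rewrite /z; ring.
have [mz _] : sq_int P z by have [] := wpz.
pose Z : {RV P >-> R} := mfun_Sub (mem_set mz).
have ZE : (Z : Omega -> R) = z by [].
pose Yo (i : 'I_m) : Omega -> R := Y i.
have gYZ (c : 'I_m -> R) b :
    centered_gaussian P (fun w => b * Z w + \sum_(i < m) c i * Yo i w).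
  have wpc := wiener_pair_sum hH finind hW (index_enum 'I_m) c
    (fun i => wpY i (ltnW (ltn_ord i))).
  by have [] := wiener_pair_gaussian hH finind hW
    (wiener_pairZD hH finind hW b wpz wpc).
have hYo i : sq_int P (Yo i) by apply: hYm.
have orth i : \int[P]_w (Yo i w * Z w) = 0.
  by rewrite -(ha i (ltn_ord i)); apply: eq_Rintegral => w _; rewrite mulrC.
pose G := g_sigma_algebraType (orthants Yo).
have mf := Cb_measurable hf.
pose drift k (V : nat -> Omega -> R) w := x0 + 1 / Gamma alpha *
  (\sum_(1 <= j < k.+1) f (V j.-1 w) *
     \int[lebesgue_measure]_(s in `[t j.-1, t j]) ((t k - s) `^ (alpha - 1))).
have mdrift k V : (forall i, measurable_fun setT (V i : G -> R)) ->
    measurable_fun setT (drift k V : G -> R).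
  move=> mV; apply: measurable_funD => //; apply: measurable_funM => //.
  apply: measurable_sum => j; apply: measurable_funM => //.
  exact: (measurableT_comp mf (mV j.-1)).
have driftE k V w : (forall i, (i < k)%N -> x i w = V i w) ->
    drift k (fun i => x i) w = drift k V w.
  move=> xV; rewrite /drift; congr (_ + _ * _); apply: eq_big_nat => j /andP[j1 jk].
  by rewrite xV// -ltnS prednK.
have mYo i : measurable_fun setT (Yo i : G -> R) by exact: orthants_measurable_fun.
(* The recursion holds only almost surely, so the [x i] with [i <= m] get versions that are exactly
   [G]-measurable, built along the recursion: [x i] calls on the integrals [Y 0], ..., [Y (i - 1)]
   only. *)
have [V [mV xV]] : exists V : nat -> Omega -> R,
    (forall i, measurable_fun setT (V i : G -> R)) /\
    \forall w \ae P, forall i, (i <= m)%N -> x i w = V i w.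
  suff : forall k, (k <= m)%N -> exists V : nat -> Omega -> R,
      (forall i, measurable_fun setT (V i : G -> R)) /\
      \forall w \ae P, forall i, (i <= k)%N -> x i w = V i w.
    by apply.
  elim=> [_|k IH km].
    exists (fun _ _ => x0); split => //; apply/aeW => w i.
    by rewrite leqn0 => /eqP ->.
  have [V [mV xV]] := IH (ltnW km).
  pose V' w := drift k.+1 V w + sigma / Gamma alpha * Yo (Ordinal km) w.
  exists (fun i => if i == k.+1 then V' else V i); split.
    move=> i; case: ifP => // _; apply: measurable_funD; first exact: mdrift.
    by apply: measurable_funM => //; exact: mYo.
  have kN : (1 <= k.+1 <= N)%N by rewrite /= (leq_trans km)// ltnW.
  apply: filterS2 xV (hx k.+1 kN) => w xVw xkw i.
  case: eqVneq => [->|ik] ik1; last by apply: xVw; rewrite -ltnS ltn_neqAle ik.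
  by rewrite xkw /V' -(driftE k.+1 V w)// => j; rewrite ltnS; exact: xVw.
have Gam : Gamma alpha != 0 by rewrite gt_eqF// Gamma_gt0// al0.
pose c := sigma / Gamma alpha.
have c0 : c != 0 by rewrite mulf_neq0// invr_eq0.
(* The drift at [m.+1] involves only [V 0], ..., [V m]; adding the projection of the last integral
   keeps [U] measurable for [G] and leaves [c * Z]. *)
pose U w := drift m.+1 V w + c * \sum_(i < m) a i * Yo i w.
have mU : measurable_fun setT (U : G -> R).
  apply: measurable_funD; first exact: mdrift.
  apply: measurable_funM => //; apply: measurable_sum => i.
  by apply: measurable_funM => //; exact: mYo.
have xU : \forall w \ae P, x m.+1 w = U w + c * Z w.
  have mN1 : (1 <= m.+1 <= N)%N by [].
  apply: filterS2 xV (hx m.+1 mN1) => w xVw ->.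
  rewrite -[X in X + _]/(drift m.+1 (fun i => x i) w) (driftE m.+1 V w)//.
  rewrite /U ZE /z /Yo; move: (\sum_(i < m) a i * Y i w) => S.
  by rewrite /c /Y; ring.
apply/null_content_dominatesP => A mA A0.
have gZ b : centered_gaussian P (fun w => b * Z w).
  have : centered_gaussian P (fun w => b * z w + 0).
    by have [] := wiener_pair_gaussian hH finind hW
    (wiener_pairZD hH finind hW b wpz (wiener_pair0 T hH W)).
  by congr centered_gaussian; apply/funext => w; rewrite addr0.
have sG : orthants Yo `<=` measurable.
  by apply: orthants_measurable => i; have [] := hYo i.
have nullU : P [set w | A (U w + c * Z w)] = 0%E.
  apply: (@independent_sum_null _ _ _ P U Z c A) => //.
  - exact: (g_sigma_algebra_measurable_fun sG mU).
  - move=> B D mB mD; apply: (gaussian_orthogonal_independent gYZ hYo orth) => //.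
    by have := mU measurableT B mB; rewrite setTI.
  - by move=> v; apply: affine_gaussian_null => //; exact: pos.
have mx : measurable (x m.+1 @^-1` A).
  by rewrite -[X in measurable X]setTI; exact: (measurable_funPT (x m.+1)).
change (P (x m.+1 @^-1` A) = 0%E); apply: measure_negligible => //.
have mUZ : measurable [set w | A (U w + c * Z w)].
  have mUZ : measurable_fun setT (fun w => U w + c * Z w).
    apply: measurable_funD; first exact: (g_sigma_algebra_measurable_fun sG mU).
    exact: measurable_funM.
  by rewrite -[X in measurable X]setTI; exact: mUZ.
have nU : P.-negligible [set w | A (U w + c * Z w)] by exact/negligibleP.
(* Either the almost sure decomposition fails, or the value of [x m.+1] is that of [U + c * Z]. *)
apply: negligibleS (negligibleU xU nU) => w /= Aw.
by have [xw|xw] := pselect (x m.+1 w = U w + c * Z w); [right; rewrite /= -xw|left].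
Qed.
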